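(* Let $b$ be a prime, $s,m\in\mathbb N$, $\beta>0$, and let $\mathcal S$ be an $s$-dimensional generalized Niederreiter sequence in base $b$ that is $(\log n)^{1+\beta}$-reduced. Let $\mathcal I_{m,\mathcal S}(f)$ be the coarsely scrambled estimator based on the first $b^m$ points of $\mathcal S$. Then for every $f\in L^2((0,1)^s)$, $$\operatorname{Var}\left(\mathcal I_{m,\mathcal S}(f)\right)\le \frac{\Gamma(\mathcal I_{m,\mathcal S})}{b^m}\,\sigma_{MC}^2(f)\le \frac{C_\beta}{b^m}\,\sigma_{MC}^2(f),$$ where $$C_\beta=\exp\left(2+\frac{1}{2(\log 2)^{1+\beta}}+\frac{1}{\beta(\log 2)^\beta}\right).$$
   Context: Functions are real valued on $(0,1)^s$; $I(f)=\int_{(0,1)^s}f(\boldsymbol x)\,d\boldsymbol x$ and $\sigma_{MC}^2(f)=\int_{(0,1)^s}f(\boldsymbol x)^2d\boldsymbol x-I(f)^2$. $\log$ is the natural logarithm. The field $\mathbb F_b$ is identified with $\{0,\dots,b-1\}$ with arithmetic modulo $b$. Generalized Niederreiter sequence (GNS): let $p_1,\dots,p_s\in\mathbb F_b[x]$ be monic pairwise coprime polynomials (the base polynomials), $e_j=\deg p_j$. For $1\le j\le s$ and $k\in\mathbb N$ put $k_j=\lfloor (k-1)/e_j\rfloor$, and let $y_k^{(j)}\in\mathbb F_b[x]$ be such that, for each $t\ge1$, the residues $y_k^{(j)}\bmod p_j$ for $(t-1)e_j\le k-1<te_j$ are linearly independent over $\mathbb F_b$. Expand $y_k^{(j)}(x)/p_j(x)^t=\sum_{r\ge1}a^{(j)}(t,k,r)x^{-r}$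 in $\mathbb F_b((x^{-1}))$. The GNS $\mathcal S$ is the digital sequence with generating matrices $C_j=(c^{(j)}_{k,r})_{k,r\in\mathbb N}$, $c^{(j)}_{k,r}=a^{(j)}(k_j+1,k,r)$: for $n\in\mathbb N_0$ with base-$b$ digits $n=\eta_0+\eta_1b+\cdots$ and $\vec n=(\eta_0,\eta_1,\dots)^\top$, the $n$-th point has $j$-th coordinate $\phi_b(C_j\vec n)$, where $\phi_b(\vec z)=\sum_{r\ge1}z_rb^{-r}$ for $\vec z\in\mathbb F_b^{\mathbb N}$. Reduced GNS: for a positive sequence $a(n)$, $n\ge2$, a GNS is $a(n)$-reduced if its base polynomials are irreducible and, for each degree $n\ge2$, at most $\lfloor (b^n-1)/(n\,a(n))\rfloor$ monic irreducible polynomials of degree $n$ are used as base polynomials. Coarse scrambling: let $D_j\in\mathbb F_b^{\mathbb N}$ and $M_j\in\mathbb F_b^{\mathbb N\times\mathbb N}$, $j=1,\dots,s$, be independent; $D_j$ has i.i.d. uniform entries; $M_j$ is block lower triangular with $e_j\times e_j$ blocks, its diagonal blocks uniform on $\mathrm{GL}(e_j,\mathbb F_b)$ and its blocks below the diagonal uniform on $\mathbb F_b^{e_j\times e_j}$, all blocks independent. The scrambled points are $\widetilde{\boldsymbol x}_n=(\phi_b(M_1C_1\vec n+D_1),\dots,\phi_b(M_sC_s\vec n+D_s))$. The estimator is $\mathcal I_{m,\mathcal S}(f)=b^{-m}\sum_{n=0}^{b^m-1}f(\widetilde{\boldsymbol x}_n)$. Maximal gain coefficient: $\Gamma(\mathcal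 I_{m,\mathcal S})=\sup\left\{\operatorname{Var}(\mathcal I_{m,\mathcal S}(f))/(b^{-m}\sigma_{MC}^2(f)):\ f\in L^2((0,1)^s),\ \sigma_{MC}^2(f)\ne0\right\}$. *)

(* Defs.v *)
(* Matrices, digit vectors and blocks are indexed from 0. *)
From HB Require Import structures.
Set Warnings "-notation-overridden,-notation-incompatible-prefix".
From mathcomp Require Import all_boot all_order all_algebra.
From mathcomp Require Import all_classical all_reals all_analysis.

Set Implicit Arguments.
Unset Strict Implicit.
Unset Printing Implicit Defensive.
Import Order.TTheory GRing.Theory Num.Theory.
Import numFieldNormedType.Exports.

Local Open Scope classical_set_scope.
Local Open Scope ring_scope.

(** * Lebesgue measure on R^n and functionals on the open unit cube *)

(* R^n is [n.-tuple (measurableTypeR R)]: [measurableTypeR R] is R with the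
   sigma-algebra structure on which [lebesgue_measure] is declared. *)
Definition tuple_of_pair (R : realType) (n : nat) (z : measurableTypeR R * n.-tuple (measurableTypeR R)) :
  n.+1.-tuple (measurableTypeR R) := [tuple of z.1 :: z.2].

Lemma measurable_tuple_of_pair (R : realType) (n : nat) :
  measurable_fun [set: measurableTypeR R * n.-tuple (measurableTypeR R)] (@tuple_of_pair R n).
Proof. exact: measurable_cons. Qed.

Lemma measurable_tuple_of_pair_image (R : realType) (n : nat)
    (A : set (measurableTypeR R * n.-tuple (measurableTypeR R))) :
  measurable A -> measurable (@tuple_of_pair R n @` A).
Proof.
move=> mA.
pose g (x : n.+1.-tuple (measurableTypeR R)) : measurableTypeR R * n.-tuple (measurableTypeR R) := (thead x, [tuple of behead x]).
have gK u v : g (tuple_of_pair (u, v)) = (u, v).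
  by rewrite /g /tuple_of_pair /= theadE; congr (_, _); exact: val_inj.
have -> : @tuple_of_pair R n @` A = g @^-1` A.
  apply/seteqP; split=> [_ [[u v] Auv <-]|x Agx] /=; first by rewrite gK.
  exists (g x) => //.
  by rewrite [RHS]tuple_eta; exact: val_inj.
rewrite -[X in measurable X]setTI.
have mg : measurable_fun setT g.
  apply/measurable_fun_pairP; split; first exact: measurable_tnth.
  exact: measurable_behead.
exact: mg.
Qed.

Definition lebesgue_cons (R : realType) (n : nat)
    (mu : {sigma_finite_measure set (n.-tuple (measurableTypeR R)) -> \bar R}) :
    set (n.+1.-tuple (measurableTypeR R)) -> \bar R :=
  pushforward (@lebesgue_measure R \x mu)%E (@tuple_of_pair R n).

Lemma lebesgue_cons0 (R : realType) (n : nat)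
    (mu : {sigma_finite_measure set (n.-tuple (measurableTypeR R)) -> \bar R}) :
  lebesgue_cons mu set0 = 0%E.
Proof. by rewrite /lebesgue_cons /pushforward preimage_set0 measure0. Qed.

Lemma lebesgue_cons_ge0 (R : realType) (n : nat)
    (mu : {sigma_finite_measure set (n.-tuple (measurableTypeR R)) -> \bar R}) A :
  (0 <= lebesgue_cons mu A)%E.
Proof. by rewrite /lebesgue_cons /pushforward measure_ge0. Qed.

Lemma lebesgue_cons_sigma_additive (R : realType) (n : nat)
    (mu : {sigma_finite_measure set (n.-tuple (measurableTypeR R)) -> \bar R}) :
  semi_sigma_additive (lebesgue_cons mu).
Proof.
exact: (@measure_semi_sigma_additive _ _ _
  (measure_function_pushforward__canonical__measure_function_Measure
    (@lebesgue_measure R \x mu)%E (@measurable_tuple_of_pair R n))).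
Qed.

HB.instance Definition _ (R : realType) (n : nat)
    (mu : {sigma_finite_measure set (n.-tuple (measurableTypeR R)) -> \bar R}) :=
  isMeasure.Build _ _ _ (lebesgue_cons mu) (lebesgue_cons0 mu)
    (lebesgue_cons_ge0 mu) (@lebesgue_cons_sigma_additive R n mu).

(* Proved from scratch: on [_ \x _] the library infers the sigma-finite
   structure of subprobabilities only. *)
Lemma lebesgue_cons_sigma_finite (R : realType) (n : nat)
    (mu : {sigma_finite_measure set (n.-tuple (measurableTypeR R)) -> \bar R}) :
  sigma_finite setT (lebesgue_cons mu).
Proof.
have [F FT Ffin] := sigma_finiteT (@lebesgue_measure R).
have [G GT Gfin] := sigma_finiteT mu.
have FG_finite i j :
    measurable (F i `*` G j) /\ ((@lebesgue_measure R \x mu) (F i `*` G j) < +oo)%E.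
  have [mF Foo] := Ffin i; have [mG Goo] := Gfin j.
  split; first exact: measurableX.
  by rewrite product_measure1E// lte_mul_pinfty// ge0_fin_numE.
pose H k : set (measurableTypeR R * n.-tuple (measurableTypeR R)) :=
  if unpickle k is Some (i, j) then F i `*` G j else set0.
exists (fun k => @tuple_of_pair R n @` H k).
  apply/seteqP; split=> // x _.
  have : setT (thead x) by [].
  rewrite FT => -[i _ Fi].
  have : setT ([tuple of behead x] : n.-tuple (measurableTypeR R)) by [].
  rewrite GT => -[j _ Gj].
  exists (pickle (i, j)) => //; rewrite /H pickleK.
  exists (thead x, [tuple of behead x]) => //.
  by rewrite [RHS]tuple_eta; exact: val_inj.
move=> k.
have [mH Hoo] : measurable (H k) /\ ((@lebesgue_measure R \x mu) (H k) < +oo)%E.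
  rewrite /H; case: (unpickle k) => [[i j]|]; first exact: FG_finite.
  by split => //; rewrite measure0.
split; first exact: measurable_tuple_of_pair_image.
rewrite /lebesgue_cons /pushforward.
rewrite (_ : _ @^-1` _ = H k)//; apply/seteqP; split; last exact: preimage_image.
by move=> [u v] [[u' v']] + /(congr1 val) /= [<- /val_inj <-].
Qed.

HB.instance Definition _ (R : realType) (n : nat)
    (mu : {sigma_finite_measure set (n.-tuple (measurableTypeR R)) -> \bar R}) :=
  Measure_isSigmaFinite.Build _ _ _ (lebesgue_cons mu)
    (@lebesgue_cons_sigma_finite R n mu).

Fixpoint lebesgue_tuple (R : realType) (n : nat) :
    {sigma_finite_measure set (n.-tuple (measurableTypeR R)) -> \bar R} :=
  match n with
  | 0 => \d_([tuple] : 0.-tuple (measurableTypeR R))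
  | n'.+1 => lebesgue_cons (lebesgue_tuple R n')
  end.

Definition unit_cube (R : realType) (s : nat) : set (s.-tuple (measurableTypeR R)) :=
  [set x | forall i, 0 < (tnth x i : R) < 1].

Arguments unit_cube : clear implicits.

Lemma measurable_unit_cube (R : realType) (s : nat) :
  measurable (unit_cube R s).
Proof.
have -> : unit_cube R s =
    \bigcap_(i in [set: 'I_s])
      ((fun x => tnth x i : R) @^-1` `]0, 1[).
  by apply/seteqP; split=> x /= h i => [_|]; have := h i; rewrite /= in_itv/= => ->.
apply: fin_bigcap_measurable => // i _.
by rewrite -[X in measurable X]setTI; exact: measurable_tnth.
Qed.

(* Members of L^2((0,1)^s) are represented by Borel functions on R^s, square
   integrable on the cube; values outside the cube are irrelevant. *)
Definition L2_cube (R : realType) (s : nat) : set (s.-tuple (measurableTypeR R) -> R) :=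
  [set f | f \in Lfun (mrestr (lebesgue_tuple R s) (@measurable_unit_cube R s))
                   2%:E].

Definition cube_integral (R : realType) (s : nat) (f : s.-tuple (measurableTypeR R) -> R) : R :=
  \int[lebesgue_tuple R s]_(x in unit_cube R s) f x.

Definition sigma2_MC (R : realType) (s : nat) (f : s.-tuple (measurableTypeR R) -> R) : R :=
  cube_integral (fun x => f x ^+ 2) - cube_integral f ^+ 2.

(** * Generalized Niederreiter sequences *)

(* [laurent_expansion u v a] : u / v = \sum_r (a r) x^(- r) in F((x^-1)), that
   is, [a] vanishes for r small enough and the coefficients of x^n in
   v * \sum_r (a r) x^(- r) and in u agree for every integer n. *)
Definition laurent_expansion (F : fieldType) (u v : {poly F}) (a : int -> F) :=
  (exists N : int, forall r, r < N -> a r = 0) /\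
  (forall n : int, \sum_(i < size v) v`_i * a (i%:Z - n) =
                   if n is Posz k then u`_k else 0).

Definition pdeg (F : fieldType) (p : {poly F}) : nat := (size p).-1.

(* [gns_num S j k] is y_(k+1)^(j+1) and [gns_coef S j t k r] is
   a^(j+1)(t, k+1, r). *)
Record gns (b s : nat) := GNS {
  gns_base : 'I_s -> {poly 'F_b} ;
  gns_base_monic : forall j, gns_base j \is monic ;
  gns_base_coprime :
    forall i j, i != j -> coprimep (gns_base i) (gns_base j) ;
  gns_base_deg : forall j, (0 < pdeg (gns_base j))%N ;
  gns_num : 'I_s -> nat -> {poly 'F_b} ;
  gns_num_free : forall j (t : nat) (c : 'I_(pdeg (gns_base j)) -> 'F_b),
    \sum_i c i *: (gns_num j (t * pdeg (gns_base j) + i)%N %% gns_base j) = 0 ->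
    forall i, c i = 0 ;
  gns_coef : 'I_s -> nat -> nat -> int -> 'F_b ;
  gns_coef_expansion : forall j t k, (0 < t)%N ->
    laurent_expansion (gns_num j k) (gns_base j ^+ t) (gns_coef j t k)
}.

Definition gns_deg (b s : nat) (S : gns b s) (j : 'I_s) : nat :=
  pdeg (gns_base S j).

Definition gns_matrix (b s : nat) (S : gns b s) (j : 'I_s) (k r : nat) : 'F_b :=
  gns_coef S j (k %/ gns_deg S j)%N.+1 k r.+1%:Z.

(* The base polynomials are pairwise distinct, so that the cardinal counts the
   polynomials of degree n in use. *)
Definition reduced (R : realType) (a : nat -> R) (b s : nat) (S : gns b s) :=
  (forall j, irreducible_poly (gns_base S j)) /\
  (forall n : nat, (2 <= n)%N ->
     #|[pred j | gns_deg S j == n]|%:Z <=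
     Num.floor ((b%:R ^+ n - 1) / (n%:R * a n))).

(** * Digital points and coarse scrambling *)

Definition digit_vec (b n i : nat) : 'F_b := ((n %/ b ^ i) %% b)%N%:R.

(* [digit_vec b n i] vanishes for n <= i. *)
Definition matrix_digits (b : nat) (C : nat -> nat -> 'F_b) (n k : nat) : 'F_b :=
  \sum_(i < n) C k i * digit_vec b n i.

Definition radix_val (R : realType) (b : nat) (z : nat -> 'F_b) : R :=
  limn (series (fun r => (z r : nat)%:R / b%:R ^+ r.+1 : R)).
Arguments radix_val : clear implicits.

Definition mx_block (F : Type) (e : nat) (M : nat -> nat -> F) (t u : nat) :
  'M[F]_e := \matrix_(i < e, l < e) M (t * e + i)%N (u * e + l)%N.

Definition uniform_on (d : measure_display) (Omega : measurableType d)
    (R : realType) (P : probability Omega R) (T : finType) (X : Omega -> T)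
    (A : {pred T}) :=
  forall a, P (X @^-1` [set a]) = ((a \in A)%:R / #|A|%:R)%:E.

Definition mutually_independent (d : measure_display)
    (Omega : measurableType d) (R : realType) (P : probability Omega R)
    (I : eqType) (E : I -> set (set Omega)) :=
  forall (J : seq I) (A : I -> set Omega), uniq J ->
    (forall i, i \in J -> E i (A i)) ->
    P (\bigcap_(i in [set` J]) A i) = (\prod_(i <- J) P (A i))%E.

Definition events_of (Omega T : Type) (X : Omega -> T) : set (set Omega) :=
  [set X @^-1` B | B in [set: set T]].

(* The elementary random objects: [inl (j, k)] is the k-th entry of D_j and
   [inr (j, (t, u))] is the block of M_j in position (t, u). *)
Definition scrambling_events (b s : nat) (e : 'I_s -> nat) (Omega : Type)
    (D : 'I_s -> Omega -> nat -> 'F_b)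
    (M : 'I_s -> Omega -> nat -> nat -> 'F_b)
    (i : 'I_s * nat + 'I_s * (nat * nat)) : set (set Omega) :=
  match i with
  | inl (j, k) => events_of (fun w => D j w k)
  | inr (j, (t, u)) => events_of (fun w => mx_block (e j) (M j w) t u)
  end.

Record coarse_scrambling (d : measure_display) (Omega : measurableType d)
    (R : realType) (P : probability Omega R) (b s : nat) (e : 'I_s -> nat) :=
  CoarseScrambling {
  scr_shift : 'I_s -> Omega -> nat -> 'F_b ;
  scr_mx : 'I_s -> Omega -> nat -> nat -> 'F_b ;
  scr_shift_measurable :
    forall j k a, measurable [set w | scr_shift j w k = a] ;
  scr_mx_measurable :
    forall j k l a, measurable [set w | scr_mx j w k l = a] ;
  scr_mx_lower : forall j w k l,
    (k %/ e j < l %/ e j)%N -> scr_mx j w k l = 0 ;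
  scr_shift_uniform :
    forall j k, uniform_on P (fun w => scr_shift j w k) predT ;
  scr_diag_uniform : forall j t,
    uniform_on P (fun w => mx_block (e j) (scr_mx j w) t t) unitmx ;
  scr_lower_uniform : forall j t u, (u < t)%N ->
    uniform_on P (fun w => mx_block (e j) (scr_mx j w) t u) predT ;
  scr_independent :
    mutually_independent P (scrambling_events e scr_shift scr_mx)
}.

(* The k-th entry of M y + D, for M block lower triangular with e x e blocks:
   the k-th row of M vanishes from column (k / e + 1) e onwards. *)
Definition scramble (b e : nat) (M : nat -> nat -> 'F_b) (D y : nat -> 'F_b)
    (k : nat) : 'F_b :=
  \sum_(l < ((k %/ e).+1 * e)%N) M k l * y l + D k.

Definition scrambled_point (d : measure_display) (Omega : measurableType d)
    (R : realType) (P : probability Omega R) (b s : nat) (S : gns b s)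
    (Z : coarse_scrambling P b (gns_deg S)) (n : nat) (w : Omega) :
    s.-tuple (measurableTypeR R) :=
  [tuple radix_val R b (scramble (gns_deg S j) (scr_mx Z j w) (scr_shift Z j w)
                        (matrix_digits (gns_matrix S j) n)) | j < s].

Definition estimator (d : measure_display) (Omega : measurableType d)
    (R : realType) (P : probability Omega R) (b s : nat) (S : gns b s)
    (Z : coarse_scrambling P b (gns_deg S)) (m : nat)
    (f : s.-tuple (measurableTypeR R) -> R) (w : Omega) : R :=
  (b%:R ^+ m)^-1 * \sum_(n < b ^ m) f (scrambled_point Z n w).

Definition max_gain (d : measure_display) (Omega : measurableType d)
    (R : realType) (P : probability Omega R) (b s : nat) (S : gns b s)
    (Z : coarse_scrambling P b (gns_deg S)) (m : nat) : \bar R :=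
  ereal_sup [set ('V_P[estimator Z m f] / ((b%:R ^+ m)^-1 * sigma2_MC f)%:E)%E
            | f in [set f | L2_cube f /\ sigma2_MC f != 0]].

(* Main.v *)
Require Import Defs.
From HB Require Import structures.
Set Warnings "-notation-overridden,-notation-incompatible-prefix".
From mathcomp Require Import all_boot all_order all_algebra.
From mathcomp Require Import all_classical all_reals all_analysis.
From mathcomp Require Import measurable_realfun.
From mathcomp Require Import ring lra zify.

(** The variance is bounded by comparing the estimator with the average of a
    function over a random affine subspace of a finite vector space.

    Scrambling acts on digits. A scrambled point has uniform digits, hence it is
    uniform in the cube ([point_law]); this makes the estimator unbiased and
    reduces integrals over the cube to expectations over digit sequences. Two
    distinct points among the first [b ^ m] already differ, in every coordinate,
    within a fixed number [K0] of digits, and their digits beyond [K0] are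
    independent ([pair_cell_law]), because the blocks of a scrambling matrix below
    its diagonal are uniform. Therefore the covariance of the values of the
    integrand at two points only involves its averages [g] over the cells given by
    the first [K0] digits ([pair_expectation]). On the diagonal the variance of
    the integrand replaces that of [g], which is smaller.

    What remains is the second moment of the sum of [g] over the [K0]-digit net
    [L u + D], where [L] is the product of a random block lower triangular matrix
    with the generating matrices and [D] is a uniform shift. By Fourier analysis
    on the space of digits ([random_subspace_bound]), this sum behaves as one over
    independent points up to a factor [C], provided that each nonzero frequency
    vanishes on the random net with probability at most [C / b ^ m]. The transpose
    of the scrambling matrix moves a frequency uniformly inside the set of
    frequencies with the same last nonzero blocks ([card_coact_stratum]). Among
    those, the ones that vanish on the unscrambled net are few because the rows of
    the generating matrices are independent ([card_annihilator]), which comes from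
    the coprimality of the base polynomials by partial fractions
    ([gns_rows_free]). This gives for [C] the product over [j] of
    [b ^ e j / (b ^ e j - 1)], where [e j] is the degree of the [j]-th base
    polynomial.

    Finally the logarithm of the product is at most the sum of the
    [(b ^ e j - 1)^-1]. Polynomials of degree 1 contribute at most 2 to it, and
    reducedness bounds the rest by the convergent series of the
    [(n * ln n ^ (1 + beta))^-1], which is estimated by comparison with an integral
    ([gain_le_constant]). *)

Set Implicit Arguments.
Unset Strict Implicit.
Unset Printing Implicit Defensive.
Import Order.TTheory GRing.Theory Num.Theory.
Import numFieldNormedType.Exports.

Local Open Scope classical_set_scope.
Local Open Scope ring_scope.

(** * A quadratic-form bound on finite vector spaces *)

Section FiniteForm.
Variables (R : realFieldType) (F : finFieldType).
Implicit Types a c : F.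

Let q : R := #|F|%:R.

(** The sum of all nontrivial additive characters of [F] at [a]. *)
Definition rho a : R := if a == 0 then #|F|%:R - 1 else -1.

Lemma rhoN a : rho (- a) = rho a.
Proof. by rewrite /rho oppr_eq0. Qed.

Lemma rhoE a : rho a = q * (a == 0)%:R - 1.
Proof. by rewrite /rho; case: eqP => _; rewrite ?mulr1// mulr0 sub0r. Qed.

Lemma sum_eq0_shift a : \sum_c ((a + c == 0)%:R : R) = 1.
Proof.
rewrite (bigD1 (- a))//= addrN eqxx big1 ?addr0// => c.
by rewrite addrC -[c + a](opprK) opprD -[0]oppr0 (inj_eq oppr_inj) addr_eq0 opprK
  eqr_oppLR => /negPf ->.
Qed.

Lemma sum_rho a : \sum_c rho (a + c) = 0.
Proof.
under eq_bigr do rewrite rhoE.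
rewrite big_split/= -mulr_sumr sum_eq0_shift mulr1 sumr_const.
by rewrite mulNrn -/q subrr.
Qed.

Lemma rho_convolution a c : \sum_d rho (a + d) * rho (c + d) = q * rho (a - c).
Proof.
under eq_bigr => d _.
  rewrite (rhoE (a + d)) mulrBl mul1r -mulrA; over.
rewrite sumrB sum_rho subr0 -mulr_sumr; congr (_ * _).
rewrite (bigD1 (- a))//= addrN eqxx mul1r -rhoN opprD opprK.
rewrite big1 ?addr0; last first.
  move=> d dNa; case: eqP => [/eqP|]; last by rewrite mul0r.
  by rewrite addrC addr_eq0 (negPf dNa).
by rewrite [- c + a]addrC.
Qed.

(** A nonzero linear form takes every value equally often. *)
Lemma sum_rho_linear (n p : nat) (phi : {linear 'M[F]_(n, p) -> F^o}) v0 a :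
  phi v0 != 0 -> \sum_v rho (phi v + a) = 0.
Proof.
move=> phi0; set S := LHS.
have S_shift c : \sum_v rho (phi v + (a + c)) = S.
  rewrite /S (reindex_inj (addIr (- ((c / phi v0) *: v0)))); apply: eq_bigr => v _.
  rewrite linearB linearZ_LR/= -[_ *: _]/(c / phi v0 * phi v0) divfK//.
  by congr rho; rewrite addrACA addNr addr0.
have : q * S = 0.
  rewrite /q mulr_natl -sumr_const -(eq_bigr _ (fun c _ => S_shift c)).
  rewrite exchange_big big1// => v _.
  by rewrite -[RHS](sum_rho (phi v + a)); apply: eq_bigr => c _; rewrite addrA.
move/eqP; rewrite mulf_eq0 => /orP[|/eqP//].
by rewrite pnatr_eq0 (cardD1 0) inE.
Qed.

Definition pairing (n p : nat) (chi x : 'M[F]_(n, p)) : F :=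
  \sum_i \sum_j chi i j * x i j.

Lemma pairing_is_linear (n p : nat) (chi : 'M[F]_(n, p)) :
  linear (pairing chi : 'M[F]_(n, p) -> F^o).
Proof.
move=> a x y; change (pairing chi (a *: x + y) = a * pairing chi x + pairing chi y).
rewrite /pairing mulr_sumr -big_split/=.
apply: eq_bigr => i _; rewrite mulr_sumr -big_split/=; apply: eq_bigr => j _.
by rewrite !mxE mulrDr mulrCA.
Qed.

HB.instance Definition _ (n p : nat) (chi : 'M[F]_(n, p)) :=
  GRing.isLinear.Build F 'M[F]_(n, p) F^o _ (pairing chi) (pairing_is_linear chi).

Lemma pairingC (n p : nat) (chi x : 'M[F]_(n, p)) : pairing chi x = pairing x chi.
Proof. by apply: eq_bigr => i _; apply: eq_bigr => j _; rewrite mulrC. Qed.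

Lemma pairing_delta (n p : nat) (chi : 'M[F]_(n, p)) i j :
  pairing chi (delta_mx i j) = chi i j.
Proof.
rewrite /pairing (bigD1 i)//= [X in _ + X]big1 ?addr0 => [|i' i'i]; last first.
  by rewrite big1// => j' _; rewrite mxE (negPf i'i) mulr0.
rewrite (bigD1 j)//= [X in _ + X]big1 ?addr0 => [|j' j'j]; last first.
  by rewrite mxE (negPf j'j) andbF mulr0.
by rewrite mxE !eqxx mulr1.
Qed.

Lemma pairing_nondegenerate (n p : nat) (chi : 'M[F]_(n, p)) :
  chi != 0 -> exists x, pairing chi x != 0.
Proof.
move=> chi0; apply/existsP; apply: contraNT chi0 => /existsPn h.
by apply/eqP/matrixP => i j; rewrite mxE -pairing_delta; have := h (delta_mx i j); rewrite negbK => /eqP.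
Qed.

(** Fourier inversion: the Dirac mass at [0] as a combination of the [rho]. *)
Lemma sum_rho_pairing (n p : nat) (x : 'M[F]_(n, p)) :
  \sum_chi rho (pairing chi x) = (q - 1) * #|{: 'M[F]_(n, p)}|%:R * (x == 0)%:R.
Proof.
have [->|x0] := eqVneq x 0.
  rewrite mulr1 mulr_natr -sumr_const; apply: eq_bigr => chi _.
  by rewrite linear0 /rho eqxx.
have [y hy] := pairing_nondegenerate x0; rewrite mulr0.
rewrite -[RHS](sum_rho_linear 0 hy); apply: eq_bigr => chi _.
by rewrite addr0 pairingC.
Qed.

Variables (n p m : nat).
Local Notation V := 'M[F]_(n, p).
Local Notation U := 'rV[F]_m.
Variable g : V -> R.

(** Up to a constant, the energy of [g] on the line of characters spanned by [chi]. *)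
Definition energy (chi : V) : R :=
  \sum_x \sum_y g x * g y * rho (pairing chi (y - x)).

Lemma energy_ge0 chi : 0 <= energy chi.
Proof.
have q0 : 0 < q by rewrite ltr0n (cardD1 0) inE.
rewrite -(pmulr_rge0 _ q0).
suff -> : q * energy chi = \sum_c (\sum_x g x * rho (pairing chi x + c)) ^+ 2.
  by apply: sumr_ge0 => c _; exact: sqr_ge0.
under [RHS]eq_bigr => c _.
  rewrite expr2 mulr_suml; under eq_bigr do rewrite mulr_sumr; over.
rewrite exchange_big/= /energy mulr_sumr; apply: eq_bigr => x _.
rewrite exchange_big/= mulr_sumr; apply: eq_bigr => y _.
under [RHS]eq_bigr => c _ do rewrite mulrACA.
rewrite -mulr_sumr rho_convolution linearB/= -rhoN opprB.
by rewrite mulrCA.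
Qed.

Lemma energy0 : energy 0 = (q - 1) * (\sum_x g x) ^+ 2.
Proof.
rewrite expr2 mulr_suml mulr_sumr; apply: eq_bigr => x _.
rewrite !mulr_sumr; apply: eq_bigr => y _.
by rewrite pairingC linear0 /rho eqxx mulrC.
Qed.

Lemma sum_energy : \sum_chi energy chi = (q - 1) * #|{: V}|%:R * \sum_x g x ^+ 2.
Proof.
rewrite exchange_big mulr_sumr; apply: eq_bigr => x _ /=.
rewrite exchange_big (bigD1 x)//= -mulr_sumr sum_rho_pairing subrr eqxx mulr1.
rewrite big1 ?addr0 => [|y yx]; first by rewrite -expr2 mulrC.
by rewrite -mulr_sumr sum_rho_pairing subr_eq0 (negPf yx) !mulr0.
Qed.

(** Averaging over all shifts [D] and over a subspace keeps exactly the
    frequencies that vanish on the subspace. *)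
Lemma shifted_sum_sqr (L : {linear U -> V}) :
  (q - 1) * #|{: V}|%:R * \sum_D (\sum_u g (L u + D)) ^+ 2 =
  #|{: U}|%:R ^+ 2 * \sum_(chi | [forall u, pairing chi (L u) == 0]) energy chi.
Proof.
set N := (q - 1) * _.
have -> : \sum_D (\sum_u g (L u + D)) ^+ 2 =
          #|{: U}|%:R * \sum_u \sum_x g x * g (x + L u).
  under eq_bigr => D _.
    rewrite expr2 mulr_suml; under eq_bigr do rewrite mulr_sumr; over.
  rewrite exchange_big/= mulr_natl -sumr_const; apply: eq_bigr => u _.
  rewrite exchange_big/= (reindex_inj (addIr u)); apply: eq_bigr => v _.
  rewrite [RHS](reindex_inj (addrI (L u))); apply: eq_bigr => D _.
  by rewrite linearD/= [L v + _]addrC addrAC.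
rewrite mulrCA expr2 -mulrA; congr (_ * _).
have expand u x : N * g (x + L u) =
    \sum_y \sum_chi g y * rho (pairing chi (y - x) - pairing chi (L u)).
  rewrite (bigD1 (x + L u))//= [X in _ = _ + X]big1 ?addr0 => [|y yx]; rewrite -mulr_sumr.
    under eq_bigr do rewrite -linearB/= -addrA -opprD subrr.
    by rewrite sum_rho_pairing eqxx mulr1 mulrC.
  under eq_bigr do rewrite -linearB/=.
  by rewrite sum_rho_pairing -addrA -opprD subr_eq0 (negPf yx) !mulr0.
transitivity (\sum_chi \sum_x \sum_y g x * g y *
    \sum_u rho (pairing chi (L u) + pairing chi (x - y))).
  rewrite mulr_sumr; under eq_bigr => u _.
    rewrite mulr_sumr; under eq_bigr => x _.
      rewrite mulrCA expand mulr_sumr.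
      under eq_bigr do rewrite mulr_sumr.
      over.
    over.
  rewrite exchange_big/= [RHS]exchange_big/=; apply: eq_bigr => x _.
  rewrite exchange_big/= [RHS]exchange_big/=; apply: eq_bigr => y _.
  rewrite exchange_big/=; apply: eq_bigr => chi _.
  rewrite mulr_sumr; apply: eq_bigr => u _; rewrite mulrA -rhoN opprB.
  by rewrite -(opprB x y) linearN opprK.
rewrite [in RHS]big_mkcond mulr_sumr; apply: eq_bigr => chi _.
case: ifPn => [/forallP h|/forallPn[u hu]].
  rewrite mulr_sumr; apply: eq_bigr => x _.
  rewrite mulr_sumr; apply: eq_bigr => y _.
  rewrite mulrCA; congr (_ * _).
  rewrite (eq_bigr (fun=> rho (pairing chi (y - x)))) => [|u _].
    by rewrite sumr_const mulr_natl.
  by rewrite (eqP (h u)) add0r -rhoN -linearN opprB.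
rewrite mulr0 big1// => x _; rewrite big1// => y _.
by rewrite (@sum_rho_linear _ _ (pairing chi \o L) u) ?mulr0.
Qed.

(** The frequencies that survive the average over shifts ([shifted_sum_sqr]) have
    nonnegative energies: the zero frequency gives the mean of [g], and [C] bounds
    how often each of the other ones survives. For [C = 1] the bound is the
    second moment of a sum over independent uniform points. *)
Lemma random_subspace_bound (T : finType) (A : {pred T}) (L : T -> {linear U -> V})
    (C : R) :
  (forall chi, chi != 0 ->
     #|[pred t in A | [forall u, pairing chi (L t u) == 0]]|%:R * #|{: U}|%:R
       <= C * #|A|%:R) ->
  \sum_(t in A) \sum_D (\sum_u g (L t u + D)) ^+ 2 <=
  #|A|%:R * #|{: U}|%:R *
    (#|{: U}|%:R * (\sum_x g x) ^+ 2 / #|{: V}|%:R +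
     C * (\sum_x g x ^+ 2 - (\sum_x g x) ^+ 2 / #|{: V}|%:R)).
Proof.
move=> hC.
have q1 : 0 < q - 1.
  by rewrite subr_gt0 ltr1n (cardD1 0) inE (cardD1 1) !inE oner_eq0.
have N0 : 0 < #|{: V}|%:R :> R by rewrite ltr0n (cardD1 0) inE.
have U0 : 0 < #|{: U}|%:R :> R by rewrite ltr0n (cardD1 0) inE.
rewrite -(ler_pM2l (mulr_gt0 q1 N0)) mulr_sumr.
under eq_bigr do rewrite shifted_sum_sqr big_mkcond mulr_sumr.
rewrite exchange_big/= (bigD1 0)//=.
have -> : \sum_(t in A) #|{: U}|%:R ^+ 2 *
    (if [forall u, pairing 0 (L t u) == 0] then energy 0 else 0) =
    #|A|%:R * #|{: U}|%:R ^+ 2 * ((q - 1) * (\sum_x g x) ^+ 2).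
  transitivity (\sum_(t in A) #|{: U}|%:R ^+ 2 * energy 0); last first.
    by rewrite sumr_const -energy0 -[LHS]mulr_natl mulrA.
  apply: eq_bigr => t _.
  by case: ifPn => // /forallPn[u]; rewrite pairingC linear0 eqxx.
have -> : \sum_x g x ^+ 2 - (\sum_x g x) ^+ 2 / #|{: V}|%:R =
   (\sum_(chi | chi != 0) energy chi) / ((q - 1) * #|{: V}|%:R).
  have := sum_energy; rewrite (bigD1 0)//= energy0 => /esym/eqP.
  rewrite addrC -subr_eq => /eqP <-; field.
  by rewrite !gt_eqF.
set S1 := \sum_x g x; set S2 := \sum_(_ | _ != 0) energy _.
have -> : (q - 1) * #|{: V}|%:R *
  (#|A|%:R * #|{: U}|%:R *
   (#|{: U}|%:R * S1 ^+ 2 / #|{: V}|%:R + C * (S2 / ((q - 1) * #|{: V}|%:R)))) =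
   #|A|%:R * #|{: U}|%:R ^+ 2 * ((q - 1) * S1 ^+ 2) +
   \sum_(chi | chi != 0) energy chi * (#|{: U}|%:R * (C * #|A|%:R)).
  by rewrite -mulr_suml -/S2; field; rewrite !gt_eqF.
rewrite lerD2l; apply: ler_sum => chi chi0.
rewrite -mulr_sumr -big_mkcondr/=.
rewrite (eq_bigl [pred t in A | [forall u, pairing chi (L t u) == 0]])//.
rewrite sumr_const -[energy chi *+ _]mulr_natr mulrCA.
apply: ler_wpM2l; first exact: energy_ge0.
rewrite expr2 -mulrA; apply: ler_wpM2l; first exact: ler0n.
by rewrite mulrC hC.
Qed.

End FiniteForm.

(** * Counting block lower triangular matrices *)

Section BlockTriangular.
Variables (F : finFieldType) (e K : nat).
Hypotheses (e_gt0 : (0 < e)%N) (eK : (e %| K)%N).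

(** Access by natural numbers, so that [mx_block] applies to finite matrices
    and truncations of any size can be compared. *)
Definition entry (F' : fieldType) n p (A : 'M[F']_(n, p)) (k l : nat) : F' :=
  match insub k, insub l with Some i, Some j => A i j | _, _ => 0 end.

Lemma entryE (F' : fieldType) n p (A : 'M[F']_(n, p)) (i : 'I_n) (j : 'I_p) :
  entry A i j = A i j.
Proof. by rewrite /entry !valK. Qed.

Lemma entry_out (F' : fieldType) n p (A : 'M[F']_(n, p)) (i l : nat) :
  (p <= l)%N -> entry A i l = 0.
Proof. by move=> pl; rewrite /entry; case: insub => // i'; rewrite insubF// ltnNge pl. Qed.

(** The values that a truncated scrambling matrix can take. *)
Definition block_lower (A : 'M[F]_K) : bool :=
  [forall k : 'I_K, forall l : 'I_K, (k %/ e < l %/ e)%N ==> (A k l == 0)] &&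
  [forall T : 'I_(K %/ e), mx_block e (entry A) T T \in unitmx].

Lemma block_lower0 A (k l : 'I_K) :
  block_lower A -> (k %/ e < l %/ e)%N -> A k l = 0.
Proof. by case/andP => /forallP/(_ k)/forallP/(_ l)/implyP h _ /h/eqP. Qed.

Lemma block_lt (l i : nat) : (l < K %/ e)%N -> (i < e)%N -> (l * e + i < K)%N.
Proof.
move=> lK ie; rewrite -[K in ltnRHS](divnK eK).
by rewrite (@leq_trans (l * e + e)%N) ?ltn_add2l// -mulSnr leq_mul2r lK orbT.
Qed.

Lemma block_div (l i : nat) : (i < e)%N -> ((l * e + i) %/ e = l)%N.
Proof. by move=> ie; rewrite divnMDl// divn_small// addn0. Qed.

Lemma block_index_lt (r : 'I_K) : (r %/ e < K %/ e)%N.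
Proof. by rewrite ltn_divLR// divnK. Qed.

Lemma sum_block (V : nmodType) (f : nat -> V) l : (l < K %/ e)%N ->
  (forall r, (r < K)%N -> (r %/ e != l)%N -> f r = 0) ->
  \sum_(r < K) f r = \sum_(i < e) f (l * e + i)%N.
Proof.
move=> lK f0.
have le1 : (l * e + e <= K)%N by rewrite -mulSnr -[leqRHS](divnK eK) leq_mul2r lK orbT.
rewrite -(big_mkord xpredT f) (@big_cat_nat _ _ _ (l * e + e)%N)//=.
rewrite (@big_cat_nat _ _ _ (l * e)%N) ?leq_addr//=.
rewrite big_nat_cond big1 ?add0r => [|r /andP[/andP[_ rl] _]]; last first.
  rewrite f0 //; first by rewrite (leq_trans rl)// (leq_trans _ le1)// leq_addr.
  by rewrite neq_ltn ltn_divLR// rl.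
rewrite [X in _ + X]big_nat_cond [X in _ + X]big1 ?addr0 => [|r /andP[/andP[rl rK] _]]; last first.
  by rewrite f0// neq_ltn leq_divRL// mulSnr rl orbT.
rewrite -{1}[(l * e)%N]add0n big_addn addKn big_mkord.
by apply: eq_bigr => i _; rewrite addnC.
Qed.

Lemma unit_rank_one n (u : 'cV[F]_n) (w : 'rV[F]_n) :
  1 + (w *m u) 0 0 != 0 -> 1%:M + u *m w \in unitmx.
Proof.
set a : F := (w *m u) 0 0 => a1.
suff /mulmx1_unit[] : (1%:M + u *m w) *m (1%:M - (1 + a)^-1 *: (u *m w)) = 1%:M by [].
rewrite mulmxDl mul1mx mulmxBr mulmx1 -scalemxAr mulmxA -(mulmxA u w u).
rewrite [w *m u]mx11_scalar -/a mul_mx_scalar -scalemxAl scalerA.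
rewrite -addrA -scaleNr -[X in _ + (_ + (X - _))]scale1r -scalerBl -scalerDl.
have -> : - (1 + a)^-1 + (1 - (1 + a)^-1 * a) = 0 by field.
by rewrite scale0r addr0.
Qed.

(** Right multiplication by [1 + phi^T w] stays among block lower triangular
    matrices if [phi] lives in one block and [w] lives up to this block: of the
    diagonal blocks it only changes that one, by an invertible factor. *)
Lemma block_lower_rank_one (A : 'M[F]_K) (phi w : 'rV[F]_K) l :
  (l < K %/ e)%N ->
  (forall r : 'I_K, (r %/ e != l)%N -> phi 0 r = 0) ->
  (forall c : 'I_K, (l < c %/ e)%N -> w 0 c = 0) ->
  1 + (w *m phi^T) 0 0 != 0 ->
  block_lower A -> block_lower (A *m (1%:M + phi^T *m w)).
Proof.
move=> lK phi0 w0 unit_phi_w bA.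
have expand k c : (A *m (1%:M + phi^T *m w)) k c =
    A k c + (\sum_r A k r * phi 0 r) * w 0 c.
  rewrite mulmxDr mulmx1 mulmxA mxE; congr (_ + _).
  by rewrite mxE big_ord1 mxE; under eq_bigr do rewrite mxE.
have Aphi0 (k : 'I_K) : (k %/ e < l)%N -> \sum_r A k r * phi 0 r = 0.
  move=> kl; apply: big1 => r _.
  have [rl|rl] := eqVneq (r %/ e)%N l; last by rewrite phi0 ?mulr0.
  by rewrite (block_lower0 bA) ?mul0r// rl.
apply/andP; split.
  apply/forallP => k; apply/forallP => c; apply/implyP => kc.
  rewrite expand (block_lower0 bA)// add0r.
  have [kl|lk] := ltnP (k %/ e) l; first by rewrite Aphi0// mul0r.
  by rewrite w0 ?mulr0// (leq_ltn_trans lk).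
apply/forallP => T.
have [TK] : (T < K %/ e)%N by [].
have inK i : (i < e)%N -> (T * e + i < K)%N by exact: block_lt.
have bTT : mx_block e (entry A) T T \in unitmx by case/andP: bA => _ /forallP.
pose idx (i : 'I_e) : 'I_K := Ordinal (inK i (ltn_ord i)).
have idxE B i j : mx_block e (entry B) T T i j = B (idx i) (idx j).
  by rewrite mxE -entryE.
have [Tl|Tl] := eqVneq (T : nat) l; last first.
  suff -> : mx_block e (entry (A *m (1%:M + phi^T *m w))) T T =
            mx_block e (entry A) T T by [].
  apply/matrixP => i j; rewrite !idxE expand.
  have [ltTl|] := ltnP T l; first by rewrite Aphi0 ?mul0r ?addr0//= block_div.
  rewrite leq_eqVlt eq_sym (negPf Tl) /= => ltlT.
  by rewrite w0 ?mulr0 ?addr0//= block_div.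
pose phiT : 'rV_e := \row_i phi 0 (idx i).
pose wT : 'rV_e := \row_i w 0 (idx i).
have sumT (f : 'I_K -> F) : \sum_r f r * phi 0 r = \sum_i f (idx i) * phi 0 (idx i).
  pose f' r := if insub r is Some i then f i * phi 0 i else 0.
  transitivity (\sum_(r < K) f' r).
    by apply: eq_bigr => r _; rewrite /f' valK.
  rewrite (@sum_block _ f' T)//; last first.
    by move=> r rK rT; rewrite /f' insubT/= phi0 ?mulr0//= -Tl.
  by apply: eq_bigr => i _; rewrite -[(T * e + i)%N]/(val (idx i)) /f' valK.
suff -> : mx_block e (entry (A *m (1%:M + phi^T *m w))) T T =
    mx_block e (entry A) T T *m (1%:M + phiT^T *m wT).
  rewrite unitmx_mul bTT unit_rank_one//.
  suff -> : (wT *m phiT^T) 0 0 = (w *m phi^T) 0 0 by [].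
  rewrite !mxE; under eq_bigr do rewrite !mxE.
  by under [RHS]eq_bigr do rewrite !mxE; rewrite sumT.
apply/matrixP => i j; rewrite idxE expand mulmxDr mulmx1 mulmxA !mxE.
congr (_ + _); first by rewrite -entryE.
rewrite big_ord1 !mxE sumT; congr (_ * _); apply: eq_bigr => i' _.
by rewrite !mxE -[A _ _]entryE.
Qed.

(** The last nonzero block of [chi] is the block [k - 1], and [chi = 0] if [k = 0].
    Block lower triangular matrices, acting on the right, preserve the strata. *)
Definition in_stratum (k : nat) (chi : 'rV[F]_K) : bool :=
  [forall r : 'I_K, (k <= r %/ e)%N ==> (chi 0 r == 0)] &&
  ((0 < k)%N ==> [exists r : 'I_K, (r %/ e == k.-1)%N && (chi 0 r != 0)]).

Lemma in_stratum0 k chi (r : 'I_K) :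
  in_stratum k chi -> (k <= r %/ e)%N -> chi 0 r = 0.
Proof. by case/andP => /forallP/(_ r)/implyP h _ /h/eqP. Qed.

Lemma ex_stratum (chi : 'rV[F]_K) : exists2 k, (k <= K %/ e)%N & in_stratum k chi.
Proof.
pose k := \max_(r : 'I_K | chi 0 r != 0) (r %/ e).+1.
exists k; first by apply/bigmax_leqP => r _; exact: block_index_lt.
apply/andP; split.
  apply/forallP => r; apply/implyP; apply: contraTT => chir.
  by rewrite -ltnNge; exact: (@leq_bigmax_cond _ (fun r : 'I_K => chi 0 r != 0) (fun r => (r %/ e).+1)).
apply/implyP => k0.
have [r0 chir0|none] := pickP (fun r : 'I_K => chi 0 r != 0); last first.
  by move: k0; rewrite /k big_pred0.
have [r chir kE] := @eq_bigmax_cond _ (fun r : 'I_K => chi 0 r != 0)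
  (fun r => (r %/ e).+1) (ltac:(by apply/card_gt0P; exists r0)).
have {}kE : k = (r %/ e).+1 by exact: kE.
by apply/existsP; exists r; rewrite kE eqxx; exact: chir.
Qed.

Lemma stratum_nonzero_block k chi : (k < K %/ e)%N -> in_stratum k.+1 chi ->
  exists2 r : 'I_K, (r %/ e = k)%N & chi 0 r != 0.
Proof. by move=> kK /andP[_ /existsP[r /andP[/eqP rk chir]]]; exists r. Qed.

(** A vector space is not the union of two hyperplanes. *)
Lemma common_nonzero (k : nat) (chi1 chi2 : 'rV[F]_K) :
  (exists2 r : 'I_K, (r %/ e = k)%N & chi1 0 r != 0) ->
  (exists2 r : 'I_K, (r %/ e = k)%N & chi2 0 r != 0) ->
  exists phi : 'rV[F]_K, [/\ forall r : 'I_K, (r %/ e != k)%N -> phi 0 r = 0,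
    (chi1 *m phi^T) 0 0 = 1 & (chi2 *m phi^T) 0 0 != 0].
Proof.
move=> [r1 r1k chi1r] [r2 r2k chi2r].
have dot (chi : 'rV[F]_K) r : (chi *m (delta_mx 0 r : 'rV[F]_K)^T) 0 0 = chi 0 r.
  rewrite !mxE (bigD1 r)//= big1 ?addr0 => [|i ir]; first by rewrite !mxE !eqxx mulr1.
  by rewrite !mxE (negPf ir) andbF mulr0.
suff [phi [phi0 h1 h2]] : exists phi : 'rV[F]_K,
    [/\ forall r : 'I_K, (r %/ e != k)%N -> phi 0 r = 0,
    (chi1 *m phi^T) 0 0 != 0 & (chi2 *m phi^T) 0 0 != 0].
  exists (((chi1 *m phi^T) 0 0)^-1 *: phi); split.
  - by move=> r /phi0 h; rewrite mxE h mulr0.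
  - by rewrite linearZ/= -scalemxAr mxE mulVf.
  - by rewrite linearZ/= -scalemxAr mxE mulf_neq0// invr_eq0.
have delta0 (r r' : 'I_K) : (r' %/ e = k)%N -> (r %/ e != k)%N -> (delta_mx 0 r' : 'rV[F]_K) 0 r = 0.
  by move=> r'k; rewrite mxE eqxx /=; case: (eqVneq r r') => // ->; rewrite r'k eqxx.
have [h2|h2] := eqVneq (chi2 0 r1) 0; last first.
  by exists (delta_mx 0 r1); rewrite !dot; split=> // r; exact: delta0.
have [h1|h1] := eqVneq (chi1 0 r2) 0; last first.
  by exists (delta_mx 0 r2); rewrite !dot; split=> // r; exact: delta0.
exists (delta_mx 0 r1 + delta_mx 0 r2); split.
- by move=> r rk; rewrite mxE !delta0// addr0.
- by rewrite linearD/= mulmxDr mxE !dot h1 addr0.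
- by rewrite linearD/= mulmxDr mxE !dot h2 add0r.
Qed.

Lemma leq_card_image (chi chi1 chi2 : 'rV[F]_K) k :
  (k <= K %/ e)%N -> in_stratum k chi1 -> in_stratum k chi2 ->
  (#|[pred A | block_lower A && (chi *m A == chi1)]| <=
   #|[pred A | block_lower A && (chi *m A == chi2)]|)%N.
Proof.
case: k => [|k] kK O1 O2.
  suff -> : chi1 = chi2 by [].
  by apply/rowP => r; rewrite (in_stratum0 O1)// (in_stratum0 O2).
have [phi [phi0 phi1 phi2]] := common_nonzero
  (stratum_nonzero_block kK O1) (stratum_nonzero_block kK O2).
pose w := chi2 - chi1.
have unit_w : 1 + (w *m phi^T) 0 0 != 0.
  by rewrite mulmxBl mxE [X in _ + (_ + X)]mxE phi1 addrC subrK.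
have G_unit := @unit_rank_one _ phi^T w unit_w.
rewrite -(fintype.card_image (can_inj (mulmxK G_unit))); apply: subset_leq_card.
apply/fintype.subsetP => B /fintype.imageP[A]; rewrite inE => /andP[bA /eqP chiA] ->.
rewrite inE; apply/andP; split.
  apply: (block_lower_rank_one kK) => // c kc.
  by rewrite !mxE (in_stratum0 O1)// (in_stratum0 O2)// subr0.
rewrite mulmxA chiA mulmxDr mulmx1 mulmxA [chi1 *m _]mx11_scalar phi1 mul1mx.
by rewrite /w addrC subrK.
Qed.

Lemma stratum_stable k chi A : (k <= K %/ e)%N ->
  block_lower A -> in_stratum k chi -> in_stratum k (chi *m A).
Proof.
move=> kK bA Ochi; apply/andP; split.
  apply/forallP => c; apply/implyP => kc; apply/eqP; rewrite mxE big1// => r _.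
  have [kr|rk] := leqP k (r %/ e); first by rewrite (in_stratum0 Ochi)// mul0r.
  by rewrite (block_lower0 bA) ?mulr0// (leq_trans rk).
case: k kK Ochi => //= k kK Ochi.
have [r0 r0k chir0] := stratum_nonzero_block kK Ochi.
pose idx (i : 'I_e) : 'I_K := Ordinal (block_lt kK (ltn_ord i)).
pose chik : 'rV_e := \row_i chi 0 (idx i).
have bkk : mx_block e (entry A) k k \in unitmx.
  by case/andP: bA => _ /forallP/(_ (Ordinal kK)).
have prodE j : (chi *m A) 0 (idx j) = (chik *m mx_block e (entry A) k k) 0 j.
  rewrite !mxE.
  pose f r := if insub r is Some i then chi 0 i * A i (idx j) else 0.
  transitivity (\sum_(r < K) f r).
    by apply: eq_bigr => r _; rewrite /f valK.
  rewrite (@sum_block _ f k)//; last first.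
    move=> r rK rk; rewrite /f insubT/=; move: rk; rewrite neq_ltn => /orP[rk|kr].
      by rewrite (block_lower0 bA) ?mulr0//= block_div.
    by rewrite (in_stratum0 Ochi) ?mul0r.
  apply: eq_bigr => i _; rewrite -[(k * e + i)%N]/(val (idx i)) /f valK !mxE.
  by rewrite -[A _ _]entryE.
have : chik *m mx_block e (entry A) k k != 0.
  apply: contraNneq chir0 => chiA0.
  have : chik = 0 by rewrite -(mulmxK bkk chik) chiA0 mul0mx.
  move/rowP => /(_ (Ordinal (ltn_pmod r0 e_gt0))); rewrite !mxE => h.
  rewrite -h; apply/eqP; congr (chi _ _); apply/val_inj => /=.
  by rewrite -r0k -divn_eq.
move=> /rV0Pn[j]; rewrite -prodE => h; apply/existsP; exists (idx j).
by rewrite h block_div ?eqxx.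
Qed.

(** The image of [chi] under a random block lower triangular matrix is uniform
    on its stratum: the matrices [1 + phi^T w] of [block_lower_rank_one] carry any
    point of the stratum to any other one. *)
Lemma card_image_stratum k chi chi' : (k <= K %/ e)%N -> in_stratum k chi ->
  (#|[pred A | block_lower A && (chi *m A == chi')]| * #|in_stratum k|
     <= #|block_lower|)%N.
Proof.
move=> kK Ochi.
have [Ochi'|nOchi'] := boolP (in_stratum k chi'); last first.
  rewrite eq_card0 ?mul0n// => A; rewrite !inE; apply/negP => /andP[bA /eqP chiA].
  by move: nOchi'; rewrite -chiA stratum_stable.
rewrite mulnC -sum_nat_const.
apply: (@leq_trans (\sum_(chi2 in in_stratum k)
    #|[pred A | block_lower A && (chi *m A == chi2)]|)).
  by apply: leq_sum => chi2 O2; exact: (leq_card_image _ kK).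
rewrite -[#|block_lower|]sum1_card (partition_big (mulmx chi) (in_stratum k))/=.
  apply: leq_sum => chi2 O2; rewrite -sum1_card.
  by apply: eq_leq; apply: eq_bigl => A; rewrite !inE.
by move=> A bA; exact: stratum_stable.
Qed.

Lemma card_support d : (d <= K)%N ->
  #|[pred chi : 'rV[F]_K | [forall r : 'I_K, (d <= r)%N ==> (chi 0 r == 0)]]|
    = (#|F| ^ d)%N.
Proof.
move=> dK.
pose ext (v : 'rV[F]_d) : 'rV[F]_K := \row_r entry v 0 r.
have ext_inj : injective ext.
  move=> v1 v2 /rowP h; apply/rowP => i.
  by have := h (widen_ord dK i); rewrite !mxE !(entryE _ ord0 i).
have <- : #|{: 'rV[F]_d}| = (#|F| ^ d)%N by rewrite card_mx mul1n.
rewrite -(fintype.card_image ext_inj); apply: eq_card => chi; rewrite inE.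
apply/forallP/fintype.imageP => [h|[v _ -> r]]; last first.
  by apply/implyP => dr; rewrite mxE (entry_out _ ord0).
exists (\row_i chi 0 (widen_ord dK i)) => //; apply/rowP => r; rewrite mxE.
have [rd|dr] := ltnP r d.
  rewrite (entryE _ ord0 (Ordinal rd)) mxE; congr (chi _ _); exact: val_inj.
by rewrite (entry_out _ ord0)//; apply/eqP; exact: (implyP (h r)).
Qed.

Lemma card_stratum k : (k <= K %/ e)%N ->
  (#|F| ^ (e * k) * (#|F| ^ e - 1) <= #|in_stratum k| * #|F| ^ e)%N.
Proof.
case: k => [|k] kK.
  rewrite muln0 expn0 mul1n (leq_trans (leq_subr _ _))// leq_pmull//.
  by apply/card_gt0P; exists 0; apply/andP; split=> //; apply/forallP => r; rewrite mxE eqxx implybT.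
pose X d := [pred chi : 'rV[F]_K | [forall r : 'I_K, (d <= r)%N ==> (chi 0 r == 0)]].
have XK l : (l <= K %/ e)%N -> #|X (e * l)%N| = (#|F| ^ (e * l))%N.
  by move=> lK; rewrite card_support// -[leqRHS](divnK eK) mulnC leq_mul2r lK orbT.
have subX : X (e * k)%N \subset X (e * k.+1)%N.
  apply/fintype.subsetP => chi /forallP h; apply/forallP => r; apply/implyP => kr.
  by apply: (implyP (h r)); rewrite (leq_trans _ kr)// leq_mul2l leqnSn orbT.
have -> : #|in_stratum k.+1| = (#|F| ^ (e * k.+1) - #|F| ^ (e * k))%N.
  rewrite -XK// -(XK k) 1?ltnW// -(cardID (X (e * k)%N) (X (e * k.+1)%N)).
  rewrite (_ : #|predI _ _| = #|X (e * k)%N|) ?addKn; last first.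
    apply: eq_card => chi; rewrite !inE andbC; apply: andb_idr.
    exact: (fintype.subsetP subX).
  apply: eq_card => chi; rewrite !inE /in_stratum /= andbC.
  have -> : [forall r : 'I_K, (e * k.+1 <= r)%N ==> (chi 0 r == 0)] =
            [forall r : 'I_K, (k < r %/ e)%N ==> (chi 0 r == 0)].
    by apply: eq_forallb => r; rewrite leq_divRL// mulnC.
  apply: andb_id2l => /forallP h.
  rewrite negb_forall; apply: eq_existsb => r.
  rewrite negb_imply mulnC -leq_divRL//; apply: andb_id2r => chir.
  rewrite eqn_leq andbC; apply: andb_idr => _; rewrite leqNgt.
  by apply/negP => kr; have := h r; rewrite kr (negPf chir).
rewrite mulnBr muln1 mulnS expnD mulnBl -mulnA leq_sub// mulnC.
exact: leqnn.
Qed.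

(** If [z] has a nonzero entry [r0] before [K0], then adding to the matrix, in
    the column [r0], any vector that vanishes before [K0] changes only blocks
    below the diagonal: the entries of the image of [z] from [K0] on are uniform. *)
Lemma card_preimage_tail K0 (z v1 v2 : 'cV[F]_K) (r0 : 'I_K) :
  (e %| K0)%N -> (r0 < K0)%N -> z r0 0 != 0 ->
  (forall r : 'I_K, (r < K0)%N -> v1 r 0 = v2 r 0) ->
  (#|[pred A | block_lower A && (A *m z == v1)]| <=
   #|[pred A | block_lower A && (A *m z == v2)]|)%N.
Proof.
move=> eK0 r0K0 z0 v12.
pose E : 'M[F]_K := (v2 - v1) *m ((z r0 0)^-1 *: delta_mx 0 r0).
have EE k c : E k c = (v2 k 0 - v1 k 0) * ((z r0 0)^-1 * (c == r0)%:R).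
  by rewrite mxE big_ord1 !mxE eqxx.
have Ez : E *m z = v2 - v1.
  apply/colP => k; rewrite mxE (bigD1 r0)//= big1 ?addr0 => [|c cr0]; rewrite EE.
    by rewrite eqxx mulr1 divfK// !mxE.
  by rewrite (negPf cr0) !mulr0 mul0r.
have E0 (k c : 'I_K) : (k %/ e <= c %/ e)%N -> E k c = 0.
  rewrite EE; case: eqVneq => [->|_] kc; last by rewrite !mulr0.
  rewrite v12 ?subrr ?mul0r//.
  by rewrite -(divnK eK0) -ltn_divLR// (leq_ltn_trans kc)// ltn_divLR// divnK.
rewrite -(fintype.card_image (addIr E)); apply: subset_leq_card.
apply/fintype.subsetP => B /fintype.imageP[A]; rewrite inE => /andP[bA /eqP Az] ->.
rewrite inE mulmxDl Az Ez [v1 + _]addrC subrK eqxx andbT; apply/andP; split.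
  apply/forallP => k; apply/forallP => c; apply/implyP => kc.
  by rewrite mxE (block_lower0 bA)// E0 ?addr0// ltnW.
apply/forallP => T.
have bTT : mx_block e (entry A) T T \in unitmx by case/andP: bA => _ /forallP.
suff -> : mx_block e (entry (A + E)) T T = mx_block e (entry A) T T by [].
apply/matrixP => i j.
have idxE (A' : 'M[F]_K) : mx_block e (entry A') T T i j =
   A' (Ordinal (block_lt (ltn_ord T) (ltn_ord i))) (Ordinal (block_lt (ltn_ord T) (ltn_ord j))).
  by rewrite mxE -entryE.
by rewrite !idxE mxE E0 ?addr0//= !block_div.
Qed.

End BlockTriangular.

(** ** Independent matrices, one for each coordinate *)

Section Families.
Variables (F : finFieldType) (s K : nat) (e : 'I_s -> nat).
Hypotheses (e_gt0 : forall j, (0 < e j)%N) (eK : forall j, (e j %| K)%N).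

Definition block_lower_family : {pred {ffun 'I_s -> 'M[F]_K}} :=
  family (fun j => block_lower (e j) (K := K) (F := F)).

Lemma card_familyE (Q : 'I_s -> {pred 'M[F]_K}) :
  #|family Q| = (\prod_j #|Q j|)%N.
Proof. by rewrite card_family foldrE big_map big_enum. Qed.

(** Row [j] of a matrix of type ['M_(s, K)] holds the first [K] digits of the
    coordinate [j], which has its own scrambling matrix [A j]. *)
Definition act (A : {ffun 'I_s -> 'M[F]_K}) (x : 'M[F]_(s, K)) : 'M[F]_(s, K) :=
  \matrix_(j, k) \sum_l A j k l * x j l.

(** The adjoint of [act] for [pairing], which moves frequencies. *)
Definition coact (A : {ffun 'I_s -> 'M[F]_K}) (chi : 'M[F]_(s, K)) : 'M[F]_(s, K) :=
  \matrix_(j, l) \sum_k chi j k * A j k l.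

Lemma act_is_linear A : linear (act A).
Proof.
move=> a x y; apply/matrixP => j k; rewrite !mxE mulr_sumr -big_split/=.
by apply: eq_bigr => l _; rewrite !mxE mulrDr mulrCA.
Qed.

HB.instance Definition _ A := GRing.isLinear.Build F 'M[F]_(s, K) 'M[F]_(s, K) _
  (act A) (act_is_linear A).

Lemma pairing_act A chi x : pairing chi (act A x) = pairing (coact A chi) x.
Proof.
apply: eq_bigr => j _.
under eq_bigr => k _ do rewrite mxE mulr_sumr.
under [RHS]eq_bigr => k _ do rewrite mxE mulr_suml.
rewrite exchange_big; apply: eq_bigr => l _ /=.
by apply: eq_bigr => k _; rewrite mulrA.
Qed.

Lemma row_act A x j : (row j (act A x))^T = A j *m (row j x)^T.
Proof. by apply/colP => k; rewrite !mxE; apply: eq_bigr => l _; rewrite !mxE. Qed.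

Lemma row_coact A chi j : row j (coact A chi) = row j chi *m A j.
Proof. by apply/rowP => k; rewrite !mxE; apply: eq_bigr => l _; rewrite !mxE. Qed.

Lemma card_act_tail K0 (z v1 v2 : 'M[F]_(s, K)) :
  (forall j, e j %| K0)%N ->
  (forall j, exists2 r : 'I_K, (r < K0)%N & z j r != 0) ->
  (forall j (r : 'I_K), (r < K0)%N -> v1 j r = v2 j r) ->
  #|[pred A in block_lower_family | act A z == v1]| =
  #|[pred A in block_lower_family | act A z == v2]|.
Proof.
move=> eK0 z0; wlog suff : v1 v2 / (forall j (r : 'I_K), (r < K0)%N -> v1 j r = v2 j r) ->
    (#|[pred A in block_lower_family | act A z == v1]| <=
     #|[pred A in block_lower_family | act A z == v2]|)%N.
  move=> h v12; apply/eqP; rewrite eqn_leq !h// => j r rK0.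
  by rewrite v12.
move=> v12.
have factor v : #|[pred A in block_lower_family | act A z == v]| =
    (\prod_j #|[pred A : 'M[F]_K | block_lower (e j) A && (A *m (row j z)^T == (row j v)^T)]|)%N.
  rewrite -card_familyE; apply: eq_card => A; rewrite !inE.
  apply/andP/familyP => [[/familyP bA /eqP Az] j|h].
    by rewrite inE -row_act Az eqxx andbT; exact: bA.
  split; first by apply/familyP => j; have := h j; rewrite inE => /andP[].
  apply/eqP/row_matrixP => j; apply: trmx_inj.
  by have := h j; rewrite inE -row_act => /andP[_ /eqP].
rewrite !factor; apply: leq_prod => j _.
have [r rK0 zr] := z0 j.
apply: (card_preimage_tail _ _ (eK0 j) rK0) => //; first by rewrite !mxE.
by move=> r' r'K0; rewrite !mxE v12.
Qed.

(** By [card_image_stratum] in each row, a random family moves [chi] into [Z] with a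
    probability at most the density of [Z] in the strata of the rows of [chi]. *)
Lemma card_coact_stratum (k : 'I_s -> nat) (chi : 'M[F]_(s, K)) (Z : {pred 'M[F]_(s, K)}) :
  (forall j, k j <= K %/ e j)%N -> (forall j, in_stratum (e j) (k j) (row j chi)) ->
  (#|[pred A in block_lower_family | coact A chi \in Z]| *
     \prod_j #|in_stratum (F := F) (K := K) (e j) (k j)| <=
   #|[pred chi' in Z | [forall j, in_stratum (e j) (k j) (row j chi')]]| *
     #|block_lower_family|)%N.
Proof.
move=> kK Ochi.
have stable A : A \in block_lower_family ->
    [forall j, in_stratum (e j) (k j) (row j (coact A chi))].
  move=> /familyP bA; apply/forallP => j; rewrite row_coact.
  exact: (stratum_stable (e_gt0 j) (eK j) (kK j) (bA j)).
rewrite -[X in (X * _ <= _)%N]sum1_card (partition_big (coact^~ chi)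
  (mem [pred chi' in Z | [forall j, in_stratum (e j) (k j) (row j chi')]]))/=; last first.
  by move=> A; rewrite !inE => /andP[bA ->]; exact: stable.
rewrite big_distrl -sum_nat_const/=; apply: leq_sum => chi' _.
apply: (@leq_trans (#|[pred A in block_lower_family | coact A chi == chi']| *
   \prod_j #|in_stratum (F := F) (K := K) (e j) (k j)|)%N).
  rewrite leq_mul2r; apply/orP; right; rewrite sum1_card; apply: subset_leq_card.
  apply/fintype.subsetP => A /andP[/andP[bA _] chiA].
  by apply/andP; split.
have -> : #|[pred A in block_lower_family | coact A chi == chi']| =
    (\prod_j #|[pred A : 'M[F]_K | block_lower (e j) A && (row j chi *m A == row j chi')]|)%N.
  rewrite -card_familyE; apply: eq_card => A; rewrite !inE.
  apply/andP/familyP => [[/familyP bA /eqP Az] j|h].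
    by rewrite inE -row_coact Az eqxx andbT; exact: bA.
  split; first by apply/familyP => j; have := h j; rewrite inE => /andP[].
  apply/eqP/row_matrixP => j.
  by have := h j; rewrite inE -row_coact => /andP[_ /eqP].
rewrite card_familyE -big_split/=; apply: leq_prod => j _.
exact: card_image_stratum.
Qed.

End Families.

(** * Linear independence of the rows of the generating matrices *)

Section Laurent.
Variable F : fieldType.
Implicit Types (u v w : {poly F}) (a : int -> F).

Definition coef_int u (n : int) : F := if n is Posz k then u`_k else 0.

(** The coefficient of [x^n] in [v * \sum_r (a r) x^(- r)]. *)
Definition laurent_mul v a (n : int) : F := \sum_(i < size v) v`_i * a (i%:Z - n).

Lemma laurent_mul_wide N v a n : (size v <= N)%N ->
  laurent_mul v a n = \sum_(i < N) v`_i * a (i%:Z - n).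
Proof.
move=> vN; rewrite /laurent_mul (big_ord_widen N (fun i => v`_i * a (i%:Z - n)))//.
rewrite big_mkcond; apply: eq_bigr => i _; case: ltnP => // vi.
by rewrite nth_default// mul0r.
Qed.

Lemma laurent_mulD v w a n :
  laurent_mul (v + w) a n = laurent_mul v a n + laurent_mul w a n.
Proof.
have h := leq_maxl (size v) (size w); have h' := leq_maxr (size v) (size w).
rewrite !(@laurent_mul_wide (maxn (size v) (size w)))// ?size_polyD//.
by rewrite -big_split; apply: eq_bigr => i _; rewrite coefD mulrDl.
Qed.

Lemma laurent_mulZ c v a n : laurent_mul (c *: v) a n = c * laurent_mul v a n.
Proof.
rewrite (@laurent_mul_wide (size v)) ?size_scale_leq// /laurent_mul mulr_sumr.
by apply: eq_bigr => i _; rewrite coefZ mulrA.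
Qed.

Lemma laurent_mulX v a n : laurent_mul (v * 'X) a n = laurent_mul v a (n - 1).
Proof.
rewrite (@laurent_mul_wide (size v).+1); last first.
  by rewrite (leq_trans (size_polyMleq _ _))// size_polyX addn2.
rewrite big_ord_recl coefMX mul0r add0r; apply: eq_bigr => i _.
rewrite coefMX/= /bump/= add1n; congr (_ * a _).
by rewrite -addn1 PoszD opprB addrAC -addrA [1 - n]addrC addrA.
Qed.

Lemma coef_int_sum (I : Type) (r : seq I) (f : I -> {poly F}) n :
  coef_int (\sum_(i <- r) f i) n = \sum_(i <- r) coef_int (f i) n.
Proof.
apply: (big_morph (coef_int^~ n)) => [u v|]; case: n => n /=.
- exact: coefD.
- by rewrite addr0.
- exact: coef0.
- by [].
Qed.

Lemma coef_intX u n : coef_int (u * 'X) n = coef_int u (n - 1).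
Proof.
case: n => [[|n]|n]; rewrite /coef_int ?coefMX//.
by rewrite -addn1 PoszD addrK addn1.
Qed.

Lemma laurent_expansion_mul u v a : laurent_expansion u v a ->
  forall w n, laurent_mul (w * v) a n = coef_int (w * u) n.
Proof.
case=> _ E w; elim/poly_ind: w => [|w c IH] n.
  rewrite !mul0r /laurent_mul size_poly0 big_ord0.
  by case: n => n //=; rewrite coef0.
rewrite !mulrDl -[w * 'X * v]mulrAC -[w * 'X * u]mulrAC laurent_mulD laurent_mulX IH.
rewrite -coef_intX !mul_polyC laurent_mulZ.
have -> : laurent_mul v a n = coef_int u n by exact: E.
by case: n => n /=; rewrite ?coefD ?coefZ// mulr0 addr0.
Qed.

(** If [v * a] is a polynomial and [a] has no coefficient at [x^-1, ..., x^-d]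
    where [d] is the degree of [v], then [a] has no fractional part at all: its
    tail times [v] would be a polynomial of negative degree. *)
Lemma laurent_dvdp u v a (N : int) :
  (forall r, r < N -> a r = 0) ->
  (forall n : nat, laurent_mul v a n = u`_n) ->
  (forall i : nat, (i.+1 < size v)%N -> a i.+1%:Z = 0) ->
  v %| u.
Proof.
move=> aN va_u a0.
pose w : {poly F} := \poly_(k < `|N|.+1) a (- k%:Z).
have wE k : w`_k = a (- k%:Z).
  rewrite coef_poly; case: ltnP => // Nk; rewrite aN// ltrNl.
  rewrite (le_lt_trans (ler_norm _))// normrN -abszE.
  by rewrite ltz_nat.
suff -> : u = w * v by exact: dvdp_mull.
apply/polyP => n; rewrite -va_u mulrC coefM.
rewrite (@laurent_mul_wide (maxn (size v) n.+1)) ?leq_maxl//.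
rewrite [RHS](big_ord_widen _ (fun i => v`_i * w`_(n - i)%N) (leq_maxr (size v) n.+1)).
rewrite [RHS]big_mkcond; apply: eq_bigr => i _; rewrite ltnS.
case: leqP => [le_in|lt_ni]; first by rewrite wE -subzn// opprB.
have [lt_iv|le_vi] := ltnP i (size v); last by rewrite nth_default// mul0r.
rewrite subzn ?(ltnW lt_ni)//.
have := a0 (i - n).-1; rewrite prednK ?subn_gt0// => -> //; first by rewrite mulr0.
by rewrite (leq_ltn_trans _ lt_iv)// leq_subr.
Qed.

End Laurent.

Section Independence.
Variables (b s : nat) (S : gns b s).
Local Notation p := (gns_base S).
Local Notation e := (gns_deg S).
Local Notation y := (gns_num S).

Lemma gns_deg_gt0 j : (0 < e j)%N. Proof. exact: gns_base_deg. Qed.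

Lemma gns_base_neq0 j : p j != 0. Proof. exact: monic_neq0 (gns_base_monic S j). Qed.

(** The numerators of a block are independent modulo the base polynomial, so a
    combination divisible by a full power is trivial, as seen by removing the
    blocks one at a time from the last one. *)
Lemma dvdp_numerators j k (chi : nat -> 'F_b) :
  p j ^+ k %| \sum_(r < k * e j) chi r *: (p j ^+ (k.-1 - r %/ e j) * y j r) ->
  forall r, (r < k * e j)%N -> chi r = 0.
Proof.
move=> dvd r; have ej := gns_deg_gt0 j.
suff H l : (l <= k)%N -> forall r, ((k - l) * e j <= r < k * e j)%N -> chi r = 0.
  by move=> rk; apply: (H k) => //; rewrite subnn mul0n.
elim: l => [_|l IH lk] {}r; first by rewrite subn0 => /andP[h /(leq_ltn_trans h)]; rewrite ltnn.
have {}IH := IH (ltnW lk).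
have chi0 r' : ((k - l) * e j <= r')%N -> (r' < k * e j)%N -> chi r' = 0.
  by move=> h h'; apply: IH; rewrite h.
set u := (k - l.+1)%N; have ul : (k - l)%N = u.+1 by rewrite /u -subSn.
have uk : (u.+1 <= k)%N by rewrite -ul leq_subr.
pose f r := chi r *: (p j ^+ (k.-1 - r %/ e j) * y j r).
pose Y := \sum_(i < e j) chi (u * e j + i)%N *: y j (u * e j + i)%N.
have splitE : \sum_(r < k * e j) f r = \sum_(r < u * e j) f r + p j ^+ l * Y.
  rewrite -(big_mkord xpredT f) (@big_cat_nat _ _ _ (u.+1 * e j)) ?leq_mul2r ?uk ?orbT//=.
  rewrite [X in _ + X]big_nat_cond [X in _ + X]big1 ?addr0; last first.
    by move=> r' /andP[/andP[h h'] _]; rewrite /f chi0 ?scale0r// ul.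
  rewrite (@big_cat_nat _ _ _ (u * e j)) ?leq_mul2r ?leqnSn ?orbT//= big_mkord.
  congr (_ + _); rewrite -{1}[(u * e j)%N]add0n big_addn -mulnBl subSnn mul1n big_mkord.
  rewrite /Y mulr_sumr; apply: eq_bigr => i _.
  rewrite /f [(i + _)%N]addnC block_div// scalerAr; congr (_ * _).
  by congr (_ ^+ _); rewrite /u; lia.
have pl_dvd : p j ^+ l.+1 %| p j ^+ l * Y.
  have : p j ^+ l.+1 %| \sum_(r < k * e j) f r.
    by apply: dvdp_trans dvd; exact: dvdp_exp2l.
  rewrite splitE dvdp_addr// ; apply: (big_ind (fun q => p j ^+ l.+1 %| q)).
  - exact: dvdp0.
  - by move=> q1 q2; exact: dvdp_add.
  move=> i _; rewrite /f -mul_polyC dvdp_mull// dvdp_mulr// dvdp_exp2l//.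
  have := ltn_ord i; rewrite -ltn_divLR// => h.
  by move: h; rewrite /u; lia.
have {pl_dvd} : p j %| Y.
  by move: pl_dvd; rewrite exprSr dvdp_mul2l// expf_neq0// gns_base_neq0.
rewrite /dvdp /Y => /eqP pY.
have free := @gns_num_free _ _ S j u (fun i => chi (u * e j + i)%N).
have {free} chiu : forall i : 'I_(e j), chi (u * e j + i)%N = 0.
  apply: free; rewrite -[RHS]pY.
  rewrite (big_morph (fun q => q %% p j) (fun q1 q2 => modpD (p j) q1 q2) (mod0p _)).
  by apply: eq_bigr => i _; rewrite modpZl.
case/andP => ur rk; have [h|h] := leqP ((k - l) * e j) r; first exact: chi0.
have ie : (r - u * e j < e j)%N by rewrite ltn_subLR// -mulSnr -ul.
by have := chiu (Ordinal ie); rewrite /= subnKC.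
Qed.

(** The defining property of these sequences: the rows [r < k j * e j] of all
    the matrices are independent when restricted to their first [d] columns, where
    [d] is the degree of [V], the product of the [p j ^+ k j]. A dependency says
    that a combination [a] of the expansions of [y / p ^ t] starts after
    [x^(- d)]; as [V * a] is a polynomial, [laurent_dvdp] makes [a] itself a
    polynomial, and the partial fractions vanish one base polynomial at a time. *)
Lemma gns_rows_free (k : 'I_s -> nat) (chi : 'I_s -> nat -> 'F_b) :
  (forall i, (i < \sum_j k j * e j)%N ->
     \sum_j \sum_(r < k j * e j) chi j r * gns_matrix S j r i = 0) ->
  forall j r, (r < k j * e j)%N -> chi j r = 0.
Proof.
move=> chi0.
pose t j r := (r %/ e j)%N.+1.
pose a (n : int) := \sum_j \sum_(r < k j * e j) chi j r * gns_coef S j (t j r) r n.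
pose V := \prod_j p j ^+ k j.
pose W j := \prod_(i | i != j) p i ^+ k i.
have VW j : V = W j * p j ^+ k j by rewrite /V (bigD1 j)//= mulrC.
have tk j (r : 'I_(k j * e j)) : (t j r <= k j)%N.
  by rewrite /t ltn_divLR ?gns_deg_gt0.
pose T j := \sum_(r < k j * e j) chi j r *: (p j ^+ ((k j).-1 - r %/ e j) * y j r).
pose U := \sum_j W j * T j.
have expansion j r := @gns_coef_expansion _ _ S j (t j r) r (ltn0Sn _).
have Va n : laurent_mul V a n = coef_int U n.
  transitivity (\sum_j \sum_(r < k j * e j)
      chi j r * laurent_mul V (gns_coef S j (t j r) r) n).
    rewrite /laurent_mul /a.
    under eq_bigr => i _ do rewrite mulr_sumr.
    rewrite exchange_big; apply: eq_bigr => j _ /=.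
    under eq_bigr => i _ do rewrite mulr_sumr.
    rewrite exchange_big; apply: eq_bigr => r _ /=.
    by rewrite mulr_sumr; apply: eq_bigr => i _; rewrite mulrCA.
  rewrite coef_int_sum; apply: eq_bigr => j _; rewrite /T mulr_sumr.
  rewrite coef_int_sum.
  apply: eq_bigr => r _.
  have -> : V = W j * p j ^+ ((k j).-1 - r %/ e j) * p j ^+ t j r.
    rewrite -mulrA -exprD (VW j); congr (_ * _ ^+ _).
    by move: (tk j r); rewrite /t; move: (r %/ e j)%N => i; lia.
  rewrite (laurent_expansion_mul (expansion j r)) -scalerAr mulrA.
  by case: n => n /=; rewrite ?coefZ// mulr0.
have sizeV : size V = (\sum_j k j * e j).+1.
  rewrite /V size_prod => [|j _]; last by rewrite expf_neq0// gns_base_neq0.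
  have sz j : size (p j ^+ k j) = (k j * e j).+1.
    by rewrite -[LHS]prednK ?size_poly_gt0 ?expf_neq0 ?gns_base_neq0// size_exp mulnC.
  under eq_bigr do rewrite sz -addn1.
  by rewrite big_split/= sum1_card subSn ?leq_addl// addnK.
have [N aN] : exists N : int, forall r, r < N -> a r = 0.
  have hN j r : {N : int | forall n, n < N -> gns_coef S j (t j r) r n = 0}.
    by apply: cid; case: (expansion j r).
  pose N := - (\sum_j \sum_(r < k j * e j) `|sval (hN j r)|).
  exists N => n nN; rewrite /a big1// => j _; rewrite big1// => r _.
  rewrite (svalP (hN j r)) ?mulr0//; apply: (lt_le_trans nN).
  rewrite /N (bigD1 j)//= (bigD1 r)//= -addrA opprD.
  have h1 : - `|sval (hN j r)| <= sval (hN j r) by rewrite lerNl -normrN ler_norm.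
  apply: le_trans h1; rewrite gerDl oppr_le0 addr_ge0//; first by rewrite sumr_ge0.
  by apply: sumr_ge0 => i _; rewrite sumr_ge0.
have VU : V %| U.
  apply: (laurent_dvdp aN) => [n|i]; first by rewrite Va.
  rewrite sizeV ltnS => /chi0 h; rewrite -[RHS]h.
  by apply: eq_bigr => j _; apply: eq_bigr => r _.
move=> j; apply: dvdp_numerators; rewrite -/(T j).
have : p j ^+ k j %| U by apply: dvdp_trans VU; rewrite (VW j) dvdp_mull.
rewrite /U (bigD1 j)//= dvdp_addl; last first.
  apply: (big_ind (fun q => p j ^+ k j %| q)) => [|q1 q2|i ij].
  - exact: dvdp0.
  - exact: dvdp_add.
  by rewrite dvdp_mulr// /W (bigD1 j)//= 1?eq_sym// dvdp_mulr.
rewrite Gauss_dvdpr// coprimep_expl// /W.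
apply: (big_ind (fun q => coprimep (p j) q)) => [|q1 q2|i ij].
- exact: coprimep1.
- by rewrite coprimepMr => -> ->.
- by rewrite coprimep_expr// gns_base_coprime// eq_sym.
Qed.

End Independence.

(** * Counting the frequencies that a scrambled net does not see *)

Section Frequencies.
Variables (b s : nat) (S : gns b s) (m K : nat).
Hypothesis b_prime : prime b.
Local Notation e := (gns_deg S).
Hypothesis eK : forall j, (e j %| K)%N.

(** The first [K] digits of the points of the sequence, as a function of the
    first [m] digits of their indices. *)
Definition gen_map (u : 'rV['F_b]_m) : 'M['F_b]_(s, K) :=
  \matrix_(j, k) \sum_(i < m) gns_matrix S j k i * u 0 i.

Lemma gen_map_is_linear : linear gen_map.
Proof.
move=> a x y; apply/matrixP => j k; rewrite !mxE mulr_sumr -big_split/=.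
by apply: eq_bigr => l _; rewrite !mxE mulrDr mulrCA.
Qed.

HB.instance Definition _ := GRing.isLinear.Build 'F_b 'rV['F_b]_m 'M['F_b]_(s, K) _
  gen_map gen_map_is_linear.

Lemma pairing_gen_map (chi : 'M['F_b]_(s, K)) i :
  pairing chi (gen_map (delta_mx 0 i)) = \sum_j \sum_(r < K) chi j r * gns_matrix S j r i.
Proof.
apply: eq_bigr => j _; apply: eq_bigr => r _; rewrite mxE (bigD1 i)//= big1.
  by rewrite mxE !eqxx mulr1 addr0.
by move=> i' /negPf i'i; rewrite mxE i'i andbF mulr0.
Qed.

(** Frequencies supported by the first [k j] blocks are at most [d - m]
    dimensional when they vanish on the net, as they are determined by their
    values on the first [d] columns, the first [m] of which vanish. *)
Lemma card_annihilator (k : 'I_s -> nat) (i0 : 'I_s) :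
  (forall j, k j <= K %/ e j)%N -> (0 < k i0)%N ->
  (#|[pred chi : 'M['F_b]_(s, K) | [forall u, pairing chi (gen_map u) == 0%R] &
      [forall j, in_stratum (e j) (k j) (row j chi)]]| * b ^ m
   <= b ^ (\sum_j k j * e j))%N.
Proof.
move=> kK k0; set d := (\sum_j _)%N; set Z := [pred _ | _ & _].
pose val (chi : 'M['F_b]_(s, K)) (i : nat) := \sum_j \sum_(r < K) chi j r * gns_matrix S j r i.
have kjK j : (k j * e j <= K)%N by rewrite -[leqRHS](divnK (eK j)) leq_mul2r kK orbT.
have free (chi : 'M['F_b]_(s, K)) :
    (forall j (r : 'I_K), (k j <= r %/ e j)%N -> chi j r = 0) ->
    (forall i, (i < d)%N -> val chi i = 0) -> chi = 0.
  move=> supp chi0; apply/matrixP => j r; rewrite mxE.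
  have [rk|kr] := ltnP (r %/ e j)%N (k j); last exact: supp.
  rewrite -(entryE chi).
  apply: (@gns_rows_free _ _ S k (fun j r => entry chi j r)); last first.
    by rewrite -ltn_divLR// gns_deg_gt0.
  move=> i id; rewrite -[RHS](chi0 i id) /val; apply: eq_bigr => j' _.
  rewrite (big_ord_widen K (fun r => entry chi j' r * gns_matrix S j' r i))//.
  rewrite big_mkcond; apply: eq_bigr => r' _; rewrite entryE; case: ltnP => // kr.
  by rewrite supp ?mul0r// leq_divRL ?gns_deg_gt0.
have Zsupp chi : chi \in Z -> forall j (r : 'I_K), (k j <= r %/ e j)%N -> chi j r = 0.
  move=> /andP[_ /forallP h] j r kr; have := in_stratum0 (h j) kr.
  by rewrite mxE.
have Z0 chi : chi \in Z -> forall i, (i < m)%N -> val chi i = 0.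
  move=> /andP[/forallP h _] i im.
  by have := eqP (h (delta_mx 0 (Ordinal im))); rewrite pairing_gen_map.
have [dm|md] := leqP d m.
  rewrite eq_card0 ?mul0n// => chi; apply/negP => chiZ.
  have chi0 : chi = 0.
    by apply: free => [|i id]; [exact: Zsupp|apply: Z0 => //; exact: leq_trans dm].
  case/andP: chiZ => _ /forallP/(_ i0)/andP[_].
  by rewrite k0 /= => /existsP[r]; rewrite chi0 !mxE eqxx andbF.
pose tail (chi : 'M['F_b]_(s, K)) : 'rV['F_b]_(d - m) := \row_i val chi (m + i)%N.
have tail_inj : {in Z &, injective tail}.
  move=> chi1 chi2 Z1 Z2 /rowP h; apply/eqP; rewrite -subr_eq0; apply/eqP.
  have valB i : val (chi1 - chi2) i = val chi1 i - val chi2 i.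
    rewrite /val -sumrB; apply: eq_bigr => j _; rewrite -sumrB.
    by apply: eq_bigr => r _; rewrite !mxE mulrBl.
  apply: free => [j r kr|i id]; first by rewrite !mxE (Zsupp chi1)// (Zsupp chi2)// subr0.
  rewrite valB; have [im|mi] := ltnP i m; first by rewrite (Z0 chi1)// (Z0 chi2)// subr0.
  have im : (i - m < d - m)%N by rewrite ltn_sub2r.
  by have := h (Ordinal im); rewrite !mxE /= subnKC// => ->; rewrite subrr.
rewrite -(card_in_imset tail_inj) -[X in (_ <= b ^ X)%N](subnK (ltnW md)) expnD.
rewrite leq_mul2r; apply/orP; right; rewrite -[X in (_ <= X ^ _)%N](card_Fp b_prime).
by rewrite (leq_trans (max_card _))// card_mx mul1n.
Qed.

(** A random family moves [chi] uniformly inside its strata, where at most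
    [b ^ (d - m)] frequencies vanish on the net if [d] is the number of digits
    involved ([card_annihilator]); the strata hold [b ^ d] elements
    up to the factors [1 - b ^ (- e j)], which gives the product on both sides. *)
Lemma card_unseen_frequency (chi : 'M['F_b]_(s, K)) : chi != 0 ->
  (#|[pred A in block_lower_family (F := 'F_b) (K := K) e |
       [forall u, pairing chi (act A (gen_map u)) == 0%R]]| * b ^ m *
     \prod_j (b ^ e j - 1) <=
   \prod_j b ^ e j * #|block_lower_family (F := 'F_b) (K := K) e|)%N.
Proof.
move=> chi0; have e0 := @gns_deg_gt0 _ _ S.
have /choice[k kP] : forall j, exists k, (k <= K %/ e j)%N /\ in_stratum (e j) k (row j chi).
  by move=> j; have [k kK Ok] := ex_stratum (e0 j) (eK j) (row j chi); exists k.
have kK j : (k j <= K %/ e j)%N by case: (kP j).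
have Ochi j : in_stratum (e j) (k j) (row j chi) by case: (kP j).
have [i0 k0] : exists i0, (0 < k i0)%N.
  apply/existsP; apply: contraNT chi0 => /existsPn h; apply/eqP/matrixP => j r.
  have := in_stratum0 (Ochi j) (_ : (k j <= r %/ e j)%N); rewrite !mxE; apply.
  by have := h j; rewrite -eqn0Ngt => /eqP ->.
have := card_coact_stratum e0 eK [pred chi' | [forall u, pairing chi' (gen_map u) == 0]] kK Ochi.
set cnt := #|_|; set O := (\prod_j _)%N; set Z := #|_|; set B := #|_| => cntO.
have -> : #|[pred A in block_lower_family e | [forall u, pairing chi (act A (gen_map u)) == 0]]|
    = cnt.
  apply: eq_card => A; rewrite !inE; congr (_ && _).
  by apply: eq_forallb => u; rewrite pairing_act.
have O0 : (0 < O)%N.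
  by rewrite prodn_gt0// => j; apply/card_gt0P; exists (row j chi); exact: Ochi.
have Zb : (Z * b ^ m <= b ^ (\sum_j k j * e j))%N.
  exact: (card_annihilator kK k0).
have OB : (b ^ (\sum_j k j * e j) * \prod_j (b ^ e j - 1) <= O * \prod_j b ^ e j)%N.
  rewrite expn_sum -!big_split/=; apply: leq_prod => j _.
  have := card_stratum 'F_b (e0 j) (eK j) (kK j).
  by rewrite card_Fp// [(e j * k j)%N]mulnC.
rewrite -(leq_pmul2l O0).
have : (cnt * O * (b ^ m * \prod_j (b ^ e j - 1)) <=
    Z * B * (b ^ m * \prod_j (b ^ e j - 1)))%N by rewrite leq_mul2r cntO orbT.
have : (Z * b ^ m * (B * \prod_j (b ^ e j - 1)) <=
        b ^ (\sum_j k j * e j) * (B * \prod_j (b ^ e j - 1)))%N by rewrite leq_mul2r Zb orbT.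
have : (b ^ (\sum_j k j * e j) * \prod_j (b ^ e j - 1) * B <= O * \prod_j b ^ e j * B)%N.
  by rewrite leq_mul2r OB orbT.
move: (\prod_j (b ^ e j - 1))%N (\prod_j b ^ e j)%N (b ^ (\sum_j _))%N => x y t.
move: (b ^ m)%N => z h1 h2 h3.
have -> : (O * (cnt * z * x) = cnt * O * (z * x))%N by ring.
apply: (leq_trans h3).
have -> : (Z * B * (z * x) = Z * z * (B * x))%N by ring.
apply: (leq_trans h2).
have -> : (t * (B * x) = t * x * B)%N by ring.
by rewrite mulnA.
Qed.

(** The square submatrices of order [K0 >= m] are invertible, so that distinct
    points of a net already differ in their first [K0] digits, in every coordinate. *)
Lemma gen_map_neq0 K0 (u : 'rV['F_b]_m) (j : 'I_s) :
  (K0 <= K)%N -> (e j %| K0)%N -> (m <= K0)%N -> u != 0 ->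
  exists2 r : 'I_K, (r < K0)%N & gen_map u j r != 0.
Proof.
move=> K0K eK0 mK0 u0; apply: contrapT => nex.
have gen0 (r : 'I_K) : (r < K0)%N -> gen_map u j r = 0.
  by move=> rK0; apply/eqP; apply: contrapT => h; apply: nex; exists r => //; apply/negP.
pose C : 'M['F_b]_K0 := \matrix_(r, i) gns_matrix S j r i.
have Cfree : row_free C.
  rewrite -kermx_eq0; apply/rowV0P => v /sub_kermxP vC; apply/rowP => r; rewrite mxE -entryE.
  pose k j' := if j' == j then (K0 %/ e j)%N else 0%N.
  have kE : (\sum_j' k j' * e j' = K0)%N.
    rewrite (bigD1 j)//= /k eqxx divnK// big1 ?addn0// => j' /negPf ->.
    by rewrite mul0n.
  apply: (@gns_rows_free _ _ S k (fun j' r => entry v 0 r) _ j); last first.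
    by rewrite /k eqxx divnK.
  move=> i; rewrite kE => iK0; rewrite (bigD1 j)//= [X in _ + X]big1 ?addr0; last first.
    by move=> j' /negPf j'j; rewrite /k j'j mul0n big_ord0.
  rewrite /k eqxx divnK//; have /rowP/(_ (Ordinal iK0)) := vC; rewrite !mxE => h.
  rewrite -[RHS]h; apply: eq_bigr => r' _; rewrite !mxE.
  by rewrite (entryE v 0 r').
pose w : 'cV['F_b]_K0 := \col_i entry u 0 i.
have Cw : C *m w = 0.
  apply/colP => r; rewrite [RHS]mxE -(gen0 (widen_ord K0K r) (ltn_ord r)) !mxE.
  rewrite [RHS](eq_bigr (fun i : 'I_m => gns_matrix S j r i * entry u 0 i)); last first.
    by move=> i _; rewrite (entryE u 0 i).
  rewrite [RHS](big_ord_widen K0 (fun i => gns_matrix S j r i * entry u 0 i))//.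
  rewrite [RHS]big_mkcond; apply: eq_bigr => i _; rewrite !mxE; case: ltnP => // mi.
  by rewrite (entry_out u 0)// mulr0.
have w0 : w = 0.
  by rewrite -(mulKmx (_ : C \in unitmx) w) ?Cw ?mulmx0// -row_free_unit.
move/negP: u0; apply; apply/eqP/rowP => i; rewrite mxE -(entryE u 0 i).
by have /colP/(_ (widen_ord mK0 i)) := w0; rewrite !mxE.
Qed.

End Frequencies.

Section Digits.
Variable b : nat.
Hypothesis b_gt1 : (1 < b)%N.

Lemma digits_inj m n n' : (n < b ^ m)%N -> (n' < b ^ m)%N ->
  (forall i, (i < m)%N -> (n %/ b ^ i) %% b = (n' %/ b ^ i) %% b)%N -> n = n'.
Proof.
elim: m n n' => [|m IH] n n'; first by rewrite expn0 !ltnS !leqn0 => /eqP -> /eqP ->.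
move=> nm n'm h; rewrite (divn_eq n b) (divn_eq n' b).
have := h 0%N (ltn0Sn _); rewrite expn0 !divn1 => ->; congr (_ * _ + _)%N.
have b0 : (0 < b)%N by exact: ltnW.
apply: IH => [||i im]; rewrite ?ltn_divLR// -?expnSr//.
by rewrite -!divnMA -!expnS h.
Qed.

End Digits.

Section IndexDigits.
Variables (b m : nat).
Hypothesis b_prime : prime b.

Definition index_digits (n : 'I_(b ^ m)) : 'rV['F_b]_m := \row_i digit_vec b n i.

Lemma Fp_nat_inj n n' : (n < b)%N -> (n' < b)%N -> n%:R = n'%:R :> 'F_b -> n = n'.
Proof.
move=> nb n'b /(congr1 (fun x : 'F_b => x : nat)).
by rewrite !val_Fp_nat// !modn_small.
Qed.

Lemma index_digits_bij : bijective index_digits.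
Proof.
have b0 := prime_gt0 b_prime.
apply: inj_card_bij; last by rewrite card_mx card_Fp// card_ord mul1n.
move=> n n' /rowP h; apply/val_inj/(digits_inj (prime_gt1 b_prime) (ltn_ord n) (ltn_ord n')).
move=> i im; apply: Fp_nat_inj; rewrite ?ltn_pmod//.
by have := h (Ordinal im); rewrite !mxE.
Qed.

Lemma matrix_digits_gen_map s (S : gns b s) K (n : 'I_(b ^ m)) j (k : 'I_K) :
  matrix_digits (gns_matrix S j) n k = gen_map S K (index_digits n) j k.
Proof.
rewrite mxE /matrix_digits.
have digit0 i : (n < b ^ i)%N -> digit_vec b n i = 0.
  by move=> ni; rewrite /digit_vec divn_small// mod0n.
pose f i := gns_matrix S j k i * digit_vec b n i.
rewrite [RHS](eq_bigr (fun i : 'I_m => f i)) => [|i _]; last by rewrite mxE.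
rewrite -[LHS]/(\sum_(i < n) f i).
rewrite (big_ord_widen (maxn n m) f (leq_maxl _ _)).
rewrite [RHS](big_ord_widen (maxn n m) f (leq_maxr _ _)).
rewrite big_mkcond [RHS]big_mkcond; apply: eq_bigr => i _.
have b1 := prime_gt1 b_prime.
case: ltnP => [_|ni]; case: ltnP => [_|mi] //; rewrite /f digit0 ?mulr0//.
  by rewrite (leq_trans (ltn_ord n))// leq_exp2l.
by rewrite (leq_ltn_trans ni)// ltn_expl.
Qed.

End IndexDigits.

(** * The constant *)

Section LogSum.
Variables (R : realType) (beta : R).
Hypothesis beta_gt0 : 0 < beta.

(** Convexity of [t |-> t `^ (- beta)]. *)
Lemma powRN_convex (x y : R) : 0 < x -> 0 < y ->
  beta * (y - x) / (y * y `^ beta) <= (x `^ beta)^-1 - (y `^ beta)^-1.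
Proof.
move=> x0 y0; have yb := powR_gt0 beta y0.
have xyE : (x `^ beta)^-1 = expR (- (beta * ln (x / y))) * (y `^ beta)^-1.
  rewrite ln_div ?posrE// /powR !gt_eqF// -!expRN -expRD; congr expR.
  by ring.
rewrite xyE -[X in _ <= _ - X]mul1r -mulrBl invfM [leLHS]mulrA ler_wpM2r ?invr_ge0 ?powR_ge0//.
apply: (@le_trans _ _ (- (beta * ln (x / y)))); last first.
  by rewrite lerBrDl expR_ge1Dx.
rewrite -mulrA -mulrN; apply: ler_wpM2l; first exact: ltW.
rewrite lerNr.
have h : -1 < x / y - 1 by rewrite ltrBrDl subrr divr_gt0.
have := le_ln1Dx h; rewrite addrC subrK => /le_trans; apply.
by rewrite mulrBl divff ?gt_eqF// opprB.
Qed.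

(** Comparison with the increments of a primitive of [(t * ln t ^ (1 + beta))^-1]. *)
Lemma log_sum_step n : (2 < n)%N ->
  (n%:R * ln n%:R `^ (1 + beta))^-1 <=
  beta^-1 * ((ln n.-1%:R `^ beta)^-1 - (ln n%:R `^ beta)^-1).
Proof.
case: n => // n n2; rewrite ltnS in n2; rewrite [n.+1.-1]/=.
have n0 : 0 < n%:R :> R by rewrite ltr0n ltnW.
have l1 : 0 < ln n%:R :> R by rewrite ln_gt0// ltr1n.
have l2 : 0 < ln n.+1%:R :> R by rewrite ln_gt0// ltr1n ltnS ltnW.
have := powRN_convex l1 l2; rewrite [_^-1 * _]mulrC -ler_pdivrMr ?invr_gt0// invrK.
apply: le_trans.
rewrite powRD; last by rewrite (gt_eqF l2) implybT.
rewrite (powRr1 (ltW l2)) invfM mulrAC [_ * beta]mulrC.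
apply: ler_wpM2r; first by rewrite invr_ge0 mulr_ge0 ?powR_ge0// ltW.
apply: ler_wpM2l; first exact: ltW.
have q0 : 0 < n%:R / n.+1%:R :> R by rewrite divr_gt0.
have : -1 < n%:R / n.+1%:R - 1 :> R by rewrite ltrBrDl subrr.
move=> /le_ln1Dx; rewrite addrC subrK ln_div ?posrE// lerBrDr => h.
rewrite -lerN2 opprB; rewrite -lerBrDr in h; apply: (le_trans h).
have n1 : n.+1%:R != 0 :> R by rewrite pnatr_eq0.
rewrite -[X in _ - X](divff n1) -mulrBl -[in X in (_ - X) / _]natr1.
by rewrite opprD addrA subrr add0r mulN1r.
Qed.

Lemma log_sum_le N :
  \sum_(2 <= n < N.+2) (n%:R * ln n%:R `^ (1 + beta))^-1 <=
  (2 * ln 2 `^ (1 + beta))^-1 + (beta * ln 2 `^ beta)^-1 :> R.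
Proof.
case: N => [|N].
  by rewrite big_geq// addr_ge0 ?invr_ge0 ?mulr_ge0 ?powR_ge0 ?ltW.
suff : \sum_(2 <= n < N.+3) (n%:R * ln n%:R `^ (1 + beta))^-1 <=
  (2 * ln 2 `^ (1 + beta))^-1 + beta^-1 * ((ln 2 `^ beta)^-1 - (ln N.+2%:R `^ beta)^-1).
  move=> /le_trans; apply; rewrite lerD2l invfM mulrBr gerBl.
  by rewrite mulr_ge0 ?invr_ge0 ?powR_ge0 ?ltW.
elim: N => [|N IH]; first by rewrite big_nat1 subrr mulr0 addr0.
rewrite big_nat_recr//=; apply: (le_trans (lerD IH (log_sum_step _))) => //.
by rewrite -addrA -mulrDr addrA subrK.
Qed.

End LogSum.

Section Constant.
Variables (R : realType) (b s : nat) (S : gns b s) (beta : R).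
Hypotheses (b_prime : prime b) (beta_gt0 : 0 < beta).
Local Notation e := (gns_deg S).

(** There are only [b] monic polynomials of degree 1. *)
Lemma card_deg1 : (#|[pred j | e j == 1%N]| <= b)%N.
Proof.
rewrite -[leqRHS](card_Fp b_prime).
have base_inj : {in [pred j | e j == 1%N] &, injective (fun j => (gns_base S j)`_0)}.
  move=> i j; rewrite !inE => /eqP ei /eqP ej eq0.
  apply/eqP; apply: contraT => /(gns_base_coprime S).
  have size2 k : e k = 1%N -> size (gns_base S k) = 2%N.
    by rewrite /gns_deg /pdeg; case: size => // n /= ->.
  have linear k : e k = 1%N -> gns_base S k = 'X + ((gns_base S k)`_0)%:P.
    move=> ek; apply/polyP => n; rewrite coefD coefX coefC.
    case: n => [|[|n]]; rewrite ?add0r//=.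
      have := gns_base_monic S k; rewrite monicE lead_coefE (size2 k ek) /= => /eqP ->.
      by rewrite addr0.
    by rewrite nth_default ?addr0// (size2 k ek).
  have -> : gns_base S i = gns_base S j by rewrite (linear i ei) eq0 -(linear j ej).
  by rewrite coprimepp (size2 j ej).
by rewrite -(card_in_imset base_inj) max_card.
Qed.

(** As [1 + x <= expR x], the product of the [b ^ e j / (b ^ e j - 1)] is at most
    the exponential of the sum of the [(b ^ e j - 1)^-1]. Degree 1 contributes at
    most [b / (b - 1) <= 2], and degree [n] at most [(n * ln n ^ (1 + beta))^-1] by
    reducedness. *)
Lemma gain_le_constant : reduced (fun n => ln n%:R `^ (1 + beta)) S ->
  \prod_j (b ^ e j)%:R <=
  expR (2 + (2 * ln 2 `^ (1 + beta))^-1 + (beta * ln 2 `^ beta)^-1) *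
    \prod_j (b ^ e j - 1)%:R :> R.
Proof.
move=> [_ red]; have b1 := prime_gt1 b_prime.
have B1 n : (0 < n)%N -> 0 < (b ^ n)%:R - 1 :> R.
  by move=> n0; rewrite subr_gt0 ltr1n -(exp1n n) ltn_exp2r.
have BE n : (b ^ n - 1)%:R = (b ^ n)%:R - 1 :> R.
  by rewrite natrB// expn_gt0 (ltnW b1).
apply: (@le_trans _ _ (expR (\sum_j ((b ^ e j)%:R - 1)^-1) * \prod_j (b ^ e j - 1)%:R)).
  rewrite expR_sum -big_split/=; apply: ler_prod => j _; rewrite ler0n/= BE.
  have h := B1 _ (gns_deg_gt0 S j).
  rewrite -ler_pdivrMr//; apply: le_trans (expR_ge1Dx _).
  by rewrite -[X in X / _](subrK 1) mulrDl divff ?gt_eqF// mul1r.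
rewrite ler_wpM2r//; first by apply: prodr_ge0.
rewrite ler_expR -addrA.
pose N := \max_j e j.
pose cnt n := #|[pred j | e j == n]|.
have -> : \sum_j ((b ^ e j)%:R - 1)^-1 =
    \sum_(1 <= n < N.+2) (cnt n)%:R / ((b ^ n)%:R - 1) :> R.
  rewrite big_add1/= big_mkord.
  rewrite (partition_big (fun j => inord (e j).-1 : 'I_N.+1) predT)//=.
  apply: eq_bigr => n _; rewrite /cnt mulr_natl -sumr_const.
  have pE j : (inord (e j).-1 == n :> 'I_N.+1) = (e j == n.+1).
    have ej := gns_deg_gt0 S j.
    have eN : ((e j).-1 < N.+1)%N.
      by rewrite prednK// (leq_trans _ (leqnSn _))//; exact: leq_bigmax.
    by rewrite -val_eqE/= inordK// -[in RHS](prednK ej) eqSS.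
  rewrite (eq_bigl [pred j | e j == n.+1])//.
  by apply: eq_bigr => j /eqP ->.
rewrite big_ltn//; apply: lerD.
  rewrite expn1 ler_pdivrMr; last by have := B1 1%N isT; rewrite expn1.
  apply: (@le_trans _ _ b%:R); first by rewrite ler_nat card_deg1.
  by have : (2%:R : R) <= b%:R by [rewrite ler_nat]; lra.
apply: le_trans (log_sum_le beta_gt0 N); rewrite big_nat_cond [leRHS]big_nat_cond; apply: ler_sum => n.
rewrite andbT => /andP[n2 _].
have n0 : (0 < n)%N by exact: ltnW.
rewrite ler_pdivrMr ?B1// mulrC.
have := red n n2; rewrite -(ler_int R) => /le_trans/(_ (floor_le _)).
by rewrite natrX.
Qed.

End Constant.

(** * The law of the truncated scrambling *)

Section FiniteValued.
Context d (Omega : measurableType d) (R : realType) (P : probability Omega R).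
Variables (T : finType) (X : Omega -> T).
Hypothesis mX : forall x, measurable (X @^-1` [set x]).

Lemma preimage_pred (Q : {pred T}) :
  [set w | X w \in Q] = \bigcup_(x in [set` Q]) (X @^-1` [set x]).
Proof.
apply/seteqP; split=> [w /= QX|w [x Qx Xwx]]; first by exists (X w).
by rewrite /= Xwx.
Qed.

Lemma measurable_preimage_pred (Q : {pred T}) : measurable [set w | X w \in Q].
Proof.
by rewrite preimage_pred; exact: fin_bigcup_measurable.
Qed.

Lemma measure_preimage_pred (Q : {pred T}) :
  P [set w | X w \in Q] = (\sum_(x in Q) P (X @^-1` [set x]))%E.
Proof.
rewrite preimage_pred measure_fin_bigcup//; last first.
  by move=> x y _ _ [w [<- <-]].
by apply/esym/bigfs; rewrite ?index_enum_uniq// => i _; rewrite mem_index_enum.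
Qed.

End FiniteValued.

Section TruncatedScrambling.
Context d (Omega : measurableType d) (R : realType) (P : probability Omega R).
Variables (b s : nat) (e : 'I_s -> nat) (Z : coarse_scrambling P b e) (K : nat).
Hypotheses (e_gt0 : forall j, (0 < e j)%N) (eK : forall j, (e j %| K)%N).
Local Notation F := 'F_b.

Definition trunc_mx (w : Omega) : {ffun 'I_s -> 'M[F]_K} :=
  [ffun j => \matrix_(k, l) scr_mx Z j w k l].

Definition trunc_shift (w : Omega) : 'M[F]_(s, K) :=
  \matrix_(j, k) scr_shift Z j w k.

Definition trunc (w : Omega) := (trunc_mx w, trunc_shift w).

Lemma measurable_trunc x : measurable (trunc @^-1` [set x]).
Proof.
case: x => A delta.
have -> : trunc @^-1` [set (A, delta)] =
    (\bigcap_(i in [set: 'I_s * 'I_K * 'I_K])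
       [set w | scr_mx Z i.1.1 w i.1.2 i.2 = A i.1.1 i.1.2 i.2]) `&`
    (\bigcap_(i in [set: 'I_s * 'I_K])
       [set w | scr_shift Z i.1 w i.2 = delta i.1 i.2]).
  apply/seteqP; split=> w /=.
    move=> [<- <-]; split=> [[[j k] l] _|[j k] _] /=; last by rewrite mxE.
    by rewrite ffunE mxE.
  move=> [hA hD]; congr (_, _).
    apply/ffunP => j; apply/matrixP => k l; rewrite ffunE mxE.
    exact: (hA (j, k, l)).
  by apply/matrixP => j k; rewrite mxE; exact: (hD (j, k)).
apply: measurableI; apply: fin_bigcap_measurable => //= i _.
- exact: scr_mx_measurable.
- exact: scr_shift_measurable.
Qed.

(* Truncated entries and blocks, and the elementary object of each of them. *)
Let I : finType := (('I_s * 'I_K) + ('I_s * ('I_K * 'I_K)))%type.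

Let object (x : I) : 'I_s * nat + 'I_s * (nat * nat) :=
  match x with
  | inl (j, k) => inl (j, k : nat)
  | inr (j, (t, u)) => inr (j, (t : nat, u : nat))
  end.

Let inside (x : I) : bool :=
  match x with
  | inl _ => true
  | inr (j, (t, u)) => (u <= t)%N && (t < K %/ e j)%N
  end.

Let object_inj : injective object.
Proof.
move=> [[j k]|[j [t u]]] [[j' k']|[j' [t' u']]] //=.
  by case=> -> /val_inj ->.
by case=> -> /val_inj -> /val_inj ->.
Qed.

(* The value prescribed to an elementary object by the truncation [(A, delta)]. *)
Let event (A : {ffun 'I_s -> 'M[F]_K}) (delta : 'M[F]_(s, K))
    (i : 'I_s * nat + 'I_s * (nat * nat)) : set Omega :=
  match i with
  | inl (j, k) => (fun w => scr_shift Z j w k) @^-1` [set entry delta j k]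
  | inr (j, (t, u)) => (fun w => mx_block (e j) (scr_mx Z j w) t u) @^-1`
                         [set mx_block (e j) (entry (A j)) t u]
  end.

Let objects := [seq object x | x <- enum I & inside x].

Let objects_uniq : uniq objects.
Proof. by rewrite map_inj_uniq// filter_uniq// enum_uniq. Qed.

Let weight (x : I) : R :=
  match x with
  | inl _ => #|{: F}|%:R^-1
  | inr (j, (t, u)) =>
      if t == u then #|@unitmx F (e j)|%:R^-1
      else #|{: 'M[F]_(e j)}|%:R^-1
  end.

Definition trunc_weight : R := \prod_(x <- enum I | inside x) weight x.

Let event_block A delta w j (k l : 'I_K) :
  (\bigcap_(i in [set` objects]) event A delta i) w -> (l %/ e j <= k %/ e j)%N ->
  scr_mx Z j w k l = A j k l.
Proof.
move=> h lk; have ej := e_gt0 j.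
have kK : (k %/ e j < K %/ e j)%N by exact: block_index_lt.
have lt_K t : (t < K %/ e j)%N -> (t < K)%N by move=> /leq_trans; apply; exact: leq_div.
pose t : 'I_K := Ordinal (lt_K _ kK).
pose u : 'I_K := Ordinal (leq_ltn_trans lk (lt_K _ kK)).
have /h : object (inr (j, (t, u))) \in objects.
  by apply: map_f; rewrite mem_filter mem_enum /= lk kK.
move=> /= /matrixP/(_ (Ordinal (ltn_pmod k ej)) (Ordinal (ltn_pmod l ej))).
by rewrite !mxE /= -!divn_eq entryE.
Qed.

Let eventE A delta : A \in block_lower_family (F := F) (K := K) e ->
  trunc @^-1` [set (A, delta)] = \bigcap_(i in [set` objects]) event A delta i.
Proof.
move=> /familyP bA; apply/seteqP; split=> w /=.
  move=> [hA hdelta] _ /= /mapP[x + ->]; rewrite mem_filter => /andP[+ _].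
  case: x => [[j k] _|[j [t u]] /= /andP[ut tK]] /=.
    by rewrite entryE -hdelta mxE.
  apply/matrixP => i l; rewrite !mxE.
  have kK := block_lt (eK j) tK (ltn_ord i).
  have lK := block_lt (eK j) (leq_ltn_trans ut tK) (ltn_ord l).
  by rewrite [RHS](entryE (A j) (Ordinal kK) (Ordinal lK)) -hA ffunE mxE.
move=> h; congr (_, _).
  apply/ffunP => j; apply/matrixP => k l; rewrite ffunE mxE.
  have [kl|lk] := ltnP (k %/ e j) (l %/ e j); last exact: event_block h lk.
  by rewrite scr_mx_lower// (block_lower0 (bA j)).
apply/matrixP => j k; rewrite mxE.
have /h /= -> : object (inl (j, k)) \in objects.
  by apply: map_f; rewrite mem_filter mem_enum.
by rewrite entryE.
Qed.

Lemma trunc_law_in A delta : A \in block_lower_family (F := F) (K := K) e ->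
  P (trunc @^-1` [set (A, delta)]) = trunc_weight%:E.
Proof.
move=> bA; have indep := @scr_independent _ _ _ _ _ _ _ Z.
rewrite (eventE _ bA) (indep objects (event A delta) objects_uniq) => [|i]; last first.
  move=> /mapP[x _ ->]; case: x => [[j k]|[j [t u]]] /=.
    by exists [set entry delta j k].
  by exists [set mx_block (e j) (entry (A j)) t u].
rewrite big_map big_filter /trunc_weight (big_morph EFin EFinM erefl).
apply: eq_bigr => -[[j k]|[j [t u]]] /=.
  by move=> _; rewrite scr_shift_uniform /= div1r.
move=> /andP[ut tK]; case: eqVneq => [<-|tu].
  rewrite scr_diag_uniform.
  have /familyP/(_ j)/andP[_ /forallP/(_ (Ordinal tK))/= ->] := bA.
  by rewrite div1r.
by rewrite scr_lower_uniform ?div1r// ltn_neqAle eq_sym ut andbT.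
Qed.

Lemma trunc_law_out A delta : A \notin block_lower_family (F := F) (K := K) e ->
  P (trunc @^-1` [set (A, delta)]) = 0%E.
Proof.
move=> /familyP nA; have [j /negP nAj] : exists j, ~ block_lower (e j) (A j).
  by apply/existsNP.
move: nAj; rewrite negb_and => /orP[/forallPn[k /forallPn[l]]|/forallPn[t nu]].
  rewrite negb_imply => /andP[kl Akl].
  rewrite (_ : _ @^-1` _ = set0) ?measure0//; apply/seteqP; split=> // w /= [hA _].
  by move: Akl; rewrite -hA ffunE mxE scr_mx_lower// eqxx.
apply/eqP; rewrite eq_le measure_ge0 andbT.
have <- : P ((fun w => mx_block (e j) (scr_mx Z j w) t t) @^-1`
    [set mx_block (e j) (entry (A j)) t t]) = 0%E.
  by rewrite scr_diag_uniform (negPf nu) mul0r.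
have subset_event : trunc @^-1` [set (A, delta)] `<=`
    (fun w => mx_block (e j) (scr_mx Z j w) t t) @^-1`
      [set mx_block (e j) (entry (A j)) t t].
  move=> w /= [hA _]; apply/matrixP => i l; rewrite !mxE.
  have iK := block_lt (eK j) (ltn_ord t) (ltn_ord i).
  have lK := block_lt (eK j) (ltn_ord t) (ltn_ord l).
  by rewrite [RHS](entryE (A j) (Ordinal iK) (Ordinal lK)) -hA ffunE mxE.
apply: le_measure => //; rewrite inE; first exact: measurable_trunc.
rewrite (_ : _ @^-1` _ = \bigcap_(i in [set: 'I_(e j) * 'I_(e j)])
  [set w | scr_mx Z j w (t * e j + i.1)%N (t * e j + i.2)%N =
     mx_block (e j) (entry (A j)) t t i.1 i.2]).
  by apply: fin_bigcap_measurable => // i _; exact: scr_mx_measurable.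
apply/seteqP; split=> w /=; first by move=> <- [i l] _ /=; rewrite mxE.
by move=> h; apply/matrixP => i l; rewrite mxE; exact: (h (i, l)).
Qed.

(** Any admissible value of the truncation prescribes the same finite set of
    independent uniform objects, so all of them have the probability
    [trunc_weight]. *)
Lemma trunc_law (Q : {pred {ffun 'I_s -> 'M[F]_K} * 'M[F]_(s, K)}) :
  P [set w | trunc w \in Q] =
  (trunc_weight * #|[pred x in Q | x.1 \in block_lower_family e]|%:R)%:E.
Proof.
rewrite measure_preimage_pred; last exact: measurable_trunc.
rewrite (bigID (fun x => x.1 \in block_lower_family e))/= [X in (_ + X)%E]big1 ?adde0.
  rewrite (eq_bigr (fun=> trunc_weight%:E)) => [|[A delta] /andP[_ bA]]; last exact: trunc_law_in.
  rewrite sumEFin sumr_const mulr_natr; congr ((_ *+ _)%:E).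
by move=> [A delta] /andP[_ nA]; exact: trunc_law_out.
Qed.

End TruncatedScrambling.

(** * Random digits *)

Definition digit_seq (b s : nat) : Type := 'I_s -> nat -> 'F_b.

HB.instance Definition _ b s := gen_eqMixin (digit_seq b s).
HB.instance Definition _ b s := gen_choiceMixin (digit_seq b s).
HB.instance Definition _ b s := isPointed.Build (digit_seq b s) (fun _ _ => 0).

Definition head b s K (z : digit_seq b s) : 'M['F_b]_(s, K) := \matrix_(j, k) z j k.
Arguments head {b s} K z.

Definition cylinders (b s : nat) : set (set (digit_seq b s)) :=
  [set C | exists K (A : {pred 'M['F_b]_(s, K)}), C = [set z | head K z \in A]].

Definition digit_space (b s : nat) := g_sigma_algebraType (@cylinders b s).

Section Cylinders.
Variables b s : nat.
Local Notation F := 'F_b.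

Definition shrink K1 K (x : 'M[F]_(s, K)) : 'M[F]_(s, K1) := \matrix_(j, k) entry x j k.

Lemma shrink_head K1 K (z : digit_seq b s) : (K1 <= K)%N ->
  shrink K1 (head K z) = head K1 z.
Proof.
move=> K1K; apply/matrixP => j k; rewrite !mxE.
by rewrite (entryE _ j (widen_ord K1K k)) mxE.
Qed.

Lemma cylinder_level C : @cylinders b s C ->
  exists K1, forall K, (K1 <= K)%N ->
    exists A : {pred 'M[F]_(s, K)}, C = [set z | head K z \in A].
Proof.
move=> [K1 [A ->]]; exists K1 => K K1K.
exists (fun x : 'M[F]_(s, K) => shrink K1 x \in A); apply/funext => z /=.
by rewrite -(shrink_head z K1K).
Qed.

Lemma setI_closed_cylinders : setI_closed (@cylinders b s).
Proof.
move=> C1 C2 /cylinder_level[K1 h1] /cylinder_level[K2 h2].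
have [A1 ->] := h1 _ (leq_maxl K1 K2); have [A2 ->] := h2 _ (leq_maxr K1 K2).
exists (maxn K1 K2), (fun x : 'M[F]_(s, _) => (x \in A1) && (x \in A2)).
apply/seteqP; split=> z /=; first by case=> zA1 zA2; apply/andP.
by move=> /andP.
Qed.

Lemma cylindersT : @cylinders b s setT.
Proof. by exists 0%N, (fun=> true); apply/seteqP; split. Qed.

Lemma measurable_cylinder K (A : {pred 'M[F]_(s, K)}) :
  measurable ([set z | head K z \in A] : set (digit_space b s)).
Proof. by apply: sub_sigma_algebra; exists K, A. Qed.

Lemma measurable_head K x : measurable (head K @^-1` [set x] : set (digit_space b s)).
Proof.
rewrite (_ : _ @^-1` _ = [set z | head K z \in pred1 x]); first exact: measurable_cylinder.
by apply/seteqP; split=> z /=; rewrite !inE => /eqP.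
Qed.

Lemma measurable_fun_head d (T : measurableType d) K (g : 'M[F]_(s, K) -> T) :
  measurable_fun [set: digit_space b s] (fun z => g (head K z)).
Proof.
move=> _ B _; rewrite setTI.
rewrite (_ : _ @^-1` _ = [set z | head K z \in (fun x : 'M[F]_(s, K) => `[< B (g x) >])]).
  exact: measurable_cylinder.
by apply/funext => z /=; rewrite unfold_in asboolE.
Qed.

Lemma measurable_fun_digits d (T : measurableType d) (Y : T -> digit_space b s) :
  (forall K x, measurable [set w | head K (Y w) = x]) -> measurable_fun setT Y.
Proof.
move=> mY; apply: (@measurability _ _ T (digit_space b s) setT Y (@cylinders b s)) => // _ [C [K [A ->]] <-].
by rewrite setTI; exact: (measurable_preimage_pred (mY K)).
Qed.

End Cylinders.

Section Radix.
Variables (R : realType) (b : nat).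
Hypothesis b_prime : prime b.
Implicit Type z : nat -> 'F_b.

Let b_gt1 : (1 < b)%N := prime_gt1 b_prime.

Definition radix_part z K : R := \sum_(r < K) (z r : nat)%:R / b%:R ^+ r.+1.

Let bR_gt0 : 0 < b%:R :> R. Proof. by rewrite ltr0n ltnW. Qed.

Let term_ge0 z r : 0 <= (z r : nat)%:R / b%:R ^+ r.+1 :> R.
Proof. by rewrite divr_ge0// exprn_ge0// ltW. Qed.

Lemma radix_partE z K :
  radix_part z K = series (fun r => (z r : nat)%:R / b%:R ^+ r.+1 : R) K.
Proof. by rewrite /series /= big_mkord. Qed.

Lemma radix_part_nd z : nondecreasing_seq (radix_part z).
Proof.
apply/nondecreasing_seqP => K; rewrite /radix_part big_ord_recr /= lerDl.
exact: term_ge0.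
Qed.

Lemma radix_part_tail z K L : (K <= L)%N ->
  radix_part z L <= radix_part z K + (b%:R ^+ K)^-1 - (b%:R ^+ L)^-1.
Proof.
move=> /subnK <-; elim: (L - K)%N => [|n IH]; first by rewrite add0n addrK.
rewrite addSn /radix_part big_ord_recr /= -/(radix_part z (n + K)).
set L' := (n + K)%N in IH *.
apply: (@le_trans _ _ (radix_part z K + (b%:R ^+ K)^-1 - (b%:R ^+ L')^-1 +
   (b%:R - 1) / b%:R ^+ L'.+1)).
  apply: lerD => //; rewrite ler_pM2r ?invr_gt0 ?exprn_gt0//.
  rewrite lerBrDr natr1 ler_nat.
  by rewrite -[leqRHS](Fp_cast b_prime) ltn_ord.
rewrite -addrA lerD2l mulrBl exprS invfM mulrA divff ?gt_eqF// !mul1r.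
by rewrite addrA addNr add0r.
Qed.

Lemma radix_part_cvg z : radix_part z @ \oo --> radix_val R b z.
Proof.
have cvg_part : cvgn (radix_part z).
  apply: nondecreasing_is_cvgn; first exact: radix_part_nd.
  exists (radix_part z 0 + 1) => _ [K _ <-].
  rewrite (le_trans (radix_part_tail z (leq0n K)))// expr0 invr1 gerBl.
  by rewrite invr_ge0 exprn_ge0// ltW.
rewrite /radix_val (_ : series _ = radix_part z) //.
by apply/funext => K; rewrite radix_partE.
Qed.

Lemma radix_part_le z K : radix_part z K <= radix_val R b z.
Proof.
rewrite -(cvg_lim (@Rhausdorff R) (@radix_part_cvg z)).
by apply: nondecreasing_cvgn_le; [exact: radix_part_nd|apply: cvgP; exact: (@radix_part_cvg z)].
Qed.

Lemma radix_val_le z K : radix_val R b z <= radix_part z K + (b%:R ^+ K)^-1.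
Proof.
rewrite -(cvg_lim (@Rhausdorff R) (@radix_part_cvg z)); apply: limr_le.
  by apply: cvgP; exact: (@radix_part_cvg z).
exists K => // L /= KL; rewrite (le_trans (radix_part_tail z KL))// gerBl.
by rewrite invr_ge0 exprn_ge0// ltW.
Qed.

Lemma digit_sum K n : (n < b ^ K)%N ->
  (\sum_(i < K) (n %/ b ^ i %% b) * b ^ i = n)%N.
Proof.
elim: K n => [|K IH] n nK; first by move: nK; rewrite big_ord0 expn0 ltnS leqn0 => /eqP ->.
have b0 : (0 < b)%N by exact: ltnW.
rewrite big_ord_recl expn0 divn1 muln1 /=.
rewrite (eq_bigr (fun i : 'I_K => b * ((n %/ b) %/ b ^ i %% b * b ^ i))%N) => [|i _].
  by rewrite -big_distrr /= IH ?ltn_divLR -?expnSr// addnC [in RHS](divn_eq n b) mulnC.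
by rewrite /bump /= add1n -divnMA -expnS [RHS]mulnCA -expnS.
Qed.

(** The digits of [n / b ^ K]: its first digit is the most significant one of [n]. *)
Definition rev_digits K (n : 'I_(b ^ K)) : 'rV['F_b]_K :=
  \row_r index_digits n 0 (rev_ord r).

Lemma rev_digits_bij K : bijective (@rev_digits K).
Proof.
have rev_inj : injective (fun x : 'rV['F_b]_K => \row_r x 0 (rev_ord r)).
  move=> x y /rowP h; apply/rowP => r.
  by have := h (rev_ord r); rewrite !mxE rev_ordK.
exact: bij_comp (injF_bij rev_inj) (index_digits_bij K b_prime).
Qed.

Lemma radix_part_rev_digits K (n : 'I_(b ^ K)) z :
  (forall r : 'I_K, z r = rev_digits n 0 r) -> radix_part z K = n%:R / b%:R ^+ K.
Proof.
move=> zE; rewrite -[in RHS](digit_sum (ltn_ord n)) natr_sum mulr_suml.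
rewrite /radix_part [RHS](reindex_inj rev_ord_inj); apply: eq_bigr => r _ /=.
rewrite zE !mxE /digit_vec val_Fp_nat// modn_small ?ltn_pmod ?(ltnW b_gt1)//.
rewrite natrM -mulrA natrX /=; congr (_ * _).
have -> : b%:R ^+ K = b%:R ^+ (K - r.+1) * b%:R ^+ r.+1 :> R by rewrite -exprD subnK.
rewrite invfM mulrA divff ?mul1r//.
by rewrite expf_neq0// gt_eqF.
Qed.

End Radix.

(** * Uniform digits give uniform points *)

Section Counting.
Variable R : realType.

(** The distribution function of the uniform law on [0, 1]. *)
Definition clamp (x : R) : R := if x <= 0 then 0 else if 1 <= x then 1 else x.

Lemma clamp_ge0 x : 0 <= clamp x.
Proof. by rewrite /clamp; case: (leP x 0) => ?; case: (leP 1 x) => ?; lra. Qed.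

Lemma clamp_le1 x : clamp x <= 1.
Proof. by rewrite /clamp; case: (leP x 0) => ?; case: (leP 1 x) => ?; lra. Qed.

Lemma clamp_lipschitz x e : 0 <= e -> clamp x - clamp (x - e) <= e.
Proof. by rewrite /clamp => e0;
  case: (leP x 0) => ?; case: (leP 1 x) => ?; case: (leP (x - e) 0) => ?; case: (leP 1 (x - e)) => ?; lra. Qed.

(** Up to [1 / N], the grid of step [1 / N] on [0, 1) is uniformly distributed. *)
Lemma card_grid (N : nat) (x : R) : (0 < N)%N ->
  let c := #|[pred n : 'I_N | n%:R / N%:R < x]|%:R / N%:R in
  clamp x <= c <= Num.min 1 (clamp x + N%:R^-1).
Proof.
move=> N0; have N0R : 0 < N%:R :> R by rewrite ltr0n.
pose a := Num.max 0 (x * N%:R).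
have a0 : 0 <= a by rewrite le_max lexx.
have [u [au ua ulb]] : exists u : nat, [/\ a <= u%:R, u%:R < a + 1 &
    forall n : nat, (n%:R < x * N%:R) = (n < u)%N].
  have /andP[ta at1] := truncn_itv a0; set t := Num.truncn a in ta at1.
  have [ta'|at'] := eqVneq t%:R a.
    exists t; split; rewrite ?ta' ?ltrDl// => n.
    by rewrite -(ltr_nat R) ta' /a lt_max ltNge ler0n.
  have ta1 : t%:R < a by rewrite lt_neqAle at'.
  exists t.+1; split=> [||n]; rewrite ?ltW// -?natr1 ?ltrD2r//.
  have -> : (n%:R < x * N%:R) = (n%:R < a) by rewrite /a lt_max ltNge ler0n.
  rewrite ltnS; apply/idP/idP => [na|nt].
    by rewrite -ltnS -(ltr_nat R) (lt_trans na).
  by rewrite (le_lt_trans _ ta1)// ler_nat.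
have -> : #|[pred n : 'I_N | n%:R / N%:R < x]| = minn u N.
  rewrite -sum1_card (eq_bigl (fun n : 'I_N => (n < u)%N)) => [|n]; last first.
    by rewrite !inE ltr_pdivrMr// ulb.
  have [Nu|uN] := leqP N u.
    rewrite (eq_bigl predT) ?sum1_card ?card_ord// => n.
    by rewrite (leq_trans (ltn_ord n)).
  by rewrite (big_ord_narrow (ltnW uN)) sum1_card card_ord.
have uR : (minn u N)%:R = Num.min u%:R N%:R :> R.
  by rewrite /minn /Order.min ltr_nat; case: ifP.
have clampE : clamp x = Num.min 1 (a / N%:R).
  rewrite /a maxr_pMl ?invr_ge0 ?ler0n// mul0r mulfK ?gt_eqF// /clamp.
  rewrite /Order.max /Order.min; case: (ltP 0 x) => x0; last first.
    by rewrite ltNge ler01.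
  by case: (ltgtP 1 x).
rewrite /= uR minr_pMl ?invr_ge0 ?ler0n// divff ?gt_eqF// clampE.
have h1 : a / N%:R <= u%:R / N%:R by rewrite ler_pM2r ?invr_gt0.
have h2 : u%:R / N%:R < a / N%:R + N%:R^-1.
  by rewrite -[X in _ + X]mul1r -mulrDl ltr_pM2r ?invr_gt0.
have h3 : 0 <= N%:R^-1 :> R by rewrite invr_ge0.
set A := a / N%:R in h1 h2 *; set U := u%:R / N%:R in h1 h2 *; set E := N%:R^-1 in h2 h3 *.
apply/andP; split; rewrite !le_min !ge_min lexx ?orbT ?h1//=.
  by rewrite orbT.
have [A1|A1] := leP 1 A.
  by rewrite lerDl h3 orbT.
by rewrite (ltW h2).
Qed.

Lemma prod_lipschitz (I : Type) (r : seq I) (x y : I -> R) :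
  (forall i, 0 <= x i <= 1) -> (forall i, 0 <= y i <= 1) ->
  `|\prod_(i <- r) x i - \prod_(i <- r) y i| <= \sum_(i <- r) `|x i - y i|.
Proof.
move=> x01 y01; elim: r => [|i r IH]; first by rewrite !big_nil subrr normr0.
rewrite !big_cons; set X := \prod_(i <- r) x i; set Y := \prod_(i <- r) y i.
have -> : x i * X - y i * Y = (x i - y i) * X + y i * (X - Y) by ring.
have /andP[y0 y1] := y01 i.
have X0 : 0 <= X by apply: prodr_ge0 => k _; case/andP: (x01 k).
have X1 : X <= 1 by apply: prodr_ile1 => k _; exact: x01.
apply: (le_trans (ler_normD _ _)); rewrite !normrM (ger0_norm X0) (ger0_norm y0).
apply: lerD; first by rewrite ler_piMr.
by apply: (le_trans _ IH); rewrite ler_piMl.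
Qed.

End Counting.

Lemma card_rows (F : finFieldType) s K (Q : 'I_s -> {pred 'rV[F]_K}) :
  #|[pred x : 'M[F]_(s, K) | [forall j, row j x \in Q j]]| = (\prod_j #|Q j|)%N.
Proof.
pose rows (x : 'M[F]_(s, K)) : {ffun 'I_s -> 'rV[F]_K} := [ffun j => row j x].
have rows_inj : injective rows.
  by move=> x y /ffunP h; apply/row_matrixP => j; have := h j; rewrite !ffunE.
rewrite -(fintype.card_image rows_inj).
transitivity #|family Q|; last by rewrite card_family foldrE big_map big_enum.
apply: eq_card => f; apply/fintype.imageP/familyP => [[x + ->] j|fQ].
  by rewrite inE ffunE => /forallP/(_ j).
exists (\matrix_j f j).
  by rewrite inE; apply/forallP => j; rewrite rowK; exact: fQ.
by apply/ffunP => j; rewrite ffunE rowK.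
Qed.

Definition point_of (R : realType) b s (z : digit_space b s) :
    s.-tuple (measurableTypeR R) := [tuple radix_val R b (z j) | j < s].

Section UniformPoint.
Variables (R : realType) (b s E : nat).
Hypotheses (b_prime : prime b) (E_gt0 : (0 < E)%N).
Variable mu : probability (digit_space b s) R.
Hypothesis mu_uniform : forall t (A : {pred 'M['F_b]_(s, t * E)}),
  mu [set z | head (t * E) z \in A] =
  (#|A|%:R / #|{: 'M['F_b]_(s, t * E)}|%:R)%:E.

Lemma measurable_radix_part K j :
  measurable_fun [set: digit_space b s] (fun z => radix_part R (z j) K).
Proof.
rewrite (_ : (fun _ => _) = fun z =>
   (\sum_(r < K) (head K z j r : nat)%:R / b%:R ^+ r.+1 : measurableTypeR R)).
  exact: (@measurable_fun_head b s _ R K (fun x => \sum_(r < K) (x j r : nat)%:R / b%:R ^+ r.+1)).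
by apply/funext => z; apply: eq_bigr => r _; rewrite mxE.
Qed.

Lemma measurable_point_of : measurable_fun setT (@point_of R b s).
Proof.
apply/measurable_fun_tnthP => j.
rewrite (_ : _ \o _ = fun z : digit_space b s => (radix_val R b (z j) : measurableTypeR R)).
  have mR : measurable_fun [set: digit_space b s] (fun z => radix_val R b (z j)).
    apply: (@measurable_fun_cvg _ (digit_space b s) R setT
      (fun K z => radix_part R (z j) K)) => [K|z _]; first exact: measurable_radix_part.
    exact: radix_part_cvg.
  exact: mR.
by apply/funext => z /=; rewrite tnth_mktuple.
Qed.

Lemma card_row_radix K (x : R) :
  #|[pred v : 'rV['F_b]_K | \sum_(r < K) (v 0 r : nat)%:R / b%:R ^+ r.+1 < x]| =
  #|[pred n : 'I_(b ^ K) | n%:R / (b ^ K)%:R < x]|.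
Proof.
have rev_bij := rev_digits_bij b_prime K.
rewrite -(on_card_preimset (onW_bij _ rev_bij)) cardsE; apply: eq_card => n.
rewrite !inE natrX; congr (_ < x).
rewrite -(@radix_part_rev_digits R _ b_prime K n (fun r => entry (rev_digits n) 0 r)).
  by apply: eq_bigr => r _; rewrite (entryE _ 0 r).
by move=> r; rewrite (entryE _ 0 r).
Qed.

Lemma radix_part_cdf t (x : 'I_s -> R) :
  mu [set z | forall j, radix_part R (z j) (t * E) < x j] =
  (\prod_j (#|[pred n : 'I_(b ^ (t * E)) | n%:R / (b ^ (t * E))%:R < x j]|%:R /
            (b ^ (t * E))%:R))%:E.
Proof.
set K := (t * E)%N.
pose Q j := [pred v : 'rV['F_b]_K | \sum_(r < K) (v 0 r : nat)%:R / b%:R ^+ r.+1 < x j].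
rewrite (_ : [set _ | _] =
    [set z | head K z \in [pred x : 'M['F_b]_(s, K) | [forall j, row j x \in Q j]]]).
  rewrite mu_uniform card_rows; congr (_%:E).
  have -> : #|{: 'M['F_b]_(s, K)}|%:R = \prod_(j < s) (b ^ K)%:R :> R.
    by rewrite card_mx card_Fp// mulnC expnM natrX prodr_const card_ord.
  by rewrite natr_prod -prodf_div; apply: eq_bigr => j _; rewrite card_row_radix.
apply/seteqP; split=> z /=; rewrite inE => h.
  apply/forallP => j; rewrite inE; have := h j; rewrite /radix_part.
  by congr (_ < _); apply: eq_bigr => r _; rewrite !mxE.
move=> j; have /forallP/(_ j) := h; rewrite inE /radix_part.
by congr (_ < _); apply: eq_bigr => r _; rewrite !mxE.
Qed.

(** The first [K] digits place the point, up to [b ^ (- K)] in each coordinate, on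
    a grid that it charges uniformly, and a product of numbers in [0, 1] is a
    Lipschitz function of its factors. *)
Lemma radix_cdf (x : 'I_s -> R) :
  mu [set z | forall j, radix_val R b (z j) < x j] = (\prod_j clamp (x j))%:E.
Proof.
have b_gt1 := prime_gt1 b_prime.
have mpart t (y : 'I_s -> R) :
    measurable ([set z | forall j, radix_part R (z j) (t * E) < y j] : set (digit_space b s)).
  rewrite (_ : [set _ | _] = [set z | head (t * E) z \in
      [pred v : 'M['F_b]_(s, t * E) |
        [forall j, \sum_(r < t * E) (v j r : nat)%:R / b%:R ^+ r.+1 < y j]]]).
    exact: measurable_cylinder.
  apply/seteqP; split=> z /=; rewrite inE => h; first apply/forallP => j.
    have := h j; rewrite /radix_part.
    by congr (_ < _); apply: eq_bigr => r _; rewrite !mxE.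
  move=> j; have /forallP/(_ j) := h; rewrite /radix_part.
  by congr (_ < _); apply: eq_bigr => r _; rewrite !mxE.
have mval : measurable ([set z | forall j, radix_val R b (z j) < x j] : set (digit_space b s)).
  rewrite (_ : [set _ | _] = \bigcap_(j in [set: 'I_s])
     ((fun z => tnth (point_of R z) j : R) @^-1` `]-oo, x j[)).
    apply: fin_bigcap_measurable => // j _.
    rewrite -[X in measurable X]setTI.
    have /measurable_fun_tnthP/(_ j) := measurable_point_of; apply => //.
  apply/seteqP; split=> z /=.
    by move=> h j _; rewrite /= in_itv/= tnth_mktuple; exact: h.
  by move=> h j; have := h j I; rewrite /= in_itv/= tnth_mktuple.
rewrite -[LHS]fineK ?fin_num_measure//; congr (_%:E).
set p := fine _; set q := \prod_j _.
have close t : `|p - q| <= s%:R * (b%:R ^+ (t * E))^-1.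
  set e := _^-1; have e0 : 0 <= e by rewrite invr_ge0 exprn_ge0.
  have bt : (0 < b ^ (t * E))%N by rewrite expn_gt0 ltnW.
  have eE : e = (b ^ (t * E))%:R^-1 by rewrite natrX.
  pose c (y : R) : R := #|[pred n : 'I_(b ^ (t * E)) | n%:R / (b ^ (t * E))%:R < y]|%:R /
            (b ^ (t * E))%:R.
  have grid y : clamp y <= c y <= Num.min 1 (clamp y + e).
    by rewrite eE; exact: card_grid.
  have lower : \prod_j clamp (x j - e) <= p.
    apply: (@le_trans _ _ (\prod_j c (x j - e))).
      by apply: ler_prod => j _; rewrite clamp_ge0; case/andP: (grid (x j - e)).
    rewrite -lee_fin -radix_part_cdf fineK ?fin_num_measure//.
    apply: le_measure; rewrite ?inE// => z /= h j.
    by rewrite (le_lt_trans (@radix_val_le R b b_prime (z j) (t * E)))// -ltrBrDr.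
  have upper : p <= \prod_j Num.min 1 (clamp (x j) + e).
    apply: (@le_trans _ _ (\prod_j c (x j))); last first.
      apply: ler_prod => j _; case/andP: (grid (x j)) => h1 h2.
      by rewrite (le_trans (clamp_ge0 _) h1).
    rewrite -lee_fin -radix_part_cdf fineK ?fin_num_measure//.
    apply: le_measure; rewrite ?inE// => z /= h j.
    by rewrite (le_lt_trans (@radix_part_le R b b_prime (z j) (t * E))).
  have c01 (y : R) : 0 <= clamp y <= 1 by rewrite clamp_ge0 clamp_le1.
  have m01 (y : R) : 0 <= Num.min 1 (clamp y + e) <= 1.
    by rewrite ge_min lexx le_min ler01 addr_ge0// clamp_ge0.
  have d1 := @prod_lipschitz R _ (index_enum 'I_s) (fun j => clamp (x j - e)) (fun j => clamp (x j))
    (fun j => c01 _) (fun j => c01 _).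
  have d2 := @prod_lipschitz R _ (index_enum 'I_s) (fun j => Num.min 1 (clamp (x j) + e)) (fun j => clamp (x j))
    (fun j => m01 _) (fun j => c01 _).
  have b1 : \sum_j `|clamp (x j - e) - clamp (x j)| <= s%:R * e.
    rewrite mulr_natl -[s in _ *+ s]card_ord -sumr_const; apply: ler_sum => j _.
    rewrite distrC ger0_norm ?clamp_lipschitz// subr_ge0.
    rewrite /clamp; case: (leP (x j) 0) => ?; case: (leP 1 (x j)) => ?; case: (leP (x j - e) 0) => ?; case: (leP 1 (x j - e)) => ?; lra.
  have b2 : \sum_j `|Num.min 1 (clamp (x j) + e) - clamp (x j)| <= s%:R * e.
    rewrite mulr_natl -[s in _ *+ s]card_ord -sumr_const; apply: ler_sum => j _.
    have := clamp_le1 (x j); rewrite /Order.min; case: ltP => h h'; last first.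
      by rewrite addrC addKr ger0_norm.
    by rewrite ger0_norm ?subr_ge0//; lra.
  have {d1 b1} := le_trans d1 b1; have {d2 b2} := le_trans d2 b2.
  rewrite !ler_norml -/q; lra.
apply/eqP; rewrite -subr_eq0 -normr_eq0 eq_le normr_ge0 andbT.
apply/ler_addgt0Pr => eps eps0; rewrite add0r.
have s0 : 0 <= s%:R :> R by [].
pose N := Num.truncn (s%:R / eps).
apply: (le_trans (close N.+1)).
have bN : N.+1%:R <= b%:R ^+ (N.+1 * E) :> R.
  rewrite -natrX ler_nat (leq_trans (ltnW (ltn_expl _ b_gt1)))// leq_exp2l//.
  by rewrite leq_pmulr.
rewrite ler_pdivrMr; last by rewrite (lt_le_trans _ bN).
rewrite -ler_pdivrMl// mulrC; apply: le_trans bN.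
by rewrite ltW// truncnS_gt.
Qed.

End UniformPoint.

(** * The law of a point with uniform digits *)

Section LebesgueTuple.
Variable R : realType.

Lemma lebesgue_tuple_box n (B : 'I_n -> set (measurableTypeR R)) :
  (forall i, measurable (B i)) ->
  lebesgue_tuple R n [set x | forall i, B i (tnth x i)] =
  (\prod_i (@lebesgue_measure R (B i)))%E.
Proof.
elim: n B => [|n IH] B mB.
  rewrite big_ord0 /= diracE mem_set//; by case.
have mB' : measurable [set x : n.-tuple (measurableTypeR R) |
    forall i, B (lift ord0 i) (tnth x i)].
  rewrite (_ : [set _ | _] = \bigcap_(i in [set: 'I_n])
     ((fun x : n.-tuple (measurableTypeR R) => tnth x i) @^-1` B (lift ord0 i))).
    apply: fin_bigcap_measurable => // i _.
    by rewrite -[X in measurable X]setTI; exact: measurable_tnth.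
  by apply/seteqP; split=> x /= h i; [move=> _|]; exact: h.
rewrite big_ord_recl -(IH (fun i => B (lift ord0 i)))// -product_measure1E//.
rewrite /= /lebesgue_cons /pushforward; congr (product_measure1 _ _ _).
apply/seteqP; split=> -[u v] /= h.
  split; first by have := h ord0; rewrite tnth0.
  by move=> i; have := h (lift ord0 i); rewrite tnthS.
case: h => hu hv i; case: (unliftP ord0 i) => [j|] ->; last by rewrite tnth0.
by rewrite tnthS; exact: hv.
Qed.

Definition lower_orthants n : set (set (n.-tuple (measurableTypeR R))) :=
  [set B | exists x : 'I_n -> R, B = [set y | forall i, (tnth y i : R) < x i]].

Lemma setI_closed_lower_orthants n : setI_closed (@lower_orthants n).
Proof.
move=> _ _ [x ->] [x' ->]; exists (fun i => Num.min (x i) (x' i)).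
apply/seteqP; split=> y /=.
  by move=> [h h'] i; rewrite lt_min h h'.
by move=> h; split=> i; have := h i; rewrite lt_min => /andP[].
Qed.

Lemma measurable_lower_orthant n B : @lower_orthants n B -> measurable B.
Proof.
move=> [x ->]; rewrite (_ : [set _ | _] = \bigcap_(i in [set: 'I_n])
     ((fun y : n.-tuple (measurableTypeR R) => tnth y i : R) @^-1` `]-oo, x i[)).
  apply: fin_bigcap_measurable => // i _.
  by rewrite -[X in measurable X]setTI; exact: measurable_tnth.
by apply/seteqP; split=> y /= h i; have := h i; rewrite /= ?in_itv/= => -> //.
Qed.

Lemma measurable_tupleE n :
  (measurable : set (set (n.-tuple (measurableTypeR R)))) = <<s @lower_orthants n >>.
Proof.
apply/seteqP; split; last first.
  apply: smallest_sub; first exact: sigma_algebra_measurable.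
  exact: measurable_lower_orthant.
apply: smallest_sub; first exact: smallest_sigma_algebra.
have coord i : measurable_fun
    [set: g_sigma_algebraType (@lower_orthants n)] (fun y => tnth y i : measurableTypeR R).
  apply: (@measurability _ _ (g_sigma_algebraType (@lower_orthants n)) (measurableTypeR R)
    setT (fun y : n.-tuple (measurableTypeR R) => tnth y i) (@RGenInftyO.G R)).
    exact: RGenInftyO.measurableE.
  move=> _ [_ [x ->] <-]; rewrite setTI.
  rewrite (_ : _ @^-1` _ = \bigcup_(k in [set: nat]) [set y : n.-tuple (measurableTypeR R) |
     forall j, (tnth y j : R) < (if j == i then x else k%:R)]).
    apply: bigcup_measurable => k _; apply: sub_sigma_algebra.
    by exists (fun j => if j == i then x else k%:R).
  apply/seteqP; split=> y /=; last by move=> [k _ /(_ i)]; rewrite eqxx in_itv/=.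
  rewrite in_itv/= => yx.
  exists (Num.truncn (\sum_j `|tnth y j : R|)).+1 => // j.
  case: eqP => [->//|_]; apply: le_lt_trans (truncnS_gt _).
  rewrite (bigD1 j)//= (le_trans (ler_norm _))// lerDl.
  exact: sumr_ge0.
case: n coord => [|n] coord; first by rewrite big_ord0.
rewrite -bigcup_mkord_ord; apply: bigcup_sub => i _ B [A mA <-].
by have := coord (inord i) measurableT A mA.
Qed.

End LebesgueTuple.

(** Change of variables for a random element [X] of law [mu]. *)
Lemma integral_comp_law d d' (Omega : measurableType d) (T : measurableType d')
    (R : realType) (P : probability Omega R) (mu : {measure set T -> \bar R})
    (X : {mfun Omega >-> T}) (g : T -> R) :
  (forall B, measurable B -> distribution P X B = mu B) ->
  mu.-integrable setT (EFin \o g) ->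
  P.-integrable setT (EFin \o (g \o X)) /\
  (\int[P]_w (g (X w))%:E = \int[mu]_z (g z)%:E)%E.
Proof.
move=> law ig; have /integrableP[mg g_fin] := ig.
have law_eq (h : T -> \bar R) :
    (\int[distribution P X]_x h x = \int[mu]_x h x)%E.
  by apply: eq_measure_integral => A mA _; exact: law.
have igX : P.-integrable setT (EFin \o (g \o X)).
  apply/integrableP; split.
    by apply/measurable_EFinP; apply: measurableT_comp => //; exact/measurable_EFinP.
  rewrite -(@ge0_integral_distribution _ _ _ _ _ P X (fun x => `|(g x)%:E|%E))//.
    by rewrite law_eq.
  exact: measurableT_comp.
split=> //.
by rewrite -law_eq (@integral_distribution _ _ _ _ _ P X _ mg igX).
Qed.

Section PointLaw.
Variables (R : realType) (b s E : nat).
Hypotheses (b_prime : prime b) (E_gt0 : (0 < E)%N).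
Variable mu : probability (digit_space b s) R.
Hypothesis mu_uniform : forall t (A : {pred 'M['F_b]_(s, t * E)}),
  mu [set z | head (t * E) z \in A] =
  (#|A|%:R / #|{: 'M['F_b]_(s, t * E)}|%:R)%:E.
Local Notation T := (s.-tuple (measurableTypeR R)).
Local Notation cube := (unit_cube R s).
Local Notation lambda := (lebesgue_tuple R s).
Local Notation restricted := (mrestr lambda (@measurable_unit_cube R s)).

HB.instance Definition _ := isMeasurableFun.Build _ _ (digit_space b s) T
  (@point_of R b s) (@measurable_point_of R b s b_prime).

Let point : {mfun digit_space b s >-> T} := @point_of R b s.

(** Both measures agree on the lower orthants, which are stable by intersection. *)
Lemma point_law A : measurable A -> distribution mu point A = restricted A.
Proof.
move=> mA; apply: (measure_unique (@lower_orthants R s)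
  (fun k => [set y | forall i, (tnth y i : R) < k%:R])) => //.
- exact: measurable_tupleE.
- exact: setI_closed_lower_orthants.
- by move=> k; exists (fun=> k%:R).
- apply/seteqP; split=> // y _.
  exists (Num.truncn (\sum_j `|tnth y j : R|)).+1 => // j.
  apply: le_lt_trans (truncnS_gt _).
  rewrite (bigD1 j)//= (le_trans (ler_norm _))// lerDl.
  exact: sumr_ge0.
- move=> _ [x ->].
  transitivity (mu [set z | forall j, radix_val R b (z j) < x j]).
    congr (mu _); apply/seteqP; split=> z /= h j; have := h j;
      by rewrite tnth_mktuple.
  rewrite (radix_cdf b_prime E_gt0 mu_uniform) /= /mrestr.
  rewrite (_ : _ `&` _ = [set y : T | forall j, (`]0, Num.min 1 (x j)[%classic : set R) (tnth y j)]).
    rewrite (@lebesgue_tuple_box R s (fun j => `]0, Num.min 1 (x j)[%classic : set R)) => [|j];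
      last exact: measurable_itv.
    rewrite (big_morph EFin EFinM erefl); apply: eq_bigr => j _.
    rewrite lebesgue_measure_itv/= lte_fin lt_min ltr01/= /clamp.
    have [//|x0] := leP (x j) 0.
    by rewrite oppr0 adde0; case: (ltgtP 1 (x j)).
  apply/seteqP; split=> y /=.
    move=> [hx hcube] j; rewrite in_itv/= lt_min hx.
    by have /andP[-> ->] := hcube j.
  move=> h; split=> j; have := h j; rewrite in_itv/= lt_min => /and3P[? ? ?] //.
  exact/andP.
- move=> k; rewrite (le_lt_trans (probability_le1 _ _)) ?ltry//.
  by apply: measurable_lower_orthant; exists (fun=> k%:R).
Qed.

Lemma integral_point (g : T -> R) :
  restricted.-integrable setT (EFin \o g) ->
  mu.-integrable setT (EFin \o (g \o point)) /\
  (\int[mu]_z (g (point z))%:E = \int[lambda]_(x in cube) (g x)%:E)%E.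
Proof.
move=> ig; have [ipoint ->] := integral_comp_law point_law ig; split=> //.
have mC : measurable (~` cube) by apply: measurableC; exact: measurable_unit_cube.
rewrite (negligible_integral mC measurableT ig); last first.
  by rewrite /= /mrestr setICl measure0.
rewrite setDE setCK setTI; apply: eq_measure_integral => A mA Acube.
by rewrite /= /mrestr; congr (lambda _); exact: setIidl.
Qed.

Lemma L2_cube_point (f : T -> R) : L2_cube f ->
  let F : digit_space b s -> R := f \o point in
  [/\ measurable_fun setT F,
      mu.-integrable setT (EFin \o F),
      mu.-integrable setT (EFin \o (fun z => F z ^+ 2)),
      (\int[mu]_z (F z)%:E = (cube_integral f)%:E)%E &
      (\int[mu]_z (F z ^+ 2)%:E = (cube_integral (fun x => (f x ^+ 2)%R))%:E)%E].
Proof.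
move=> f2 F.
have fin_restr : restricted setT \is a fin_num.
  rewrite (_ : restricted setT = distribution mu point setT); last first.
    by apply/esym/point_law.
  by rewrite fin_num_measure.
have if1 : restricted.-integrable setT (EFin \o f).
  by apply/Lfun1_integrable; exact: (Lfun_subset12 fin_restr).
have if2 := Lfun2_integrable_sqr f2.
have [iF EF] := integral_point if1.
have [iF2 EF2] := integral_point if2.
split=> //.
- by have /integrableP[/measurable_EFinP] := iF.
- by rewrite EF /cube_integral /Rintegral fineK// -EF integrable_fin_num.
- by rewrite EF2 /cube_integral /Rintegral fineK// -EF2 integrable_fin_num.
Qed.

End PointLaw.

(** * Integrals over pairs of digit sequences *)

Lemma integral_mscale d (T : measurableType d) (R : realType)
    (mu : {measure set T -> \bar R}) (k : {nonneg R}) (f : T -> \bar R) D :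
  measurable D -> mu.-integrable D f ->
  (\int[mscale k mu]_(x in D) f x = (k%:num)%:E * \int[mu]_(x in D) f x)%E.
Proof.
move=> mD intf; have mf := measurable_int mu intf.
rewrite [X in (_ * X)%E]integralE [LHS]integralE.
rewrite !ge0_integral_mscale//; [|exact: measurable_funeneg|exact: measurable_funepos].
have hp : (\int[mu]_(x in D) f^\+ x \is a fin_num)%E by exact: integrable_pos_fin_num.
have hn : (\int[mu]_(x in D) f^\- x \is a fin_num)%E by exact: integrable_neg_fin_num.
by rewrite -(fineK hp) -(fineK hn) -EFinB -[RHS]EFinM mulrBr.
Qed.

Definition cylinder_pairs b s : set (set (digit_space b s * digit_space b s)) :=
  [set A `*` B | A in @cylinders b s & B in @cylinders b s].

Lemma measurable_digit_pairE b s :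
  (measurable : set (set (digit_space b s * digit_space b s))) =
  <<s @cylinder_pairs b s >>.
Proof.
apply/seteqP; split; last first.
  apply: smallest_sub; first exact: sigma_algebra_measurable.
  by move=> _ [A cA [B cB <-]]; apply: measurableX; exact: sub_sigma_algebra.
rewrite measurable_prod_measurableType; apply: smallest_sub.
  exact: smallest_sigma_algebra.
move=> _ [A mA [B mB <-]].
pose T := g_sigma_algebraType (@cylinder_pairs b s).
have mfst : measurable_fun [set: T] (fst : T -> digit_space b s).
  apply: (@measurability _ _ T (digit_space b s) setT _ (@cylinders b s)) => //.
  move=> _ [C cC <-]; apply: sub_sigma_algebra; exists C => //.
  exists setT; first exact: cylindersT.
  by apply/seteqP; split=> -[x y] /=; [case|case].
have msnd : measurable_fun [set: T] (snd : T -> digit_space b s).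
  apply: (@measurability _ _ T (digit_space b s) setT _ (@cylinders b s)) => //.
  move=> _ [C cC <-]; apply: sub_sigma_algebra; exists setT; first exact: cylindersT.
  by exists C => //; apply/seteqP; split=> -[x y] /=; case.
have := @measurableI _ T _ _ (mfst measurableT A mA) (msnd measurableT B mB).
by rewrite !setTI.
Qed.

(** [nu] stands for the joint law of two points whose first digits are
    dependent, through [w], and whose other digits are independent: [tau] reads
    the first digits. *)
Section Cells.
Variables (R : realType) (b s : nat).
Local Notation G := (digit_space b s).
Variables (mu : probability G R) (nu : probability (G * G)%type R).
Variables (T : finType) (tau : G -> T) (w : T -> T -> R).
Hypothesis mtau : forall c, measurable (tau @^-1` [set c]).
Hypothesis w_ge0 : forall c c', 0 <= w c c'.
Hypothesis nu_cell : forall c c' C C', @cylinders b s C -> @cylinders b s C' ->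
  nu ((C `&` tau @^-1` [set c]) `*` (C' `&` tau @^-1` [set c'])) =
  ((w c c')%:E * (mu (C `&` tau @^-1` [set c])%classic *
                  mu (C' `&` tau @^-1` [set c'])%classic))%E.

Let cell c c' : set (G * G) := (tau @^-1` [set c]) `*` (tau @^-1` [set c']).

Let mcell c c' : measurable (cell c c'). Proof. exact: measurableX. Qed.

(** Pairs of cylinders generate the measurable sets and are stable by intersection. *)
Lemma nu_cellE c c' B : measurable B ->
  nu (B `&` cell c c') = ((w c c')%:E * (mu \x mu)%E (B `&` cell c c')%classic)%E.
Proof.
pose m1 : {measure set (G * G)%type -> \bar R} := mrestr nu (mcell c c').
pose m2 : {measure set (G * G)%type -> \bar R} := mscale (NngNum (w_ge0 c c')) (mrestr (mu \x mu)%E (mcell c c')).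
move=> mB; rewrite -[LHS]/(m1 B) -[RHS]/(m2 B).
apply: (@measure_unique _ R (G * G)%type (@cylinder_pairs b s) (fun=> setT) _ _ _ _ m1 m2 _ _ B mB).
- exact: measurable_digit_pairE.
- move=> _ _ [A1 cA1 [B1 cB1 <-]] [A2 cA2 [B2 cB2 <-]].
  exists (A1 `&` A2); first exact: setI_closed_cylinders.
  exists (B1 `&` B2); first exact: setI_closed_cylinders.
  by apply/seteqP; split=> -[x y] /=; [case=> -[? ?] [? ?]|case=> -[? ?] [? ?]].
- move=> _; exists setT; first exact: cylindersT.
  by exists setT; [exact: cylindersT|rewrite setXTT].
- by rewrite bigcup_const//; exists 0%N.
- move=> _ [C cC [C' cC' <-]].
  change (nu ((C `*` C') `&` cell c c') =
    ((w c c')%:E * (mu \x mu)%E ((C `*` C') `&` cell c c')%classic)%E).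
  have -> : (C `*` C') `&` cell c c' =
      (C `&` tau @^-1` [set c]) `*` (C' `&` tau @^-1` [set c']).
    by apply/seteqP; split=> -[x y] /=; [case=> -[? ?] [? ?]|case=> -[? ?] [? ?]].
  rewrite nu_cell// product_measure1E//; apply: measurableI => //; exact: sub_sigma_algebra.
- move=> _; rewrite /m1 /= /mrestr setTI.
  by rewrite (le_lt_trans (probability_le1 _ _)) ?ltry.
Qed.

Variable F : G -> R.
Hypotheses (mF : measurable_fun setT F) (iF : mu.-integrable setT (EFin \o F)).
Hypothesis iFF : nu.-integrable setT (fun z => (F z.1 * F z.2)%:E).

Let A c := (\int[mu]_(x in tau @^-1` [set c]) (F x)%:E)%E.

Let A_fin c : A c \is a fin_num.
Proof.
apply: integrable_fin_num; first exact: mtau.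
exact: integrableS iF.
Qed.

Let Fc c := (fun x => F x * \1_(tau @^-1` [set c]) x).

Let iFc c : mu.-integrable setT (EFin \o Fc c).
Proof.
have := iF; rewrite (_ : EFin \o Fc c = (EFin \o F) \_ (tau @^-1` [set c])).
  by move=> h; apply/integrable_restrict => //; rewrite setTI; exact: integrableS h.
apply/funext => x; rewrite /= /Fc patchE indicE; case: (x \in _); last by rewrite mulr0.
by rewrite mulr1.
Qed.

Let int_Fc c : (\int[mu]_x (Fc c x)%:E = A c)%E.
Proof.
rewrite /A [RHS]integral_mkcond; apply: eq_integral => x _.
rewrite /Fc patchE indicE; case: (x \in _); last by rewrite mulr0.
by rewrite mulr1.
Qed.

Lemma integrable_prodX (f g : G -> R) :
  mu.-integrable setT (EFin \o f) -> mu.-integrable setT (EFin \o g) ->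
  (mu \x mu)%E.-integrable setT (fun z : G * G => (f z.1 * g z.2)%:E) /\
  (\int[mu \x mu]_z (f z.1 * g z.2)%:E =
   (\int[mu]_x (f x)%:E) * (\int[mu]_x (g x)%:E))%E.
Proof.
move=> intf intg.
have /integrableP[/measurable_EFinP mf f_fin] := intf.
have /integrableP[/measurable_EFinP mg g_fin] := intg.
have mfg : measurable_fun setT (fun z : G * G => (f z.1 * g z.2)%:E).
  apply/measurable_EFinP; apply: measurable_funM.
    by apply: (measurableT_comp mf); exact: measurable_fst.
  by apply: (measurableT_comp mg); exact: measurable_snd.
have ifg : (mu \x mu)%E.-integrable setT (fun z : G * G => (f z.1 * g z.2)%:E).
  apply/(integrable12ltyP mu mu mfg) => /=.
  rewrite (eq_integral (fun x => `|(f x)%:E| * \int[mu]_y `|(g y)%:E|)%E) => [|x _].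
    rewrite ge0_integralZr//; last first.
    - exact: integral_ge0.
    - by apply/measurable_EFinP; exact: measurableT_comp.
    rewrite lte_mul_pinfty//; first exact: integral_ge0.
    by rewrite ge0_fin_numE// integral_ge0.
  rewrite -ge0_integralZl//; last by apply/measurable_EFinP; exact: measurableT_comp.
  by apply: eq_integral => y _; rewrite normrM.
split=> //; rewrite -integral12_prod_meas1//.
rewrite /fubini_F /=.
under eq_integral => x _.
  under eq_integral => y _ do rewrite EFinM.
  rewrite integralZl//.
  over.
rewrite /= -(fineK (integrable_fin_num measurableT intg)).
by rewrite integralZr.
Qed.

(** By Fubini on each pair of cells. *)
Lemma integral_pair_cells :
  (\int[nu]_z (F z.1 * F z.2)%:E =
   (\sum_(p : T * T) w p.1 p.2 * (fine (A p.1) * fine (A p.2)))%:E)%E.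
Proof.
have cover : [set: G * G] = \big[setU/set0]_(p <- enum {: T * T}) cell p.1 p.2.
  apply/seteqP; split=> // -[x y] _; rewrite -bigcup_seq.
  by exists (tau x, tau y) => //=; rewrite mem_enum.
rewrite cover integral_bigsetU_EFin//=; last 3 first.
- exact: enum_uniq.
- by move=> [c1 c2] [c1' c2'] _ _ /= [[x y] [[/= <- <-] [/= <- <-]]].
- by rewrite -cover; apply/measurable_EFinP; have /integrableP[/measurable_EFinP] := iFF.
rewrite -sumEFin big_enum /=; apply: eq_bigr => -[c c'] _ /=.
rewrite (@eq_measure_integral _ _ _ _ (mscale (NngNum (w_ge0 c c')) (mu \x mu)%E)); last first.
  by move=> B mB Bcell; have := nu_cellE c c' mB; rewrite (setIidl Bcell).
have [iprod Eprod] := integrable_prodX (iFc c) (iFc c').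
have restrictE : ((fun z : G * G => (F z.1 * F z.2)%:E) \_ (cell c c')) =
    (fun z => (Fc c z.1 * Fc c' z.2)%:E).
  apply/funext => -[x y]; rewrite patchE /Fc !indicE /=.
  rewrite -[(x, y) \in cell c c']/((x, y) \in _ `*` _) in_setX /=.
  by case: (x \in _); case: (y \in _); rewrite /= ?mulr1 ?mulr0 ?mul0r.
rewrite integral_mscale//; last first.
  by apply/integrable_mkcond => //; rewrite restrictE.
rewrite integral_mkcond restrictE Eprod !int_Fc.
by rewrite -(fineK (A_fin c)) -(fineK (A_fin c')) -!EFinM.
Qed.

End Cells.

(** * The digits of the scrambled points *)

Section ScrambledDigits.
Context d (Omega : measurableType d) (R : realType) (P : probability Omega R).
Variables (b s : nat) (S : gns b s) (Z : coarse_scrambling P b (gns_deg S)) (m : nat).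
Hypotheses (b_prime : prime b).
Local Notation F := 'F_b.
Local Notation e := (gns_deg S).
Local Notation G := (digit_space b s).

Definition scrambled_digits (n : nat) (w : Omega) : digit_space b s :=
  fun j => scramble (e j) (scr_mx Z j w) (scr_shift Z j w)
             (matrix_digits (gns_matrix S j) n).

(** Truncations to multiples of [step] respect the blocks of every coordinate. *)
Definition step : nat := (\prod_j e j)%N.

Lemma step_gt0 : (0 < step)%N.
Proof. by rewrite prodn_gt0// => j; exact: gns_deg_gt0. Qed.

Lemma dvdn_step t j : (e j %| t * step)%N.
Proof. by rewrite dvdn_mull// /step (bigD1 j)//= dvdn_mulr. Qed.

Section Level.
Variable t : nat.
Local Notation K := (t * step)%N.
Local Notation blf := (block_lower_family (F := F) (K := K) e).
Local Notation index := ({ffun 'I_s -> 'M[F]_K} * 'M[F]_(s, K))%type.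

(** The truncated digits of the [n]-th point as a function of the truncated scrambling. *)
Definition digits_of (n : 'I_(b ^ m)) (x : index) : 'M[F]_(s, K) :=
  act x.1 (gen_map S K (index_digits n)) + x.2.

Lemma head_scrambled (n : 'I_(b ^ m)) w :
  head K (scrambled_digits n w) = digits_of n (trunc Z K w).
Proof.
apply/matrixP => j k; rewrite !mxE /scrambled_digits /scramble; congr (_ + _).
have ej := gns_deg_gt0 S j.
have kK : ((k %/ e j).+1 * e j <= K)%N.
  rewrite -[leqRHS](divnK (dvdn_step t j)) leq_mul2r; apply/orP; right.
  exact: (block_index_lt ej (dvdn_step t j)).
pose f l := scr_mx Z j w k l * matrix_digits (gns_matrix S j) n l.
rewrite -[LHS]/(\sum_(l < (k %/ e j).+1 * e j) f l) (big_ord_widen K f kK).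
rewrite big_mkcond; apply: eq_bigr => l _.
rewrite ffunE mxE /f (matrix_digits_gen_map b_prime); case: ltnP => // kl.
by rewrite scr_mx_lower ?mul0r// leq_divRL.
Qed.

Local Notation weight := (@trunc_weight R b s e K).

Lemma digits_law (A : {pred index}) :
  P [set w | trunc Z K w \in A] =
  (weight * #|[pred x in A | x.1 \in blf]|%:R)%:E.
Proof. exact: (trunc_law Z (@gns_deg_gt0 _ _ S) (dvdn_step t)). Qed.

Lemma card_digits_of (n : 'I_(b ^ m)) (B : {pred 'M[F]_(s, K)}) :
  #|[pred x : index | (digits_of n x \in B) && (x.1 \in blf)]| = (#|blf| * #|B|)%N.
Proof.
rewrite -[LHS]sum1_card (eq_bigl (fun x : index => (x.1 \in blf) && (digits_of n x \in B))) => [|x]; last first.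
  by rewrite !inE andbC.
rewrite -(pair_big_dep (fun A : {ffun 'I_s -> 'M[F]_K} => A \in blf)
   (fun A delta => digits_of n (A, delta) \in B) (fun _ _ => 1%N)) /=.
rewrite -sum_nat_const; apply: eq_bigr => A _.
by rewrite -[RHS]sum1_card [RHS](reindex_inj (addrI (act A (gen_map S K (index_digits n))))).
Qed.

Lemma weight_normalized :
  weight * (#|blf|%:R * #|{: 'M[F]_(s, K)}|%:R) = 1.
Proof.
have b0 : (0 < b ^ m)%N by rewrite expn_gt0 prime_gt0.
have := digits_law predT.
rewrite (_ : [set _ | _] = setT) ?probability_setT; last by apply/seteqP; split.
move=> [] /esym; rewrite -natrM -(card_digits_of (Ordinal b0) predT) => {2}<-.
by congr (_ * _%:R); apply: eq_card => x; rewrite !inE.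
Qed.

Lemma head_law (n : 'I_(b ^ m)) (B : {pred 'M[F]_(s, K)}) :
  P [set w | head K (scrambled_digits n w) \in B] =
  (#|B|%:R / #|{: 'M[F]_(s, K)}|%:R)%:E.
Proof.
rewrite (_ : [set _ | _] = [set w | trunc Z K w \in [pred x | digits_of n x \in B]]).
  rewrite digits_law//; congr (_%:E).
  have -> : #|[pred x in [pred x | digits_of n x \in B] | x.1 \in blf]| = (#|blf| * #|B|)%N.
    by rewrite -(card_digits_of n); apply: eq_card => x; rewrite !inE.
  have N0 : #|{: 'M[F]_(s, K)}|%:R != 0 :> R by rewrite pnatr_eq0 (cardD1 0) inE.
  apply: (mulIf N0); rewrite divfK// natrM -[RHS]mul1r.
  by move/(congr1 ( *%R^~ #|B|%:R)): weight_normalized => <-; ring.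
by apply/funext => w /=; rewrite head_scrambled.
Qed.

(** The shift makes the first point uniform, and the difference of the two points
    does not depend on it. *)
Lemma card_digits_pair (n n' : 'I_(b ^ m)) (B B' : {pred 'M[F]_(s, K)}) :
  #|[pred x : index | [&& digits_of n x \in B, digits_of n' x \in B' & x.1 \in blf]]| =
  (\sum_(a in B) \sum_(a' in B')
     #|[pred A in blf | act A (gen_map S K (index_digits n' - index_digits n)) == (a' - a)%R]|)%N.
Proof.
under eq_bigr => a _ do under eq_bigr => a' _ do rewrite -sum1_card.
rewrite -[LHS]sum1_card (eq_bigl (fun x : index => (x.1 \in blf) &&
  ((digits_of n x \in B) && (digits_of n' x \in B')))) => [|x]; last first.
  by rewrite !inE andbA andbC.
rewrite -(pair_big_dep (fun A : {ffun 'I_s -> 'M[F]_K} => A \in blf)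
   (fun A delta => (digits_of n (A, delta) \in B) && (digits_of n' (A, delta) \in B'))
   (fun _ _ => 1%N)) /=.
transitivity (\sum_(A in blf) \sum_(a in B) \sum_(a' in B')
    (act A (gen_map S K (index_digits n' - index_digits n)) == (a' - a)%R))%N; last first.
  rewrite exchange_big; apply: eq_bigr => a _.
  rewrite exchange_big; apply: eq_bigr => a' _ /=.
  rewrite big_mkcond [RHS]big_mkcond; apply: eq_bigr => A _.
  rewrite [A \in [pred _ in _ | _]]inE /=.
  by case: (A \in blf) => //=; case: (_ == _).
apply: eq_bigr => A _.
rewrite (reindex_inj (addrI (- act A (gen_map S K (index_digits n))))) /=.
rewrite big_mkcond [RHS]big_mkcond; apply: eq_bigr => a _.
rewrite /digits_of /= addNKr.
have -> : act A (gen_map S K (index_digits n')) + (- act A (gen_map S K (index_digits n)) + a) =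
    a + act A (gen_map S K (index_digits n' - index_digits n)).
  by rewrite !linearB /= addrA addrC.
case: (a \in B) => //=; set v := act A _.
rewrite big_mkcond (bigD1 (a + v))//= big1 ?addn0 => [|a' a'v].
  by rewrite addrC addrK eqxx; case: (_ \in B').
case: (a' \in B') => //; case: eqP => // va; case/eqP: a'v.
by rewrite va addrC subrK.
Qed.

End Level.

End ScrambledDigits.

(** * The joint law of two scrambled points *)

Section PairLaw.
Context d (Omega : measurableType d) (R : realType) (P : probability Omega R).
Variables (b s : nat) (S : gns b s) (Z : coarse_scrambling P b (gns_deg S)) (m : nat).
Hypotheses (b_prime : prime b).
Local Notation F := 'F_b.
Local Notation e := (gns_deg S).
Local Notation G := (digit_space b s).
Local Notation step := (step S).
Local Notation blf K := (block_lower_family (F := F) (K := K) e).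
Local Notation index K := ({ffun 'I_s -> 'M[F]_K} * 'M[F]_(s, K))%type.
Local Notation weight K := (@trunc_weight R b s e K).

Lemma pow_gt0 : (0 < b ^ m)%N.
Proof. by rewrite expn_gt0 prime_gt0. Qed.

Lemma measurable_scrambled_digits (n : 'I_(b ^ m)) :
  measurable_fun [set: Omega] (scrambled_digits Z n : Omega -> G).
Proof.
apply: measurable_fun_digits => K x.
have KK : (K <= K * step)%N by rewrite leq_pmulr// step_gt0.
rewrite (_ : [set _ | _] = [set w | trunc Z (K * step) w \in
    [pred y | shrink K (digits_of n y) == x]]).
  exact: (measurable_preimage_pred (measurable_trunc Z (K := K * step))).
apply/funext => w /=; rewrite inE /= -(head_scrambled Z b_prime) shrink_head//.
by apply/propext; split=> /eqP.
Qed.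

HB.instance Definition _ (n : 'I_(b ^ m)) := isMeasurableFun.Build _ _ Omega G
  (scrambled_digits Z n) (measurable_scrambled_digits n).

(** The index 0 is an arbitrary choice, see [scrambled_digits_law]. *)
Definition digit_law : probability G R :=
  distribution P (scrambled_digits Z (Ordinal pow_gt0)).

Lemma digit_law_uniform t (A : {pred 'M[F]_(s, t * step)}) :
  digit_law [set z | head (t * step) z \in A] =
  (#|A|%:R / #|{: 'M[F]_(s, t * step)}|%:R)%:E.
Proof. exact: (head_law Z b_prime (Ordinal pow_gt0) A). Qed.

Lemma scrambled_digits_law (n : 'I_(b ^ m)) B : measurable B ->
  distribution P (scrambled_digits Z n) B = digit_law B.
Proof.
move=> mB; apply: (@measure_unique _ R G (@cylinders b s) (fun=> setT) _ _ _ _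
  (distribution P (scrambled_digits Z n)) digit_law _ _ B mB) => //.
- exact: setI_closed_cylinders.
- by move=> _; exact: cylindersT.
- by rewrite bigcup_const//; exists 0%N.
- move=> C /cylinder_level[K h].
  have [|A ->] := h (K * step)%N; first by rewrite leq_pmulr// step_gt0.
  have lawE (n' : 'I_(b ^ m)) := head_law Z b_prime n' A.
  exact: etrans (lawE n) (esym (lawE (Ordinal pow_gt0))).
- by move=> _; rewrite (le_lt_trans (probability_le1 _ _)) ?ltry.
Qed.

Definition digit_pair (n n' : 'I_(b ^ m)) (w : Omega) : G * G :=
  (scrambled_digits Z n w, scrambled_digits Z n' w).

Lemma measurable_digit_pair n n' : measurable_fun setT (digit_pair n n').
Proof.
by apply: measurable_fun_pair; exact: measurable_scrambled_digits.
Qed.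

HB.instance Definition _ n n' := isMeasurableFun.Build _ _ Omega (G * G)%type
  (digit_pair n n') (measurable_digit_pair n n').

Definition digit_pair_law n n' : probability (G * G)%type R :=
  distribution P (digit_pair n n').

Lemma integral_digit_pair n n' (g : G * G -> \bar R) : measurable_fun setT g ->
  P.-integrable setT (g \o digit_pair n n') ->
  (digit_pair_law n n').-integrable setT g /\
  (\int[digit_pair_law n n']_z g z = \int[P]_w g (digit_pair n n' w))%E.
Proof.
move=> mg ig; split; last exact: integral_distribution.
apply/integrableP; split=> //.
rewrite (ge0_integral_distribution (digit_pair n n') (f := fun z => `|g z|%E))//.
  by have /integrableP[] := ig.
exact: measurableT_comp.
Qed.

Lemma head_pair_law t (n n' : 'I_(b ^ m)) (B B' : {pred 'M[F]_(s, t * step)}) :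
  P [set w | head (t * step) (scrambled_digits Z n w) \in B /\
             head (t * step) (scrambled_digits Z n' w) \in B'] =
  (weight (t * step) * #|[pred x : index (t * step) |
     [&& digits_of n x \in B, digits_of n' x \in B' & x.1 \in blf (t * step)]]|%:R)%:E.
Proof.
rewrite (_ : [set _ | _] = [set w | trunc Z (t * step) w \in
    [pred x | (digits_of n x \in B) && (digits_of n' x \in B')]]).
  rewrite digits_law//; congr (_ * _%:R)%:E; apply: eq_card => x.
  by rewrite !inE /= andbA.
apply/funext => w /=; rewrite inE /= !(head_scrambled Z b_prime).
by apply/propext; split=> [[-> ->]//|/andP].
Qed.

Section Cell.
Variable t : nat.
Hypothesis mt : (m <= t)%N.
Local Notation K := (t * step)%N.
Local Notation K0 := (m * step)%N.

Let K0K : (K0 <= K)%N. Proof. by rewrite leq_mul2r mt orbT. Qed.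

Lemma card_fiber (c : 'M[F]_(s, K0)) :
  #|[pred a : 'M[F]_(s, K) | shrink K0 a == c]|%:R / #|{: 'M[F]_(s, K)}|%:R =
  #|{: 'M[F]_(s, K0)}|%:R^-1 :> R.
Proof.
apply: EFin_inj; rewrite -digit_law_uniform.
have := @digit_law_uniform m (pred1 c); rewrite card1 mul1r => <-.
congr (digit_law _); apply/funext => z /=.
by rewrite !inE shrink_head.
Qed.

(** Beyond the first [m * step] digits the two points are independent: their
    unscrambled digits differ before that position in every coordinate
    ([gen_map_neq0]), so that [card_act_tail] applies to their difference. *)
Lemma pair_cell_count (n n' : 'I_(b ^ m)) (c c' : 'M[F]_(s, K0)) : n != n' ->
  exists q, forall A A' : {pred 'M[F]_(s, K)},
    #|[pred x : index K | [&& digits_of n x \in [pred a in A | shrink K0 a == c],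
       digits_of n' x \in [pred a in A' | shrink K0 a == c'] & x.1 \in blf K]]| =
    (q * (#|[pred a in A | shrink K0 a == c]| * #|[pred a in A' | shrink K0 a == c']|))%N.
Proof.
move=> nn'.
pose z := gen_map S K (index_digits n' - index_digits n).
(* To the larger size [K], [shrink] extends by zeros. *)
exists #|[pred A in blf K | act A z == shrink K c' - shrink K c]| => A A'.
rewrite card_digits_pair [RHS]mulnC -[RHS]mulnA -[RHS]sum_nat_const; apply: eq_bigr => a.
rewrite inE => /andP[_ /eqP ac].
rewrite -[RHS]sum_nat_const; apply: eq_bigr => a'.
rewrite inE => /andP[_ /eqP ac'].
apply: (@card_act_tail _ _ _ _ (@gns_deg_gt0 _ _ S) (dvdn_step S t) K0).
- exact: dvdn_step.
- move=> j; apply: gen_map_neq0 => //.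
  + exact: dvdn_step.
  + by rewrite leq_pmulr// step_gt0.
  + rewrite subr_eq0; apply: contra_neq nn' => /(bij_inj (index_digits_bij m b_prime)).
    by move=> ->.
- move=> j r rK0; rewrite !mxE.
  have shrinkE (x : 'M[F]_(s, K)) : x j r = shrink K0 x j (Ordinal rK0).
    by rewrite mxE (entryE x j r).
  rewrite !shrinkE ac ac'.
  by rewrite (entryE c j (Ordinal rK0)) (entryE c' j (Ordinal rK0)).
Qed.

End Cell.

(** Joint density of the first digits of two points with respect to uniform
    independent digits. *)
Definition pair_density (n n' : 'I_(b ^ m)) (c c' : 'M[F]_(s, m * step)) : R :=
  #|{: 'M[F]_(s, m * step)}|%:R ^+ 2 * (weight (m * step) *
  #|[pred x : index (m * step) |
     [&& digits_of n x == c, digits_of n' x == c' & x.1 \in blf (m * step)]]|%:R).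

Lemma pair_cell_law (n n' : 'I_(b ^ m)) c c' C C' : n != n' ->
  @cylinders b s C -> @cylinders b s C' ->
  digit_pair_law n n' ((C `&` head (m * step) @^-1` [set c]) `*`
                  (C' `&` head (m * step) @^-1` [set c'])) =
  ((pair_density n n' c c')%:E *
   (digit_law (C `&` head (m * step) @^-1` [set c])%classic *
    digit_law (C' `&` head (m * step) @^-1` [set c'])%classic))%E.
Proof.
move=> nn' /cylinder_level[K1 h1] /cylinder_level[K2 h2].
pose t := maxn m (maxn K1 K2).
have mt : (m <= t)%N by rewrite leq_maxl.
have tK : (t <= t * step)%N by rewrite leq_pmulr// step_gt0.
have [|A ->] := h1 (t * step)%N.
  by apply: leq_trans tK; rewrite /t leq_max [X in _ || X]leq_max leqnn orbT.
have [|A' ->] := h2 (t * step)%N.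
  by apply: leq_trans tK; rewrite /t leq_max [X in _ || X]leq_max leqnn !orbT.
have K0K : (m * step <= t * step)%N by rewrite leq_mul2r mt orbT.
have cellE (B : {pred 'M[F]_(s, t * step)}) c0 :
    [set z : G | head (t * step) z \in B] `&` head (m * step) @^-1` [set c0] =
    [set z : G | head (t * step) z \in [pred a in B | shrink (m * step) a == c0]].
  apply/funext => z /=; rewrite inE /= shrink_head//.
  by apply/propext; split=> [[-> ->]|/andP[-> /eqP]]//; rewrite eqxx.
have [q hq] := pair_cell_count mt c c' nn'.
have pairE (B B' : {pred 'M[F]_(s, t * step)}) :
    digit_pair_law n n'
      ([set z : G | head (t * step) z \in [pred a in B | shrink (m * step) a == c]] `*`
       [set z : G | head (t * step) z \in [pred a in B' | shrink (m * step) a == c']]) =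
    (weight (t * step) * (q * (#|[pred a in B | shrink (m * step) a == c]| *
        #|[pred a in B' | shrink (m * step) a == c']|))%:R)%:E.
  by rewrite -hq -head_pair_law.
have densityE : weight (m * step) * #|[pred x : index (m * step) |
     [&& digits_of n x == c, digits_of n' x == c' & x.1 \in blf (m * step)]]|%:R =
   weight (t * step) * (q * (#|[pred a : 'M[F]_(s, t * step) | shrink (m * step) a == c]| *
        #|[pred a : 'M[F]_(s, t * step) | shrink (m * step) a == c']|))%:R.
  apply: EFin_inj; have := pairE predT predT => <-.
  have := head_pair_law n n' (pred1 c) (pred1 c') => <-.
  congr (P _); apply/funext => w /=; rewrite !inE /= !shrink_head//.
rewrite !cellE pairE !digit_law_uniform /pair_density densityE -!EFinM.
have := card_fiber mt c; have := card_fiber mt c'.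
have N0 : #|{: 'M[F]_(s, t * step)}|%:R != 0 :> R by rewrite pnatr_eq0 (cardD1 0) inE.
have N1 : #|{: 'M[F]_(s, m * step)}|%:R != 0 :> R by rewrite pnatr_eq0 (cardD1 0) inE.
rewrite !natrM => /(canRL (divfK N0)) -> /(canRL (divfK N0)) ->.
by congr EFin; field; rewrite N0 N1.
Qed.

End PairLaw.

(** * The variance of the estimator *)

Section Centering.
Context d (T : measurableType d) (R : realType) (mu : probability T R).
Variables (D : set T) (h : T -> R) (a : R).
Hypotheses (mD : measurable D) (ih : mu.-integrable D (EFin \o h))
  (ih2 : mu.-integrable D (EFin \o (fun x => h x ^+ 2))).

Let icst (k : R) : mu.-integrable D (EFin \o cst k).
Proof. exact: finite_measure_integrable_cst. Qed.

Let sqrE : (fun x => ((h x - a) ^+ 2)%:E) =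
  (fun x => (h x ^+ 2)%:E + ((- (2 * a))%:E * (h x)%:E + (a ^+ 2)%:E))%E.
Proof. by apply/funext => x; rewrite -!EFinM -!EFinD; congr EFin; ring. Qed.

Let ilin : mu.-integrable D (fun x => (- (2 * a))%:E * (h x)%:E)%E.
Proof. exact: (integrableZl mD (- (2 * a)) ih). Qed.

Lemma integrable_centered_sqr :
  mu.-integrable D (fun x => ((h x - a) ^+ 2)%:E).
Proof.
rewrite sqrE; apply: (integrableD mD ih2); apply: (integrableD mD ilin).
exact: (icst (a ^+ 2)).
Qed.

Lemma integral_centered_sqr :
  (\int[mu]_(x in D) ((h x - a) ^+ 2)%:E =
   (fine (\int[mu]_(x in D) (h x ^+ 2)%:E) -
    2 * a * fine (\int[mu]_(x in D) (h x)%:E) + a ^+ 2 * fine (mu D))%:E)%E.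
Proof.
rewrite sqrE integralD//; last exact: (integrableD mD ilin (icst (a ^+ 2))).
rewrite integralD//; last exact: (icst (a ^+ 2)).
rewrite integralZl// integral_cst//.
rewrite -(fineK (integrable_fin_num mD ih)) -(fineK (integrable_fin_num mD ih2)).
have muD : mu D \is a fin_num by exact: fin_num_measure.
rewrite [X in ((a ^+ 2)%:E * X)%E](_ : _ = (fine (mu D))%:E) ?[RHS]fineK// -!EFinM -!EFinD; congr EFin => /=.
by rewrite mulNr addrA.
Qed.

End Centering.

Lemma cauchy_schwarz_cell d (T : measurableType d) (R : realType)
    (mu : probability T R) (D : set T) (h : T -> R) (p : R) :
  measurable D -> mu.-integrable D (EFin \o h) ->
  mu.-integrable D (EFin \o (fun x => h x ^+ 2)) -> 0 < p -> mu D = p%:E ->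
  fine (\int[mu]_(x in D) (h x)%:E) ^+ 2 / p <=
  fine (\int[mu]_(x in D) (h x ^+ 2)%:E).
Proof.
move=> mD ih ih2 p0 muD; set A := fine _; set B := fine _.
have : (0 <= \int[mu]_(x in D) ((h x - A / p) ^+ 2)%:E)%E.
  by apply: integral_ge0 => x _; rewrite lee_fin sqr_ge0.
rewrite integral_centered_sqr// muD /= -/A -/B lee_fin -subr_ge0 subr0.
rewrite (_ : _ - _ + _ = B - A ^+ 2 / p); first by rewrite subr_ge0.
by field; rewrite gt_eqF.
Qed.

Section Variance.
Context d (Omega : measurableType d) (R : realType) (P : probability Omega R).
Variables (b s : nat) (S : gns b s) (Z : coarse_scrambling P b (gns_deg S)) (m : nat).
Hypotheses (b_prime : prime b).
Variable f : s.-tuple (measurableTypeR R) -> R.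
Hypothesis f2 : L2_cube f.
Local Notation e := (gns_deg S).
Local Notation G := (digit_space b s).
Local Notation K := (m * step S)%N.
Local Notation mu := (digit_law Z m b_prime).
Local Notation N := (#|{: 'M['F_b]_(s, K)}|%:R : R).
Local Notation blf := (block_lower_family (F := 'F_b) (K := K) e).
Local Notation weight := (@trunc_weight R b s e K).
Local Notation index := ({ffun 'I_s -> 'M['F_b]_K} * 'M['F_b]_(s, K))%type.
Local Notation Y := (scrambled_digits Z).

Let N_neq0 : N != 0. Proof. by rewrite pnatr_eq0 (cardD1 0) inE. Qed.
Let N_gt0 : 0 < N. Proof. by rewrite lt_neqAle eq_sym N_neq0 ler0n. Qed.

Let weight_card : weight * #|blf|%:R = N^-1.
Proof.
apply: (mulIf N_neq0); rewrite mulVf// -mulrA.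
exact: (weight_normalized Z m b_prime m).
Qed.

Let weight_ge0 : 0 <= weight.
Proof.
rewrite leNgt; apply/negP => w0.
have : weight * #|blf|%:R <= 0 by rewrite mulr_le0_ge0// ltW.
by rewrite weight_card leNgt invr_gt0 N_gt0.
Qed.

Definition centered (z : G) : R := f (point_of R z) - cube_integral f.
Local Notation H := centered.

Lemma centered_integrals :
  [/\ measurable_fun setT H, mu.-integrable setT (EFin \o H),
      mu.-integrable setT (EFin \o (fun z => H z ^+ 2)),
      (\int[mu]_z (H z)%:E = 0)%E &
      (\int[mu]_z (H z ^+ 2)%:E = (sigma2_MC f)%:E)%E].
Proof.
have [mF iF iF2 EF EF2] := L2_cube_point b_prime (step_gt0 S)
  (@digit_law_uniform _ _ _ _ _ _ _ Z m b_prime) f2.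
have icst : mu.-integrable setT (EFin \o cst (cube_integral f)).
  exact: finite_measure_integrable_cst.
split.
- exact: measurable_funB.
- exact: (integrableB measurableT iF icst).
- exact: (integrable_centered_sqr (cube_integral f) measurableT iF iF2).
- rewrite (integralB_EFin measurableT iF icst) EF.
  have := integral_cst mu measurableT (cube_integral f)%:E.
  rewrite [X in (_ * X)%E](_ : _ = 1%E) ?mule1; last exact: probability_setT.
  by move=> /= ->; rewrite subee.
- rewrite (integral_centered_sqr (cube_integral f) measurableT iF iF2) EF EF2.
  rewrite [X in _ ^+ 2 * fine X](_ : _ = 1%E) /=; last exact: probability_setT.
  by congr EFin; rewrite /sigma2_MC; ring.
Qed.

Local Notation cell c := (head K @^-1` [set c] : set G).

Lemma sum_cells (h : G -> R) : mu.-integrable setT (EFin \o h) ->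
  \sum_c fine (\int[mu]_(z in cell c) (h z)%:E) = fine (\int[mu]_z (h z)%:E).
Proof.
move=> ih.
have cover : [set: G] = \big[setU/set0]_(c <- enum {: 'M['F_b]_(s, K)}) cell c.
  apply/seteqP; split=> // z _; rewrite -bigcup_seq.
  by exists (head K z) => //=; rewrite mem_enum.
apply: EFin_inj; rewrite fineK; last exact: integrable_fin_num.
rewrite cover integral_bigsetU_EFin//=; last 4 first.
- by move=> c; exact: measurable_head.
- exact: enum_uniq.
- by move=> c c' _ _ /= [z [/= <- <-]].
- by rewrite -cover; apply/measurable_EFinP; have /integrableP[/measurable_EFinP] := ih.
rewrite -sumEFin big_enum /=; apply: eq_bigr => c _; rewrite fineK//.
apply: integrable_fin_num; first exact: measurable_head.
by apply: integrableS ih => //; exact: measurable_head.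
Qed.

(** The mean of the centered integrand over the points that start with [c]. *)
Definition average (c : 'M['F_b]_(s, K)) : R :=
  N * fine (\int[mu]_(z in cell c) (H z)%:E).

Lemma sum_average : \sum_c average c = 0.
Proof.
have [_ iH _ EH _] := centered_integrals.
by rewrite -mulr_sumr sum_cells// EH mulr0.
Qed.

Lemma sum_average_sqr : (\sum_c average c ^+ 2) / N <= sigma2_MC f.
Proof.
have [_ iH iH2 _ EH2] := centered_integrals.
rewrite -[leRHS]/(fine (sigma2_MC f)%:E) -EH2 -sum_cells// mulr_suml.
apply: ler_sum => c _.
have Nc : mu (cell c) = (N^-1)%:E.
  have := @digit_law_uniform _ _ _ _ _ _ _ Z m b_prime m (pred1 c).
  rewrite card1 mul1r => <-; congr (mu _); apply/funext => z /=.
  by rewrite inE; apply/propext; split=> /eqP.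
have Nc0 : 0 < N^-1 by rewrite invr_gt0.
have mc : measurable (cell c) by exact: measurable_head.
have := cauchy_schwarz_cell mc (integrableS measurableT mc (@subsetT _ _) iH)
  (integrableS measurableT mc (@subsetT _ _) iH2) Nc0 Nc.
by apply: le_trans; rewrite /average le_eqVlt; apply/orP; left; apply/eqP; field.
Qed.

Lemma sigma2_ge0 : 0 <= sigma2_MC f.
Proof.
apply: le_trans sum_average_sqr; rewrite divr_ge0 ?ler0n//.
by apply: sumr_ge0 => c _; exact: sqr_ge0.
Qed.

Lemma integrable_point n : P.-integrable setT (fun w => (H (Y (n : 'I_(b ^ m)) w))%:E) /\
  (\int[P]_w (H (Y n w))%:E = 0)%E.
Proof.
have [_ iH _ EH _] := centered_integrals.
by have := integral_comp_law (X := Y n) (scrambled_digits_law Z b_prime n) iH; rewrite EH.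
Qed.

Lemma integrable_point_sqr n : P.-integrable setT (fun w => (H (Y (n : 'I_(b ^ m)) w) ^+ 2)%:E) /\
  (\int[P]_w (H (Y n w) ^+ 2)%:E = (sigma2_MC f)%:E)%E.
Proof.
have [_ _ iH2 _ EH2] := centered_integrals.
by have := integral_comp_law (X := Y n) (scrambled_digits_law Z b_prime n) iH2; rewrite EH2.
Qed.

Lemma integrable_pair (n n' : 'I_(b ^ m)) :
  P.-integrable setT (fun w => (H (Y n w) * H (Y n' w))%:E).
Proof.
have [i1 _] := integrable_point_sqr n; have [i2 _] := integrable_point_sqr n'.
have [mH _ _ _ _] := centered_integrals.
apply: (le_integrable measurableT _ _ (integrableD measurableT i1 i2)) => [|w _].
  apply/measurable_EFinP; apply: measurable_funM;
    by apply: (measurableT_comp mH); exact: measurable_scrambled_digits.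
rewrite -EFinD /= lee_fin normrM [leRHS]ger0_norm ?addr_ge0 ?sqr_ge0//.
rewrite -(real_normK (num_real (H (Y n w)))) -(real_normK (num_real (H (Y n' w)))).
have := sqr_ge0 (`|H (Y n w)| - `|H (Y n' w)|).
have : 0 <= `|H (Y n w)| * `|H (Y n' w)| by rewrite mulr_ge0.
rewrite !expr2; nra.
Qed.

(** Given their first digits, two distinct points are independent, so that the
    integrand may be replaced by its conditional means. *)
Lemma pair_expectation (n n' : 'I_(b ^ m)) : n != n' ->
  (\int[P]_w (H (Y n w) * H (Y n' w))%:E =
   (weight * \sum_(x : index | x.1 \in blf)
      average (digits_of n x) * average (digits_of n' x))%:E)%E.
Proof.
move=> nn'; have [mH iH _ _ _] := centered_integrals.
have mHH : measurable_fun setT (fun z : G * G => (H z.1 * H z.2)%:E).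
  apply/measurable_EFinP; apply: measurable_funM.
    by apply: (measurableT_comp mH); exact: measurable_fst.
  by apply: (measurableT_comp mH); exact: measurable_snd.
have [iHH <-] := integral_digit_pair (Z := Z) b_prime mHH (integrable_pair n n').
rewrite (integral_pair_cells (mu := mu) (tau := head K) (w := pair_density R n n') _ _ _ iH iHH).
- congr EFin; rewrite (partition_big (fun x => (digits_of n x, digits_of n' x)) predT)//=.
  rewrite mulr_sumr; apply: eq_bigr => -[c c'] _ /=.
  rewrite (eq_bigr (fun=> average c * average c')) => [|x /andP[_ /eqP[-> ->]]//].
  rewrite sumr_const -mulr_natl.
  rewrite (@eq_card _ _ [pred x : index | [&& digits_of n x == c, digits_of n' x == c' & x.1 \in blf]]) => [|x]; last first.
    by rewrite unfold_in /= xpair_eqE [in RHS]inE andbC andbA.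
  pose A c0 := fine (\int[mu]_(z in cell c0) (H z)%:E)%E.
  transitivity (pair_density R n n' c c' * (A c * A c')); first by [].
  by rewrite /pair_density /average -/(A c) -/(A c'); ring.
- exact: measurable_head.
- move=> c c'; rewrite mulr_ge0// ?sqr_ge0// mulr_ge0//.
- by move=> c c' C C' hC hC'; exact: pair_cell_law.
Qed.

(** The terms that [pair_expectation] would give for [n = n'], needed to complete
    the double sum into a square. *)
Lemma diagonal_expectation (n : 'I_(b ^ m)) :
  weight * \sum_(x : index | x.1 \in blf) average (digits_of n x) * average (digits_of n x) =
  (\sum_c average c ^+ 2) / N.
Proof.
rewrite (eq_bigl (fun x : index => (x.1 \in blf) && true)) => [|x]; last by rewrite andbT.
rewrite -(pair_big_dep (fun A => A \in blf) (fun _ _ => true)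
  (fun A delta => average (digits_of n (A, delta)) * average (digits_of n (A, delta)))) /=.
rewrite (eq_bigr (fun=> \sum_c average c ^+ 2)) => [|A _]; last first.
  by rewrite [RHS](reindex_inj (addrI (act A (gen_map S K (index_digits n))))).
rewrite sumr_const -[X in weight * X]mulr_natl mulrA [RHS]mulrC.
by congr (_ * _); exact: weight_card.
Qed.

Variable C : R.
Hypothesis gain : \prod_j (b ^ e j)%:R <= C * \prod_j (b ^ e j - 1)%:R.

Let prod_pred_gt0 : 0 < \prod_j (b ^ e j - 1)%:R :> R.
Proof.
apply: prodr_gt0 => j _; rewrite ltr0n subn_gt0 -(exp1n (e j)) ltn_exp2r ?prime_gt1//.
exact: gns_deg_gt0.
Qed.

Lemma gain_ge1 : 1 <= C.
Proof.
rewrite -(ler_pM2r prod_pred_gt0) mul1r; apply: le_trans gain.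
by apply: ler_prod => j _; rewrite ler0n ler_nat leq_subr.
Qed.

(** The averages have mean zero, so [random_subspace_bound] leaves only the nonzero
    frequencies, for which [card_unseen_frequency] provides the constant. *)
Lemma quadratic_bound :
  weight * \sum_(x : index | x.1 \in blf)
    (\sum_(n < b ^ m) average (digits_of n x)) ^+ 2 <=
  (b ^ m)%:R * (C * ((\sum_c average c ^+ 2) / N)).
Proof.
pose L (A : {ffun 'I_s -> 'M['F_b]_K}) : {linear 'rV['F_b]_m -> 'M['F_b]_(s, K)} :=
  act A \o gen_map S K.
have cardU : #|{: 'rV['F_b]_m}| = (b ^ m)%N by rewrite card_mx card_Fp// mul1n.
have := @random_subspace_bound R 'F_b s K m average _ blf L C.
rewrite sum_average cardU expr0n /= mulr0 mul0r add0r subr0 => bound.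
have {}bound := bound _.
have -> : \sum_(x : index | x.1 \in blf) (\sum_(n < b ^ m) average (digits_of n x)) ^+ 2 =
    \sum_(A in blf) \sum_D (\sum_(u : 'rV['F_b]_m) average (act A (gen_map S K u) + D)) ^+ 2.
  rewrite (eq_bigl (fun x : index => (x.1 \in blf) && true)) => [|x]; last by rewrite andbT.
  rewrite -(pair_big_dep (fun A => A \in blf) (fun _ _ => true)
    (fun A delta => (\sum_(n < b ^ m) average (digits_of n (A, delta))) ^+ 2)) /=.
  apply: eq_bigr => A _; apply: eq_bigr => D _; congr (_ ^+ 2).
  by rewrite [RHS](reindex (@index_digits b m))//; exact/onW_bij/index_digits_bij.
apply: le_trans (_ : weight * (#|blf|%:R * (b ^ m)%:R * (C * \sum_x average x ^+ 2)) <= _).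
  apply: ler_wpM2l => //; apply: bound => chi chi0.
  rewrite -(ler_pM2r prod_pred_gt0) -!natr_prod -!natrM.
  apply: le_trans (_ : (\prod_j b ^ e j * #|blf|)%:R <= _).
    by rewrite ler_nat; exact: (card_unseen_frequency m b_prime (dvdn_step S m) chi0).
  rewrite natrM natr_prod mulrAC; apply: ler_wpM2r => //.
  by rewrite natr_prod.
by rewrite !mulrA weight_card le_eqVlt; apply/orP; left; apply/eqP; ring.
Qed.

Let pow_neq0 : b%:R ^+ m != 0 :> R.
Proof. by rewrite -natrX pnatr_eq0 -lt0n pow_gt0. Qed.

Lemma estimator_centered w : estimator Z m f w =
  cube_integral f + (b%:R ^+ m)^-1 * \sum_(n < b ^ m) H (Y n w).
Proof.
rewrite /centered sumrB sumr_const card_ord -[cube_integral f *+ _]mulr_natl natrX.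
by rewrite mulrBr mulKf// addrC subrK.
Qed.

Lemma integral_squared_error : let q : R := (b%:R ^+ m)^-1 in
  (\int[P]_w ((estimator Z m f w - cube_integral f) ^+ 2)%:E =
   (q ^+ 2 * \sum_(p : 'I_(b ^ m) * 'I_(b ^ m))
       fine (\int[P]_w (H (Y p.1 w) * H (Y p.2 w))%:E))%:E)%E.
Proof.
move=> q.
rewrite (eq_integral (fun w => (q ^+ 2)%:E * \sum_(p : 'I_(b ^ m) * 'I_(b ^ m))
    (H (Y p.1 w) * H (Y p.2 w))%:E)%E) => [|w _].
  rewrite integralZl//; last by apply: integrable_sum => // p _; exact: integrable_pair.
  rewrite integral_sum//; last by move=> p; exact: integrable_pair.
  rewrite [RHS]EFinM -sumEFin; congr (_ * _)%E; apply: eq_bigr => p _.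
  by rewrite fineK// integrable_fin_num//; exact: integrable_pair.
rewrite sumEFin -EFinM; congr EFin.
rewrite -(pair_big xpredT xpredT (fun n n' : 'I_(b ^ m) => H (Y n w) * H (Y n' w)))/=.
rewrite -big_distrlr /= -expr2 -exprMn; congr (_ ^+ 2).
by rewrite estimator_centered addrC addKr.
Qed.

Lemma expectation_estimator : ('E_P[estimator Z m f] = (cube_integral f)%:E)%E.
Proof.
pose q : R := b%:R ^+ m.
have iH : P.-integrable setT (fun w => (q^-1)%:E * \sum_(n < b ^ m) (H (Y n w))%:E)%E.
  apply: integrableZl => //; apply: integrable_sum => // n _.
  by case: (integrable_point n).
rewrite unlock (eq_integral (fun w => (cst (cube_integral f)%:E w +
    (q^-1)%:E * \sum_(n < b ^ m) (H (Y n w))%:E)%E)) => [|w _].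
  rewrite integralD//; last exact: finite_measure_integrable_cst.
  rewrite integral_cst// [X in (_ * X + _)%E](_ : _ = 1%E); last exact: probability_setT.
  rewrite mule1 integralZl//; last first.
    by apply: integrable_sum => // n _; case: (integrable_point n).
  rewrite integral_sum//; last by move=> n; case: (integrable_point n).
  rewrite big1 ?mule0 ?adde0// => n _.
  by case: (integrable_point n).
rewrite sumEFin -EFinM -EFinD; congr EFin.
exact: estimator_centered.
Qed.

(** The diagonal of the double sum contributes [sigma2_MC f] where the quadratic
    form has the variance [G2 <= sigma2_MC f] of the averages; since [1 <= C], the
    excess is absorbed. *)
Lemma variance_bound :
  ('V_P[estimator Z m f] <= (C / b%:R ^+ m * sigma2_MC f)%:E)%E.
Proof.
have q0 : 0 < b%:R ^+ m :> R by rewrite -natrX ltr0n pow_gt0.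
rewrite /variance covariance.unlock expectation_estimator expectation.unlock /=.
rewrite (eq_integral (fun w => ((estimator Z m f w - cube_integral f) ^+ 2)%:E)) => [|w _]; last first.
  by rewrite expr2.
rewrite integral_squared_error lee_fin.
pose Q : R := weight * \sum_(x : index | x.1 \in blf)
    (\sum_(n < b ^ m) average (digits_of n x)) ^+ 2.
pose G2 : R := (\sum_c average c ^+ 2) / N.
have -> : \sum_(p : 'I_(b ^ m) * 'I_(b ^ m))
    fine (\int[P]_w (H (Y p.1 w) * H (Y p.2 w))%:E)%E =
    (b ^ m)%:R * (sigma2_MC f - G2) + Q.
  pose D (n n' : 'I_(b ^ m)) : R := weight * \sum_(x : index | x.1 \in blf)
      average (digits_of n x) * average (digits_of n' x).
  have -> : Q = \sum_(p : 'I_(b ^ m) * 'I_(b ^ m)) D p.1 p.2.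
    rewrite -mulr_sumr exchange_big; congr (_ * _); apply: eq_bigr => x _ /=.
    by rewrite expr2 big_distrlr -(pair_big xpredT xpredT (fun n n' : 'I_(b ^ m) => average (digits_of n x) * average (digits_of n' x))).
  apply/eqP; rewrite -subr_eq -sumrB; apply/eqP.
  rewrite -(pair_big xpredT xpredT (fun n n' : 'I_(b ^ m) => fine (\int[P]_w (H (Y n w) * H (Y n' w))%:E)%E - D n n')) /=.
  rewrite (eq_bigr (fun=> sigma2_MC f - G2)) => [|n _].
    by rewrite sumr_const card_ord mulr_natl.
  rewrite (bigD1 n)//= big1 ?addr0 => [|n' n'n].
    rewrite [D n n]diagonal_expectation; congr (_ - _).
    rewrite (eq_integral (fun w => (H (Y n w) ^+ 2)%:E)) => [|w _]; last by rewrite expr2.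
    by have [_ ->] := integrable_point_sqr n.
  by rewrite pair_expectation 1?eq_sym// subrr.
have G2s : G2 <= sigma2_MC f := sum_average_sqr.
have QG : Q <= (b ^ m)%:R * (C * G2) := quadratic_bound.
have C1 := gain_ge1.
move: q0 QG; rewrite -natrX; set B : R := (b ^ m)%:R => B0 QG.
apply: (@le_trans _ _ (B^-1 ^+ 2 * (B * (sigma2_MC f - G2) + B * (C * G2)))).
  by apply: ler_wpM2l; rewrite ?sqr_ge0// lerD2l.
rewrite (_ : _ * _ = B^-1 * (sigma2_MC f - G2 + C * G2)); last first.
  by field; rewrite gt_eqF.
rewrite (_ : C / B * _ = B^-1 * (C * sigma2_MC f)); last by ring.
apply: ler_wpM2l; first by rewrite invr_ge0 ltW.
have : 0 <= (C - 1) * (sigma2_MC f - G2) by rewrite mulr_ge0 ?subr_ge0.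
by lra.
Qed.

End Variance.

Theorem lemma3p3 (R : realType) (b s m : nat) (beta : R)
    (d : measure_display) (Omega : measurableType d) (P : probability Omega R)
    (S : gns b s) (Z : coarse_scrambling P b (gns_deg S)) :
  prime b -> (0 < s)%N -> (0 < m)%N -> 0 < beta ->
  reduced (fun n => ln n%:R `^ (1 + beta)) S ->
  forall f : s.-tuple (measurableTypeR R) -> R, L2_cube f ->
    ('V_P[estimator Z m f] <=
       max_gain Z m / (b%:R ^+ m)%:E * (sigma2_MC f)%:E)%E /\
    (max_gain Z m / (b%:R ^+ m)%:E * (sigma2_MC f)%:E <=
       (expR (2 + (2 * ln 2 `^ (1 + beta))^-1 + (beta * ln 2 `^ beta)^-1)
          / b%:R ^+ m * sigma2_MC f)%:E)%E.
Proof.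
move=> b_prime _ _ beta_gt0 red f f2.
set C := expR _.
have gain := gain_le_constant b_prime beta_gt0 red.
have q_gt0 : 0 < b%:R ^+ m :> R by rewrite exprn_gt0// ltr0n prime_gt0.
have var_fin g : L2_cube g -> exists2 v : R, ('V_P[estimator Z m g] = v%:E)%E &
    v <= C / b%:R ^+ m * sigma2_MC g.
  move=> g2; have := variance_bound Z m b_prime g2 gain; have := variance_ge0 P (estimator Z m g).
  case: ('V_P[estimator Z m g])%E => [v||] //= _; rewrite lee_fin => v_le.
  by exists v.
have gain_le : (max_gain Z m <= C%:E)%E.
  apply: ge_ereal_sup => _ [g [g2 sg0] <-].
  have sg : 0 < sigma2_MC g by rewrite lt_neqAle eq_sym sg0 (sigma2_ge0 Z m b_prime g2).
  have qsg : 0 < (b%:R ^+ m)^-1 * sigma2_MC g by rewrite mulr_gt0// invr_gt0.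
  have [v -> v_le] := var_fin g g2.
  rewrite inver gt_eqF// -EFinM lee_fin ler_pdivrMr//.
  by rewrite mulrA.
have [sf0|sf0] := eqVneq (sigma2_MC f) 0.
  have [v -> ] := var_fin f f2; rewrite sf0 mulr0 mule0 !lee_fin => v_le.
  by split.
have sf : 0 < sigma2_MC f by rewrite lt_neqAle eq_sym sf0 (sigma2_ge0 Z m b_prime f2).
have qsf : 0 < (b%:R ^+ m)^-1 * sigma2_MC f by rewrite mulr_gt0// invr_gt0.
have [v Vf v_le] := var_fin f f2.
have : ('V_P[estimator Z m f] / ((b%:R ^+ m)^-1 * sigma2_MC f)%:E <= max_gain Z m)%E.
  by apply: ereal_sup_ubound; exists f.
rewrite Vf inver gt_eqF// -EFinM.
case: (max_gain Z m) gain_le => [M||] //= M_le; rewrite !lee_fin in M_le *.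
rewrite ler_pdivrMr// => v_leM.
rewrite inver gt_eqF// -!EFinM !lee_fin -!mulrA; split=> //.
by rewrite ler_pM2r.
Qed.
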